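(* Let $X_a,X_b,X_c$ be smooth tangent vector fields on a manifold $\mathfrak{M}$ satisfying $[X_a,X_b]=2X_a$, $[X_a,X_c]=-X_b$, $[X_b,X_c]=2X_c$, and let $u_a,u_b,u_c:[0,T]\to\mathbb{R}$ be fixed measurable functions. Consider the differential equation $$\dot x(t)=u_c(t)X_c+u_b(t)X_b+u_a(t)X_a,\qquad x(0)=x_0\in\mathfrak{M},$$ whose solution is (locally) of the form $$x(t)=\exp(\Xi_c(t)X_c)\exp(\Xi_b(t)X_b)\exp(\Xi_a(t)X_a)(x_0),\qquad( * )$$ where $\Xi_d(t)=\Upsilon^t(S^d)$ for $d=a,b,c$, with $$S^a=a\cdot\exp_{\sqcup}(2S_{\mathfrak{a}_1}),\qquad S^b=S_{\mathfrak{a}_1},\qquad S^c=\exp_{\sqcup}(2S_{\mathfrak{a}_1})\cdot c,$$ and $S_{\mathfrak{a}_1}\in\mathbb{R}\langle\langle\mathrm{A}\rangle\rangle$, $\mathrm{A}=\{a,b,c\}$, is the unique solution of the algebraic equation $S_{\mathfrak{a}_1}=b-a\cdot\exp_{\sqcup}(2S_{\mathfrak{a}_1})\cdot c$. If $|u_d|\le M$ for an $M>0$ ($d=a,b,c$), then the solution $( * )$ exists for $0\le t<\min\{T,1/M\}$.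
   Context: $\mathbb{R}\langle\langle\mathrm{A}\rangle\rangle$ is the algebra of noncommutative formal series with real coefficients on words over the alphabet $\mathrm{A}=\{a,b,c\}$, with concatenation product $\cdot$ and empty word $1$. The shuffle product $\sqcup$ is the bilinear commutative product determined on words by $1\sqcup w=w\sqcup 1=w$ and $(vy)\sqcup(wz)=(v\sqcup(wz))\cdot y+((vy)\sqcup w)\cdot z$ for letters $y,z$ and words $v,w$. For a series $S$ with zero constant term, $\exp_{\sqcup}(S)=\sum_{k\ge0}S^{\sqcup k}/k!$, where $S^{\sqcup0}=1$ and $S^{\sqcup k}=S\sqcup S^{\sqcup(k-1)}$. $S_k$ denotes the part of $S$ supported on words of length $k$. $\Upsilon^t$ is the linear map on noncommutative polynomials given by $\Upsilon^t(1)=1$ and $\Upsilon^t(vd)=\int_0^t\Upsilon^s(v)\,u_d(s)\,ds$ for words $v$ and letters $d\in\{a,b,c\}$; for a series, $\Upsilon^t(S)=\sum_{k\ge0}\Upsilon^t(S_k)$ whenever this converges. $\exp(rX)$ denotes the time-$r$ flow of the vector field $X$.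
   Formalization: The series converge on all of [0,min{T,1/M}); since the fields may be incomplete, ( * ) is shown to exist for small t, and to be the unique solution on any initial interval where its flows are defined. In ( * ) the flow of X_c acts on x_0 first. *)

(* Defs.v *)
From HB Require Import structures.
From mathcomp Require Import all_boot all_order all_algebra.
From mathcomp Require Import all_classical all_reals all_analysis.

Set Implicit Arguments.
Unset Strict Implicit.
Unset Printing Implicit Defensive.

Import Order.TTheory GRing.Theory Num.Theory.
Import numFieldNormedType.Exports.

Local Open Scope classical_set_scope.
Local Open Scope ring_scope.

Inductive letter := La | Lb | Lc.

Definition ord_of_letter (d : letter) : 'I_3 :=
  match d with La => inord 0 | Lb => inord 1 | Lc => inord 2 end.

Definition letter_of_ord (i : 'I_3) : letter :=
  match val i with 0%N => La | 1%N => Lb | _ => Lc end.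

Lemma ord_of_letterK : cancel ord_of_letter letter_of_ord.
Proof. by case; rewrite /letter_of_ord /= inordK. Qed.

HB.instance Definition _ := Countable.copy letter (can_type ord_of_letterK).
HB.instance Definition _ := Finite.copy letter (can_type ord_of_letterK).

Notation word := (seq letter).

Definition ncseries (R : Type) := word -> R.

(* The shuffle recursion peels off last letters, hence the reversals: here
   words are read from right to left, so that the head is the last letter.
   The result lists the terms of the shuffle with their multiplicities. *)
Fixpoint shuffle_rev (v : word) : word -> seq word :=
  match v with
  | [::] => fun w => [:: w]
  | y :: v' =>
    fix shuffle_aux (w : word) : seq word :=
      match w with
      | [::] => [:: v]
      | z :: w' => [seq y :: r | r <- shuffle_rev v' w] ++
                   [seq z :: r | r <- shuffle_aux w']
      end
  end.

Definition shuffle_word (v w : word) : seq word :=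
  [seq rev r | r <- shuffle_rev (rev v) (rev w)].

Section Series.
Variable R : realType.
Implicit Types S U : ncseries R.

Definition ser_one : ncseries R := fun w => (w == [::])%:R.

Definition ser_letter (d : letter) : ncseries R := fun w => (w == [:: d])%:R.

Definition ser_concat S U : ncseries R :=
  fun w => \sum_(i < (size w).+1) S (take i w) * U (drop i w).

(* Only pairs (v, v') with |v| + |v'| = |w| contribute to the coefficient
   of w. *)
Definition ser_shuffle S U : ncseries R := fun w =>
  \sum_(i < (size w).+1) \sum_(v : i.-tuple letter)
    \sum_(v' : (size w - i).-tuple letter)
      S v * U v' * (count_mem (w : word) (shuffle_word v v'))%:R.

Fixpoint ser_shuffle_pow S (k : nat) : ncseries R :=
  if k is k'.+1 then ser_shuffle S (ser_shuffle_pow S k') else ser_one.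

(* For S without constant term, the k-th shuffle power of S vanishes on the
   words of length less than k, so the sum over all k stops at |w|. *)
Definition ser_shuffle_exp S : ncseries R :=
  fun w => \sum_(k < (size w).+1) (k`!%:R)^-1 * ser_shuffle_pow S k w.

Definition exp_shuffle2 S : ncseries R :=
  ser_shuffle_exp (fun w => 2 * S w).

Definition Sa1_equation S : Prop :=
  S = (fun w => ser_letter Lb w -
         ser_concat (ser_concat (ser_letter La) (exp_shuffle2 S))
                    (ser_letter Lc) w).

Definition coord_series S (d : letter) : ncseries R :=
  match d with
  | La => ser_concat (ser_letter La) (exp_shuffle2 S)
  | Lb => S
  | Lc => ser_concat (exp_shuffle2 S) (ser_letter Lc)
  end.

Variable u : letter -> R -> R.

Fixpoint upsilon_rev (w : word) (t : R) : R :=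
  if w is d :: v
  then \int[@lebesgue_measure R]_(s in `[0, t]) (upsilon_rev v s * u d s)
  else 1.

Definition upsilon_word (t : R) (w : word) : R := upsilon_rev (rev w) t.

Definition upsilon_homog (t : R) S (k : nat) : R :=
  \sum_(w : k.-tuple letter) S w * upsilon_word t w.

Definition upsilon_cvg (t : R) S : Prop :=
  cvgn (series (upsilon_homog t S)).

Definition upsilon (t : R) S : R := limn (series (upsilon_homog t S)).

End Series.

Fixpoint Ck_on (R : realType) (n m : nat) (k : nat) (D : set 'rV[R]_n)
    (f : 'rV[R]_n -> 'rV[R]_m) : Prop :=
  match k with
  | 0 => forall z, D z -> {for z, continuous f}
  | k'.+1 => (forall z, D z -> differentiable f z) /\
             (forall v, Ck_on k' D ('D_v f))
  end.

Definition smooth_on (R : realType) (n m : nat) (D : set 'rV[R]_n)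
    (f : 'rV[R]_n -> 'rV[R]_m) : Prop :=
  forall k, Ck_on k D f.

(* chart and chart_inv are total functions, relevant only on chart_dom i and
   on its image. The atlas need not be maximal. *)
Record smooth_manifold (R : realType) (n : nat) (E : topologicalType) :=
  SmoothManifold {
  chart_index : Type;
  chart_dom : chart_index -> set E;
  chart : chart_index -> E -> 'rV[R]_n;
  chart_inv : chart_index -> 'rV[R]_n -> E;
  manifold_hausdorff : hausdorff_space E;
  manifold_second_countable : @second_countable E;
  chart_dom_open : forall i, open (chart_dom i);
  chart_dom_cover : forall p, exists i, chart_dom i p;
  chart_image_open : forall i, open (chart i @` chart_dom i);
  chartK : forall i p, chart_dom i p -> chart_inv i (chart i p) = p;
  chart_continuous : forall i p, chart_dom i p ->
    {for p, continuous (chart i)};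
  chart_inv_continuous : forall i z, (chart i @` chart_dom i) z ->
    {for z, continuous (chart_inv i)};
  transition_smooth : forall i j,
    smooth_on (chart i @` (chart_dom i `&` chart_dom j))
              (chart j \o chart_inv i)
}.

Arguments chart_dom {R n E} _ _.
Arguments chart {R n E} _ _ _.
Arguments chart_inv {R n E} _ _ _.

Section VectorFields.
Variables (R : realType) (n : nat) (E : topologicalType).
Variable A : smooth_manifold R n E.

(* X i z is the vector of components, in the chart i, of the field at the
   point with coordinates z. *)
Definition local_field := chart_index A -> 'rV[R]_n -> 'rV[R]_n.

Definition smooth_vector_field (X : local_field) : Prop :=
  (forall i, smooth_on (chart A i @` chart_dom A i) (X i)) /\
  (forall i j p, chart_dom A i p -> chart_dom A j p ->
     X j (chart A j p) =
     'D_(X i (chart A i p)) (chart A j \o chart_inv A i) (chart A i p)).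

Definition eq_field (X Y : local_field) : Prop :=
  forall i p, chart_dom A i p -> X i (chart A i p) = Y i (chart A i p).

Definition scale_field (r : R) (X : local_field) : local_field :=
  fun i z => r *: X i z.

(* Local expression of the commutator X Y - Y X of derivations. *)
Definition lie_bracket (X Y : local_field) : local_field :=
  fun i z => 'D_(X i z) (Y i) z - 'D_(Y i z) (X i) z.

Definition integral_curve (X : local_field) (J : set R) (g : R -> E) : Prop :=
  forall s, J s -> {for s, continuous g} /\
    forall i, chart_dom A i (g s) ->
      is_derive s (1 : R) (chart A i \o g) (X i (chart A i (g s))).

(* Graph of the time-r flow exp(rX), a partial map since X need not be
   complete. *)
Definition flow (X : local_field) (r : R) (p q : E) : Prop :=
  exists (g : R -> E) (l h : R),
    [/\ l < 0 < h, l < r < h, integral_curve X `]l, h[ g, g 0 = p & g r = q].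

(* Graph of exp(rc Xc) exp(rb Xb) exp(ra Xa). Flows are multiplied as
   operators f |-> f o exp(rX) on functions, evaluated at the initial point;
   as a composition of maps, exp(rc Xc) is therefore applied first. This is
   the order for which the letter order in upsilon_word (the first letter is
   integrated innermost) and the commutator bracket agree. *)
Definition exp_product (X : letter -> local_field) (r : letter -> R)
    (p q : E) : Prop :=
  exists p1 p2, [/\ flow (X Lc) (r Lc) p p1,
                    flow (X Lb) (r Lb) p1 p2 &
                    flow (X La) (r La) p2 q].

(* Caratheodory solution on [0, tau[ of x' = \sum_d u d *: X d, x(0) = x0 :
   the controls are only measurable, so the equation is required in integral
   form on each segment mapped into a chart. *)
Definition is_solution (X : letter -> local_field) (u : letter -> R -> R)
    (x0 : E) (tau : R) (x : R -> E) : Prop :=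
  [/\ x 0 = x0,
      {within `[0, tau[, continuous x} &
      forall i s t, 0 <= s -> s <= t -> t < tau ->
        (forall r, s <= r <= t -> chart_dom A i (x r)) ->
        forall k : 'I_n,
        let v r := (\sum_(d : letter) u d r *: X d i (chart A i (x r))) 0 k in
        (@lebesgue_measure R).-integrable `[s, t] (EFin \o v) /\
        chart A i (x t) 0 k - chart A i (x s) 0 k =
        \int[@lebesgue_measure R]_(r in `[s, t]) v r].

End VectorFields.

(* Main.v *)
Require Import Defs.
From mathcomp Require Import all_boot all_order all_algebra.
From mathcomp Require Import all_classical all_reals all_analysis.
From mathcomp Require Import measurable_realfun ring lra zify.

Set Implicit Arguments.
Unset Strict Implicit.
Unset Printing Implicit Defensive.

Import Order.TTheory GRing.Theory Num.Theory.
Import numFieldNormedType.Exports.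

Local Open Scope classical_set_scope.
Local Open Scope ring_scope.

(** The coordinates are determined by ordinary differential equations, and
these equations are what makes the product of flows solve the controlled
equation.

Algebra.  The map from [S] to [b - a.exp(2S).c] only looks at shorter words, so
it has a unique fixed point (Sa1_exists_unique).  Removing the last letter [y]
of the words is a derivation of the shuffle algebra, written [rder _ y] below,
and it is dual to integration against [u_y].  The derivatives of the three
coordinate series give, with [Sa], [Sb], [Sc] and [W = exp(2 Sb)],
  [Sa = a + 2 Sa.b - (Sa sh Sa).c],  [Sb = b - Sa.c],  [Sc = W.c],
  [W = 1 + 2 W.b - 2 (W sh Sa).c].
The first identity, which is of Riccati type, uses that the shuffle product can
also be computed from the first letters (shuffle_letterl).

Convergence.  Up to signs these are the equations [f' = (1 + f)^2] and
[w' = 2 w (1 + f)], solved by [f = t / (1 - t)] and [w = 1 / (1 - t)^2].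
Hence the absolute values of the coefficients on words of length [k] add up to
at most [k!] (hnorm_coord), whereas an iterated integral over such a word is at
most [(M t)^k / k!] (upsilon_word_bound).  The series are dominated by geometric
series of ratio [M t < 1].

Coordinates.  Iterated integrals are multiplicative for the shuffle product
(upsilon_homog_shuffle), so the identities above become integral equations for
the functions [xi_a], [xi_b], [xi_c]:
  [xi_a' = u_a + 2 xi_a u_b - xi_a^2 u_c],  [xi_b' = u_b - xi_a u_c],
  [xi_c' = exp(2 xi_b) u_c].
The controls being only measurable, derivatives are avoided: a function is
compared with an integral by comparing their first order expansions at every
point (growth_le, primitive_of_expansion).

Geometry.  By the commutation relations, the flow of [X_a] for the time [r]
pushes [X_b] to [X_b - 2 r X_a] and [X_c] to [X_c + r X_b - r^2 X_a], and the flow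
of [X_b] pushes [X_c] to [exp(-2r) X_c].  To see this, a vector field which is
constant along the flow in this sense solves the linearized equation along each
integral curve; therefore the difference between a nearby integral curve and the
displacement predicted by the field satisfies a linear differential inequality,
and is negligible (transport_estimate, displaced_flow).  The first order
expansion of the product of the three flows in terms of the increments of
[xi_a], [xi_b], [xi_c] follows (displaced_product), and inserting the equations
of the coordinates, the velocity is exactly [u_a X_a + u_b X_b + u_c X_c]
(exp_product_solution).

Solutions are unique by a contraction argument in charts, the manifold being
Hausdorff (solution_unique), and the product is defined for small exponents
because flows exist locally (picard, exp_product_local). *)

(** * The shuffle product *)

Section ShuffleAlgebra.
Variable R : realType.
Implicit Types (S U V : ncseries R) (v w : word) (y : letter).

Definition tsum n (f : word -> R) : R := \sum_(v : n.-tuple letter) f v.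

Lemma eq_tsum n f g : (forall v, size v = n -> f v = g v) -> tsum n f = tsum n g.
Proof. by move=> fg; apply: eq_bigr => v _; rewrite fg ?size_tuple. Qed.

Lemma tsum0 f : tsum 0 f = f [::].
Proof.
rewrite /tsum (big_pred1 [tuple]) => [|v]; first by [].
by rewrite [v]tuple0; apply/esym/eqP.
Qed.

Lemma tsumS n f : tsum n.+1 f = \sum_y tsum n (fun v => f (rcons v y)).
Proof.
rewrite /tsum pair_big /=.
rewrite (reindex (fun p : letter * n.-tuple letter => [tuple of rcons p.2 p.1])) //=.
exists (fun v : n.+1.-tuple letter =>
  (last La v, [tuple of belast (thead v) (behead_tuple v)])).
- move=> [y v] _ /=; congr pair; first by rewrite last_rcons.
  apply: val_inj => /=; rewrite /thead (tnth_nth La) /=.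
  by case: v => -[|z v] //= _; rewrite belast_rcons.
- move=> v _; apply: val_inj => /=.
  case/tupleP: v => z v /=; rewrite theadE.
  by rewrite -lastI.
Qed.

Lemma tsumD n f g : tsum n (fun v => f v + g v) = tsum n f + tsum n g.
Proof. by rewrite /tsum big_split. Qed.

Lemma tsumZ n a f : tsum n (fun v => a * f v) = a * tsum n f.
Proof. by rewrite /tsum mulr_sumr. Qed.

Lemma tsum_eq0 n f : (forall v, size v = n -> f v = 0) -> tsum n f = 0.
Proof. by move=> f0; rewrite /tsum big1// => v _; rewrite f0 ?size_tuple. Qed.

(** The derivation of the shuffle algebra which is dual to integration against
[u_y].  A series is determined by its constant term and its three derivatives,
so that identities between series are proved by induction on words. *)
Definition rder S y : ncseries R := fun w => S (rcons w y).

Definition shuffle_count v v' w : R :=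
  (count_mem (rev w) (shuffle_rev (rev v) (rev v')))%:R.

Lemma shuffle_countE v v' w :
  (count_mem w (shuffle_word v v'))%:R = shuffle_count v v' w.
Proof.
rewrite /shuffle_count /shuffle_word count_map; congr (_%:R).
by apply: eq_count => r /=; apply/eqP/eqP => [<-|->]; rewrite revK.
Qed.

(** The shuffles of [v] and [v'] into [wy] whose last letter comes from [v]. *)
Definition last_count v v' w y : R :=
  if rev v is z :: r then
    (z == y)%:R * (count_mem (rev w) (shuffle_rev r (rev v')))%:R else 0.

Lemma shuffle_rev_nilr (v : word) : shuffle_rev v [::] = [:: v].
Proof. by case: v. Qed.

Lemma count_mem_cons y z (r : seq word) w :
  count_mem (y :: w) [seq z :: s | s <- r] = ((z == y) * count_mem w r)%N.
Proof.
rewrite count_map; have [->|zy] := eqVneq z y.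
  by rewrite mul1n; apply: eq_count => s /=; rewrite eqseq_cons eqxx.
rewrite mul0n (@eq_count _ _ pred0) ?count_pred0// => s /=.
by rewrite eqseq_cons (negbTE zy).
Qed.

Lemma shuffle_count_rcons v v' w y :
  shuffle_count v v' (rcons w y) = last_count v v' w y +
  (if rev v' is z :: r then
    (z == y)%:R * (count_mem (rev w) (shuffle_rev (rev v) r))%:R else 0).
Proof.
rewrite /shuffle_count /last_count rev_rcons.
case: (rev v) => [|z r]; case: (rev v') => [|z' r'] /=.
- by rewrite addr0.
- by rewrite add0r !addn0 eqseq_cons -natrM mulnb.
- by rewrite addr0 shuffle_rev_nilr /= !addn0 eqseq_cons -natrM mulnb.
- by rewrite count_cat !count_mem_cons natrD !natrM.
Qed.

Lemma ser_shuffleE S U w : ser_shuffle S U w =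
  \sum_(i < (size w).+1) tsum i (fun v => tsum (size w - i) (fun v' =>
     S v * U v' * shuffle_count v v' w)).
Proof.
rewrite /ser_shuffle /tsum; apply: eq_bigr => i _; apply: eq_bigr => v _.
by apply: eq_bigr => v' _; rewrite shuffle_countE.
Qed.

Lemma sum_letter_eq (f : letter -> R) y : \sum_z (z == y)%:R * f z = f y.
Proof.
by rewrite (bigD1 y) //= eqxx mul1r big1 ?addr0// => z /negbTE ->; rewrite mul0r.
Qed.

Lemma shuffle_nil S U : ser_shuffle S U [::] = S [::] * U [::].
Proof.
by rewrite ser_shuffleE big_ord_recl big_ord0 addr0 /= !tsum0
  /shuffle_count /= mulr1.
Qed.

(** The two terms collect the words whose last letter is provided by the first
and by the second factor.  With [shuffle_nil], this rule determines the product,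
and bilinearity, commutativity and associativity follow from it. *)
Lemma shuffle_rcons S U w y : ser_shuffle S U (rcons w y) =
  ser_shuffle (rder S y) U w + ser_shuffle S (rder U y) w.
Proof.
rewrite !ser_shuffleE size_rcons.
under eq_bigr => i _ do under eq_tsum => v _ do under eq_tsum => v' _ do
  rewrite shuffle_count_rcons mulrDr.
under eq_bigr => i _ do under eq_tsum => v _ do rewrite tsumD.
under eq_bigr => i _ do rewrite tsumD.
rewrite big_split /=; congr (_ + _).
- rewrite big_ord_recl tsum0 tsum_eq0 ?add0r; last first.
    by move=> v _; rewrite /last_count /= mulr0.
  apply: eq_bigr => i _; rewrite tsumS.
  rewrite -(sum_letter_eq (fun z => tsum i (fun v => tsum (size w - i)
    (fun v' => rder S z v * U v' * shuffle_count v v' w))) y).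
  apply: eq_bigr => z _ /=; rewrite -tsumZ; apply: eq_tsum => v _.
  rewrite -tsumZ; apply: eq_tsum => v' _.
  rewrite /last_count rev_rcons /rder /shuffle_count.
  by case: eqP => [->|]; rewrite ?mul1r ?mul0r ?mulr0.
- rewrite big_ord_recr /= subnn.
  rewrite [X in _ + X]tsum_eq0 ?addr0; last first.
    by move=> v _; rewrite tsum0 /= mulr0.
  apply: eq_bigr => i _; rewrite subSn ?leq_ord//.
  apply: eq_tsum => v _; rewrite tsumS.
  rewrite -(sum_letter_eq (fun z => tsum (size w - i)
    (fun v' => S v * rder U z v' * shuffle_count v v' w)) y).
  apply: eq_bigr => z _ /=; rewrite -tsumZ; apply: eq_tsum => v' _.
  rewrite rev_rcons /rder /shuffle_count.
  by case: eqP => [->|]; rewrite ?mul1r ?mul0r ?mulr0.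
Qed.

Lemma rder_shuffle S U y : rder (ser_shuffle S U) y =
  (fun w => ser_shuffle (rder S y) U w + ser_shuffle S (rder U y) w).
Proof. by apply/funext => w; rewrite /rder shuffle_rcons. Qed.

Lemma shuffle_local S S' U U' w :
  (forall v, size v <= size w -> S v = S' v)%N ->
  (forall v, size v <= size w -> U v = U' v)%N ->
  ser_shuffle S U w = ser_shuffle S' U' w.
Proof.
elim/last_ind: w S S' U U' => [|w y IH] S S' U U' HS HU.
  by rewrite !shuffle_nil HS// HU.
rewrite !shuffle_rcons; congr (_ + _); apply: IH => v Hv;
  rewrite /rder ?HS ?HU // ?size_rcons //; exact: leqW.
Qed.

Lemma shuffle0l U w : ser_shuffle (fun=> 0) U w = 0.
Proof.
elim/last_ind: w U => [|w y IH] U; first by rewrite shuffle_nil mul0r.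
by rewrite shuffle_rcons !IH addr0.
Qed.

Lemma shuffleDl S S' U w : ser_shuffle (fun v => S v + S' v) U w =
  ser_shuffle S U w + ser_shuffle S' U w.
Proof.
elim/last_ind: w S S' U => [|w y IH] S S' U; first by rewrite !shuffle_nil mulrDl.
by rewrite !shuffle_rcons /rder !IH /rder addrACA.
Qed.

Lemma shuffleZl a S U w : ser_shuffle (fun v => a * S v) U w =
  a * ser_shuffle S U w.
Proof.
elim/last_ind: w S U => [|w y IH] S U; first by rewrite !shuffle_nil mulrA.
by rewrite !shuffle_rcons /rder !IH /rder mulrDr.
Qed.

Lemma shuffleC S U : ser_shuffle S U = ser_shuffle U S.
Proof.
apply/funext => w; elim/last_ind: w S U => [|w y IH] S U.
  by rewrite !shuffle_nil mulrC.
by rewrite !shuffle_rcons !(IH S) !(IH (rder S y)) addrC.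
Qed.

Lemma shuffleDr S U U' w : ser_shuffle S (fun v => U v + U' v) w =
  ser_shuffle S U w + ser_shuffle S U' w.
Proof. by rewrite !(shuffleC S) shuffleDl. Qed.

Lemma shuffleZr a S U w : ser_shuffle S (fun v => a * U v) w =
  a * ser_shuffle S U w.
Proof. by rewrite !(shuffleC S) shuffleZl. Qed.

Lemma shuffle_suml (I : Type) (r : seq I) (a : I -> R) (S : I -> ncseries R) U w :
  ser_shuffle (fun v => \sum_(i <- r) a i * S i v) U w =
  \sum_(i <- r) a i * ser_shuffle (S i) U w.
Proof.
elim: r => [|i r IH].
  rewrite big_nil -[RHS](shuffle0l U w).
  by congr (ser_shuffle _ U w); apply/funext => v; rewrite big_nil.
rewrite big_cons -IH -shuffleZl -shuffleDl.
by congr (ser_shuffle _ U w); apply/funext => v; rewrite big_cons.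
Qed.

Lemma shuffleA S U V :
  ser_shuffle S (ser_shuffle U V) = ser_shuffle (ser_shuffle S U) V.
Proof.
apply/funext => w; elim/last_ind: w S U V => [|w y IH] S U V.
  by rewrite !shuffle_nil mulrA.
by rewrite !shuffle_rcons !rder_shuffle shuffleDl shuffleDr !IH addrA.
Qed.

Lemma shuffle1l U : ser_shuffle (@ser_one R) U = U.
Proof.
apply/funext => w; elim/last_ind: w U => [|w y IH] U.
  by rewrite shuffle_nil /ser_one eqxx mul1r.
rewrite shuffle_rcons IH (_ : rder _ _ = fun=> 0) ?shuffle0l ?add0r//.
by apply/funext => v; rewrite /rder /ser_one; case: v.
Qed.

Lemma concat_letterr S d w y :
  ser_concat S (ser_letter R d) (rcons w y) = (y == d)%:R * S w.
Proof.
rewrite /ser_concat size_rcons big_ord_recr /= big_ord_recr /= big1 ?add0r.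
  rewrite -!cats1 take_size_cat// drop_size_cat// drop_oversize; last first.
    by rewrite size_cat addn1.
  by rewrite /ser_letter eqseq_cons /= andbT mulr0 addr0 mulrC.
move=> i _; rewrite /ser_letter; case: eqP; rewrite ?mulr0// => /(congr1 size).
by rewrite size_drop size_rcons /=; have := ltn_ord i; lia.
Qed.

Lemma concat_letterr_nil S d : ser_concat S (ser_letter R d) [::] = 0.
Proof.
by rewrite /ser_concat big_ord_recl big_ord0 addr0 /= /ser_letter mulr0.
Qed.

Lemma concat_letterl_nil d U : ser_concat (ser_letter R d) U [::] = 0.
Proof.
by rewrite /ser_concat big_ord_recl big_ord0 addr0 /= /ser_letter mul0r.
Qed.

Lemma concat_letterl_cons d U z w :
  ser_concat (ser_letter R d) U (z :: w) = (z == d)%:R * U w.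
Proof.
rewrite /ser_concat big_ord_recl big_ord_recl /= [X in X * _]/ser_letter mul0r.
rewrite add0r take0 drop0 big1 ?addr0.
  by rewrite /ser_letter eqseq_cons andbT.
move=> i _ /=; rewrite /ser_letter (_ : (_ == _) = false) ?mul0r//.
have := ltn_ord i; case: w i => [|z' w] i; first by case: i.
by rewrite eqseq_cons andbF.
Qed.

Lemma rder_letterl d U y : rder (ser_concat (ser_letter R d) U) y =
  (fun w => ser_concat (ser_letter R d) (rder U y) w +
            (U [::] * (y == d)%:R) * ser_one R w).
Proof.
apply/funext => -[|z w]; rewrite /rder /=.
  by rewrite concat_letterl_cons concat_letterl_nil /ser_one eqxx mulr1 add0r mulrC.
by rewrite !concat_letterl_cons /ser_one mulr0 addr0.
Qed.

Lemma concat_letterlD d U U' w :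
  ser_concat (ser_letter R d) (fun v => U v + U' v) w =
  ser_concat (ser_letter R d) U w + ser_concat (ser_letter R d) U' w.
Proof.
case: w => [|z w]; first by rewrite !concat_letterl_nil addr0.
by rewrite !concat_letterl_cons mulrDr.
Qed.

Lemma concat_letterlZ d a U w :
  ser_concat (ser_letter R d) (fun v => a * U v) w =
  a * ser_concat (ser_letter R d) U w.
Proof.
case: w => [|z w]; first by rewrite !concat_letterl_nil mulr0.
by rewrite !concat_letterl_cons mulrCA.
Qed.

(** The recursion from the first letters follows from the recursion from the
last ones, because concatenating a letter on the left commutes with the
derivations up to a constant series. *)
Lemma shuffle_letterl d U V : let a := ser_concat (ser_letter R d) in
  ser_shuffle (a U) (a V) =
  (fun w => a (ser_shuffle U (a V)) w + a (ser_shuffle (a U) V) w).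
Proof.
move=> a; rewrite /a {a}.
apply/funext => w; elim/last_ind: w U V => [|w y IH] U V.
  by rewrite shuffle_nil !concat_letterl_nil mulr0 addr0.
have concatE X : ser_concat (ser_letter R d) X (rcons w y) =
  rder (ser_concat (ser_letter R d) X) y w by [].
rewrite !concatE shuffle_rcons !rder_letterl.
rewrite shuffleDl shuffleDr shuffleZl shuffleZr shuffle1l
  [ser_shuffle _ (ser_one R)]shuffleC shuffle1l !IH !rder_shuffle.
rewrite !concat_letterlD !shuffle_nil !concat_letterl_nil.
rewrite (_ : ser_shuffle U (rder (ser_concat _ _) y) = fun v =>
    ser_shuffle U (ser_concat (ser_letter R d) (rder V y)) v +
    V [::] * (y == d)%:R * U v); last first.
  apply/funext => v; rewrite rder_letterl shuffleDr shuffleZr.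
  by rewrite [ser_shuffle _ (ser_one R)]shuffleC shuffle1l.
rewrite (_ : ser_shuffle (rder (ser_concat _ _) y) V = fun v =>
    ser_shuffle (ser_concat (ser_letter R d) (rder U y)) V v +
    U [::] * (y == d)%:R * V v); last first.
  by apply/funext => v; rewrite rder_letterl shuffleDl shuffleZl shuffle1l.
rewrite !concat_letterlD !concat_letterlZ.
ring.
Qed.

End ShuffleAlgebra.

(** * The shuffle exponential and the algebraic equation *)

Section ShuffleExponential.
Variable R : realType.
Implicit Types (S U : ncseries R) (v w : word) (y : letter).

Lemma ser_one_rcons w y : ser_one R (rcons w y) = 0.
Proof. by rewrite /ser_one; case: w. Qed.

(** Commutativity and associativity let the derivative be moved out of the
power, as in [d(S^k) = k S^(k-1) dS]. *)
Lemma rder_shuffle_pow S y k : rder (ser_shuffle_pow S k.+1) y =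
  (fun w => k.+1%:R * ser_shuffle (ser_shuffle_pow S k) (rder S y) w).
Proof.
elim: k => [|k IH].
  apply/funext => w; rewrite /= rder_shuffle mul1r shuffleC.
  rewrite (_ : rder (ser_one R) y = fun=> 0); last first.
    by apply/funext => v; rewrite /rder ser_one_rcons.
  by rewrite [ser_shuffle S _]shuffleC shuffle0l addr0.
apply/funext => w; rewrite [ser_shuffle_pow _ _]/= -/(ser_shuffle_pow S k.+1).
rewrite rder_shuffle IH shuffleZr shuffleA -[ser_shuffle S _]/(ser_shuffle_pow S k.+1).
by rewrite shuffleC -[k.+2]add1n natrD mulrDl mul1r.
Qed.

Lemma shuffle_pow_small S k w : S [::] = 0 -> (size w < k)%N ->
  ser_shuffle_pow S k w = 0.
Proof.
move=> S0; elim: k w => // k IH w.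
case/lastP: w => [|w y] wk; first by rewrite /= shuffle_nil S0 mul0r.
rewrite -[LHS]/(rder (ser_shuffle_pow S k.+1) y w) rder_shuffle_pow.
rewrite (@shuffle_local _ _ (fun=> 0) _ (rder S y)) ?shuffle0l ?mulr0// => v vw.
by apply: IH; move: wk; rewrite size_rcons; lia.
Qed.

Lemma shuffle_exp_widen S w m : S [::] = 0 -> (size w < m)%N ->
  ser_shuffle_exp S w = \sum_(k < m) (k`!%:R)^-1 * ser_shuffle_pow S k w.
Proof.
move=> S0 wm; rewrite /ser_shuffle_exp (big_ord_widen _ (fun k =>
  (k`!%:R)^-1 * ser_shuffle_pow S k w) wm) [LHS]big_mkcond /=.
apply: eq_bigr => k _; case: ifP => //.
by rewrite ltnS leqNgt => /negbFE wk; rewrite shuffle_pow_small ?mulr0.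
Qed.

(** Termwise, the [k]-th power divided by [k!] is sent to the previous term times
the derivative of [S]; powers vanish on short words, so the truncations of the
exponential at the length of the word do not interfere. *)
Lemma rder_shuffle_exp S y : S [::] = 0 ->
  rder (ser_shuffle_exp S) y = ser_shuffle (ser_shuffle_exp S) (rder S y).
Proof.
move=> S0; apply/funext => w; rewrite /rder (@shuffle_exp_widen _ _ (size w).+2)//;
  last by rewrite size_rcons.
rewrite big_ord_recl /= ser_one_rcons mulr0 add0r.
rewrite [RHS](@shuffle_local _ _ (fun v => \sum_(k < (size w).+1)
  (k`!%:R)^-1 * ser_shuffle_pow S k v) _ (rder S y)) //; last first.
  by move=> v vw; rewrite (@shuffle_exp_widen _ _ (size w).+1).
rewrite shuffle_suml; apply: eq_bigr => k _.
rewrite -[ser_shuffle S _ _]/(rder (ser_shuffle_pow S k.+1) y w) rder_shuffle_pow.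
by rewrite mulrA; congr (_ * _); rewrite factS natrM invfM -mulrA mulrC mulfK.
Qed.

Lemma shuffle_exp_nil S : ser_shuffle_exp S [::] = 1.
Proof.
by rewrite /ser_shuffle_exp big_ord_recl big_ord0 /= /ser_one eqxx fact0 invr1
  mulr1 addr0.
Qed.

Lemma shuffle_exp_local S S' w :
  (forall v, size v <= size w -> S v = S' v)%N ->
  ser_shuffle_exp S w = ser_shuffle_exp S' w.
Proof.
move=> SS'; apply: eq_bigr => k _; congr (_ * _).
suff H m v : (size v <= size w)%N -> ser_shuffle_pow S m v = ser_shuffle_pow S' m v.
  exact: H.
elim: m v => //= m IH v vw.
by apply: shuffle_local => v' v'v; [apply: SS'|apply: IH]; exact: leq_trans vw.
Qed.

End ShuffleExponential.

Section AlgebraicEquation.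
Variable R : realType.
Implicit Types (S U : ncseries R) (v w : word) (y : letter).

Definition Sa1_map S : ncseries R := fun w => ser_letter R Lb w -
  ser_concat (ser_concat (ser_letter R La) (exp_shuffle2 S)) (ser_letter R Lc) w.

Lemma Sa1_map_nil S : Sa1_map S [::] = 0.
Proof. by rewrite /Sa1_map concat_letterr_nil /ser_letter subr0. Qed.

Lemma Sa1_map_rcons S w y : Sa1_map S (rcons w y) =
  (y == Lb)%:R * ser_one R w - (y == Lc)%:R * coord_series S La w.
Proof.
rewrite /Sa1_map concat_letterr; congr (_ - _).
rewrite /ser_letter /ser_one; case: w => [|z w]; first by rewrite /= eqseq_cons andbT mulr1.
by rewrite mulr0 /= eqseq_cons; case: w => [|? ?]; rewrite andbF.
Qed.

(** The map is a contraction for the distance given by the length of the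
shortest word on which two series differ; hence the unique fixed point. *)
Lemma Sa1_map_local S S' m : (forall v, size v < m -> S v = S' v)%N ->
  (forall v, size v < m.+1 -> Sa1_map S v = Sa1_map S' v)%N.
Proof.
move=> SS'; case/lastP => [|w y]; first by rewrite !Sa1_map_nil.
rewrite size_rcons ltnS => wm; rewrite !Sa1_map_rcons; congr (_ - _ * _).
rewrite /coord_series; case: w wm => [|z w] wm; first by rewrite !concat_letterl_nil.
rewrite !concat_letterl_cons; congr (_ * _); apply: shuffle_exp_local => v vw.
by rewrite SS'//; move: wm => /=; lia.
Qed.

Lemma Sa1_iter_stable k k' v : (size v < k <= k')%N ->
  iter k' Sa1_map (fun=> 0) v = iter k Sa1_map (fun=> 0) v.
Proof.
move=> /andP[vk]; elim: k k' v vk => // k IH [//|k'] v vk kk'.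
rewrite !iterS; apply: (@Sa1_map_local _ _ k) => // v' v'k; exact: IH.
Qed.

Lemma Sa1_exists_unique : exists! S : ncseries R, Sa1_equation S.
Proof.
pose S : ncseries R := fun w => iter (size w).+1 Sa1_map (fun=> 0) w.
exists S; split.
  apply/funext => w; rewrite -[RHS]/(Sa1_map S w).
  rewrite /S iterS; apply: (@Sa1_map_local _ _ (size w)) => // v vw.
  by apply: Sa1_iter_stable; rewrite ltnSn.
move=> S' S'E; have fixE : S' = Sa1_map S' := S'E.
apply/funext => w; rewrite /S.
suff H m v : (size v < m)%N -> iter m Sa1_map (fun=> 0) v = S' v by exact: H.
elim: m v => // m IH v vm; rewrite fixE iterS.
by apply: (@Sa1_map_local _ _ m).
Qed.

Section Solution.
Variable S : ncseries R.
Hypothesis S_eq : Sa1_equation S.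
Local Notation Sa := (coord_series S La).
Local Notation W := (exp_shuffle2 S).

Lemma Sa1_nil : S [::] = 0.
Proof. by have -> : S = Sa1_map S by []; rewrite Sa1_map_nil. Qed.

Lemma rder_Sa1 y : rder S y =
  (fun w => (y == Lb)%:R * ser_one R w - (y == Lc)%:R * Sa w).
Proof.
apply/funext => w; rewrite /rder.
by have {1}-> : S = Sa1_map S by []; rewrite Sa1_map_rcons.
Qed.

Lemma exp_shuffle2_nil : W [::] = 1.
Proof. exact: shuffle_exp_nil. Qed.

Lemma rder_exp_shuffle2 y : rder W y = (fun w =>
  2 * (y == Lb)%:R * W w - 2 * (y == Lc)%:R * ser_shuffle W Sa w).
Proof.
rewrite /exp_shuffle2 rder_shuffle_exp ?Sa1_nil ?mulr0//.
set W' := ser_shuffle_exp _.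
rewrite (_ : rder _ y = fun w => 2 * (y == Lb)%:R * ser_one R w +
   - (2 * (y == Lc)%:R) * Sa w); last first.
  have rE w : S (rcons w y) = rder S y w by [].
  by apply/funext => w; rewrite /rder rE rder_Sa1; ring.
apply/funext => w; rewrite shuffleDr !shuffleZr.
by rewrite [ser_shuffle _ (ser_one R)]shuffleC shuffle1l mulNr.
Qed.

Lemma coord_series_nil d : coord_series S d [::] = 0.
Proof.
by case: d; rewrite /= ?concat_letterl_nil ?concat_letterr_nil ?Sa1_nil.
Qed.

(** With [W] the exponential, the derivatives of [Sa = a.W] are [a.(dW)], plus
the constant coming from the letter [a]; the quadratic term appears because
[2 a.(W sh a.W)] is the shuffle square of [a.W] by [shuffle_letterl]. *)
Lemma rder_coord_series_a y : rder Sa y = (fun w =>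
  (y == La)%:R * ser_one R w + 2 * (y == Lb)%:R * Sa w -
  (y == Lc)%:R * ser_shuffle Sa Sa w).
Proof.
rewrite [coord_series S La]/coord_series rder_letterl exp_shuffle2_nil rder_exp_shuffle2.
apply/funext => w; rewrite (_ : (fun v => _) = fun v => 2 * (y == Lb)%:R * W v +
   - (2 * (y == Lc)%:R) * ser_shuffle W Sa v); last first.
  by apply/funext => v; rewrite mulNr.
rewrite concat_letterlD !concat_letterlZ shuffle_letterl.
rewrite [ser_shuffle (ser_concat _ _) W]shuffleC.
ring.
Qed.

Lemma rder_coord_series_c y : rder (coord_series S Lc) y =
  (fun w => (y == Lc)%:R * W w).
Proof. by apply/funext => w; rewrite /rder /= concat_letterr. Qed.

End Solution.
End AlgebraicEquation.

(** * Growth of the coefficients *)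

Section Growth.
Variable R : realType.
Implicit Types (S U : ncseries R) (v w : word) (y : letter) (f g : nat -> R).

Definition hnorm S k : R := tsum k (fun v => `|S v|).

(** The binomial convolution.  Leibniz's rule is taken as the definition because
the derivations of series obey the same recursion. *)
Fixpoint leibniz f g k : R :=
  if k is k'.+1 then leibniz (f \o S) g k' + leibniz f (g \o S) k'
  else f 0%N * g 0%N.

Lemma eq_leibniz f f' g g' k : f =1 f' -> g =1 g' ->
  leibniz f g k = leibniz f' g' k.
Proof.
elim: k f f' g g' => [|k IH] f f' g g' ff' gg' /=; first by rewrite ff' gg'.
by congr (_ + _); apply: IH => // i /=; rewrite ?ff' ?gg'.
Qed.

Lemma leibniz_mono f f' g g' k :
  (forall i, (i <= k)%N -> 0 <= f i <= f' i) ->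
  (forall i, (i <= k)%N -> 0 <= g i <= g' i) ->
  leibniz f g k <= leibniz f' g' k.
Proof.
elim: k f f' g g' => [|k IH] f f' g g' ff' gg' /=.
  by have /andP[? ?] := ff' 0%N isT; have /andP[? ?] := gg' 0%N isT; exact: ler_pM.
by apply: lerD; apply: IH => i ik /=; rewrite ?ff' ?gg'//; lia.
Qed.

Lemma leibnizC f g k : leibniz f g k = leibniz g f k.
Proof.
elim: k f g => [|k IH] f g /=; first by rewrite mulrC.
by rewrite IH [X in _ + X]IH addrC.
Qed.

Lemma leibnizDl f f' g k : leibniz (fun i => f i + f' i) g k =
  leibniz f g k + leibniz f' g k.
Proof.
elim: k f f' g => [|k IH] f f' g /=; first by rewrite mulrDl.
rewrite -[_ \o S]/(fun i => (f \o S) i + (f' \o S) i) !IH; ring.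
Qed.

Lemma leibnizNl f g k : leibniz (fun i => - f i) g k = - leibniz f g k.
Proof.
elim: k f g => [|k IH] f g /=; first by rewrite mulNr.
by rewrite -[_ \o S]/(fun i => - (f \o S) i) !IH opprD.
Qed.

Lemma leibniz0l g k : leibniz (fun=> 0) g k = 0.
Proof.
elim: k g => [|k IH] g /=; first by rewrite mul0r.
by rewrite -[_ \o S]/(fun i : nat => 0) !IH addr0.
Qed.

Lemma leibniz_suml (I : Type) (r : seq I) (f : I -> nat -> R) g k :
  leibniz (fun i => \sum_(j <- r) f j i) g k = \sum_(j <- r) leibniz (f j) g k.
Proof.
elim: r => [|j r IH].
  rewrite big_nil -[RHS](leibniz0l g k).
  by apply: eq_leibniz => // i; rewrite big_nil.
rewrite big_cons -IH -leibnizDl.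
by apply: eq_leibniz => // i; rewrite big_cons.
Qed.

Definition delta0 k : R := (k == 0%N)%:R.

Lemma leibniz_delta0 f k : leibniz delta0 f k = f k.
Proof.
elim: k f => [|k IH] f /=; first by rewrite mul1r.
by rewrite IH -[_ \o S]/(fun i : nat => 0) leibniz0l add0r.
Qed.

Definition shift_fact p k : R := (k + p)`!%:R.

(** The sequences are the derivatives at 0 of [p! / (1 - t)^(p+1)] and
[q! / (1 - t)^(q+1)], whose product is again of this form. *)
Lemma leibniz_shift_fact p q k :
  leibniz (shift_fact p) (shift_fact q) k * (p + q).+1`!%:R =
  p`!%:R * q`!%:R * (k + (p + q).+1)`!%:R.
Proof.
have shiftE r : shift_fact r \o S =1 shift_fact r.+1.
  by move=> i; rewrite /shift_fact /= addnS.
elim: k p q => [|k IH] p q /=; first by rewrite /shift_fact !add0n.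
rewrite (eq_leibniz _ (shiftE p) (frefl _)) (eq_leibniz _ (frefl _) (shiftE q)).
have := IH p.+1 q; have := IH p q.+1; rewrite !addnS !addSn.
rewrite !factS !natrM; set A := leibniz _ _ _; set B := leibniz _ _ _.
set F : R := (k + (p + q))`!%:R; set G : R := (p + q)`!%:R.
set P : R := p`!%:R; set Q : R := q`!%:R => HA HB.
have nz : (p + q).+2%:R != 0 :> R by rewrite pnatr_eq0.
apply: (mulfI nz).
transitivity ((p + q).+2%:R * ((p + q).+1%:R * G) * B +
              (p + q).+2%:R * ((p + q).+1%:R * G) * A).
  by ring.
have -> : (p + q).+2%:R * ((p + q).+1%:R * G) * B =
  B * ((p + q).+2%:R * ((p + q).+1%:R * G)) by ring.
have -> : (p + q).+2%:R * ((p + q).+1%:R * G) * A =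
  A * ((p + q).+2%:R * ((p + q).+1%:R * G)) by ring.
rewrite HA HB -!natr1 !natrD; ring.
Qed.

Lemma hnorm_ge0 S k : 0 <= hnorm S k.
Proof. exact: sumr_ge0. Qed.

Lemma hnorm0 S : hnorm S 0 = `|S [::]|.
Proof. by rewrite /hnorm tsum0. Qed.

Lemma hnormS S k : hnorm S k.+1 = \sum_y hnorm (rder S y) k.
Proof. by rewrite /hnorm tsumS. Qed.

Lemma hnormD S U k : hnorm (fun w => S w + U w) k <= hnorm S k + hnorm U k.
Proof. by rewrite /hnorm -tsumD; apply: ler_sum => v _; exact: ler_normD. Qed.

Lemma hnormZ a S k : hnorm (fun w => a * S w) k = `|a| * hnorm S k.
Proof. by rewrite /hnorm -tsumZ; apply: eq_tsum => v _; rewrite normrM. Qed.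

Lemma hnorm_scale a S U k : (forall w, U w = a * S w) ->
  hnorm U k = `|a| * hnorm S k.
Proof. by move=> UE; rewrite -hnormZ; congr hnorm; apply/funext. Qed.

Lemma hnorm_one k : hnorm (@ser_one R) k = delta0 k.
Proof.
case: k => [|k]; first by rewrite hnorm0 /ser_one normr1.
by rewrite /hnorm tsum_eq0// => -[]// *; rewrite /ser_one normr0.
Qed.

Lemma hnorm_shuffle S U k :
  hnorm (ser_shuffle S U) k <= leibniz (hnorm S) (hnorm U) k.
Proof.
elim: k S U => [|k IH] S U; first by rewrite hnorm0 shuffle_nil normrM /= !hnorm0.
rewrite hnormS.
apply: (@le_trans _ _ (\sum_y (leibniz (hnorm (rder S y)) (hnorm U) k +
                               leibniz (hnorm S) (hnorm (rder U y)) k))).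
  apply: ler_sum => y _; rewrite rder_shuffle.
  by apply: le_trans (hnormD _ _ _) _; apply: lerD; exact: IH.
rewrite big_split /= le_eqVlt; apply/orP; left; apply/eqP; congr (_ + _).
  by rewrite -leibniz_suml; apply: eq_leibniz => // i /=; rewrite hnormS.
under eq_bigr => y _ do rewrite leibnizC.
rewrite -leibniz_suml leibnizC.
by apply: eq_leibniz => // i /=; rewrite hnormS.
Qed.

Lemma letter_eqE : (((La == Lb) = false) * ((La == Lc) = false) *
  ((Lb == La) = false) * ((Lb == Lc) = false) *
  ((Lc == La) = false) * ((Lc == Lb) = false))%type.
Proof. by do ![split]; apply/eqP. Qed.

Lemma sum_letter (V : nmodType) (f : letter -> V) : \sum_y f y = f La + f Lb + f Lc.
Proof.
rewrite (bigD1 La)//= (bigD1 Lb) ?letter_eqE//= (bigD1 Lc) ?letter_eqE//=.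
by rewrite big1 ?addr0 ?addrA//; case; rewrite eqxx ?andbF.
Qed.

Section Solution.
Variable S : ncseries R.
Hypothesis S_eq : Sa1_equation S.
Local Arguments coord_series : simpl never.
Local Notation Sa := (coord_series S La).
Local Notation W := (exp_shuffle2 S).

Lemma leibniz_fact k : leibniz (shift_fact 0) (shift_fact 0) k = k.+1`!%:R.
Proof. by have := leibniz_shift_fact 0 0 k; rewrite mulr1 !mul1r addn1. Qed.

(** Up to signs, [Sa] solves the Riccati equation [f' = 1 + 2 f + f ^ 2],
whose solution with [f 0 = 0] is [1 / (1 - t) - 1]; the radius of convergence
is thus 1. *)
Lemma hnorm_coord_a k : hnorm Sa k <= shift_fact 0 k - delta0 k.
Proof.
elim/ltn_ind: k => -[|k] IH.
  by rewrite hnorm0 coord_series_nil// normr0 /shift_fact /delta0 subrr.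
rewrite hnormS sum_letter !rder_coord_series_a// !letter_eqE !eqxx /=.
rewrite [X in X + _ + _ <= _](@hnorm_scale 1 (ser_one R)); last by move=> w; ring.
rewrite [X in _ + X + _ <= _](@hnorm_scale 2 Sa); last by move=> w; ring.
rewrite [X in _ + _ + X <= _](@hnorm_scale (-1) (ser_shuffle Sa Sa)); last by move=> w; ring.
rewrite hnorm_one normrN !normr1 !mul1r (@ger0_norm _ 2)//.
have bnd i : (i <= k)%N -> 0 <= hnorm Sa i <= shift_fact 0 i - delta0 i.
  by move=> ik; rewrite hnorm_ge0 IH.
have := leibniz_mono bnd bnd.
move=> /(le_trans (hnorm_shuffle Sa Sa k)).
rewrite leibnizDl leibnizNl leibniz_delta0 leibnizC leibnizDl leibnizNl.
rewrite leibniz_delta0 leibniz_fact.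
have := IH k (leqnn _); rewrite /shift_fact !addn0 /= [delta0 k.+1]/delta0 /=.
lra.
Qed.

(** Here the majorant [1 / (1 - t)^2] solves [w' = 2 w + 2 w f], with [f] the
majorant of [Sa]. *)
Lemma hnorm_exp k : hnorm W k <= shift_fact 1 k.
Proof.
elim/ltn_ind: k => -[|k] IH.
  by rewrite hnorm0 exp_shuffle2_nil// normr1.
rewrite hnormS sum_letter !rder_exp_shuffle2// !letter_eqE !eqxx /=.
rewrite [X in X + _ + _ <= _](@hnorm_scale 0 W); last by move=> w; ring.
rewrite [X in _ + X + _ <= _](@hnorm_scale 2 W); last by move=> w; ring.
rewrite [X in _ + _ + X <= _](@hnorm_scale (-2) (ser_shuffle W Sa)); last by move=> w; ring.
rewrite normr0 mul0r add0r normrN (@ger0_norm _ 2)//.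
have bndW i : (i <= k)%N -> 0 <= hnorm W i <= shift_fact 1 i.
  by move=> ik; rewrite hnorm_ge0 IH.
have bnda i : (i <= k)%N -> 0 <= hnorm Sa i <= shift_fact 0 i - delta0 i.
  by move=> _; rewrite hnorm_ge0 hnorm_coord_a.
have := leibniz_mono bndW bnda.
move=> /(le_trans (hnorm_shuffle W Sa k)).
rewrite leibnizC leibnizDl leibnizNl leibniz_delta0 leibnizC.
have := leibniz_shift_fact 1 0 k; rewrite !addn0 addn2 !mul1r.
have := IH k (leqnn _); rewrite /shift_fact !addn1.
rewrite (_ : 2`!%:R = 2)//.
lra.
Qed.

Lemma hnorm_coord d k : hnorm (coord_series S d) k <= k`!%:R.
Proof.
have aE := hnorm_coord_a k.
case: d => //.
- by move: aE; rewrite /shift_fact addn0 /delta0; case: (k == 0%N) => /=; lra.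
- case: k {aE} => [|k]; first by rewrite hnorm0 coord_series_nil ?normr0.
  rewrite /= hnormS sum_letter !rder_Sa1// !letter_eqE !eqxx /=.
  rewrite [X in X + _ + _ <= _](@hnorm_scale 0 W); last by move=> w; ring.
  rewrite [X in _ + X + _ <= _](@hnorm_scale 1 (ser_one R)); last by move=> w; ring.
  rewrite [X in _ + _ + X <= _](@hnorm_scale (-1) Sa); last by move=> w; ring.
  rewrite hnorm_one normr0 normrN !normr1 !mul1r mul0r add0r.
  have := hnorm_coord_a k; rewrite /shift_fact addn0 => aE.
  have : k`!%:R <= k.+1`!%:R :> R by rewrite ler_nat factS leq_pmull.
  lra.
- case: k {aE} => [|k]; first by rewrite hnorm0 coord_series_nil ?normr0.
  rewrite hnormS sum_letter !rder_coord_series_c// !letter_eqE !eqxx /=.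
  rewrite [hnorm (fun w => 0 * W w) k](_ : _ = 0); last first.
    by rewrite hnormZ normr0 mul0r.
  rewrite hnormZ normr1 mul1r !add0r.
  by have := hnorm_exp k; rewrite /shift_fact addn1.
Qed.

End Solution.
End Growth.

(** * The mean value inequality *)

Section Growth.
Variable R : realType.

Lemma nearP (V : normedModType R) (x : V) (P : V -> Prop) :
  (\forall y \near x, P y) <-> exists2 d : R, 0 < d & forall y, `|y - x| < d -> P y.
Proof.
split.
  move=> /nbhs_normP[d /= d0 dP]; exists d => // y yd; apply: dP => /=.
  by rewrite distrC.
move=> [d d0 dP]; apply/nbhs_normP; exists d => //= y /= yd; apply: dP.
by rewrite distrC.
Qed.

Lemma nearI (V : normedModType R) (x : V) (P : V -> Prop) (d : R) : 0 < d ->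
  (forall y, `|y - x| < d -> P y) -> \forall y \near x, P y.
Proof. by move=> d0 HP; apply/nearP; exists d. Qed.

(** For a slightly larger constant, the bound holds up to a maximal time, and the
hypothesis at this time would extend it further unless the time is [b].  The
hypothesis can be checked for differences of integrals of measurable functions,
of which no derivative is known. *)
Lemma growth_le (V : normedModType R) (y : R -> V) (a b K : R) : a <= b ->
  (forall s, a <= s <= b -> forall e : R, 0 < e ->
    \forall t \near s, a <= t <= b -> `|y t - y s| <= (K + e) * `|t - s|) ->
  `|y b - y a| <= K * (b - a).
Proof.
move=> ab Hy.
suff H e : 0 < e -> `|y b - y a| <= (K + e) * (b - a).
  apply/ler_addgt0Pr => e e0.
  have ba1 : 0 < b - a + 1 by lra.
  apply: le_trans (H (e / (b - a + 1)) _) _; first exact: divr_gt0.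
  rewrite mulrDl lerD2l mulrAC ler_pdivrMr// ler_pM2l//; lra.
move=> e0; set L := K + e.
pose A := [set t | a <= t <= b /\ forall r, a <= r <= t -> `|y r - y a| <= L * (r - a)].
have Aa : A a.
  split; first by rewrite lexx ab.
  move=> r; rewrite -eq_le => /eqP <-.
  by rewrite !subrr normr0 mulr0.
have supA : has_sup A by split; [exists a|exists b => t [/andP[]]].
set c := sup A.
have ac : a <= c by apply: sup_upper_bound.
have cb : c <= b by apply: ge_sup; [exists a|move=> t [/andP[]]].
have /nearP[d d0 Hd] : \forall t \near c, a <= t <= b ->
    `|y t - y c| <= L * `|t - c| by apply: Hy => //; rewrite ac cb.
have below r : a <= r -> r < c -> `|y r - y a| <= L * (r - a).
  move=> ar rc; have cr : 0 < c - r by rewrite subr_gt0.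
  have [t [tab At] rt] := @sup_adherent _ A (c - r) cr supA.
  by apply: At; rewrite ar /=; move: rt; rewrite -/c; lra.
have atc : `|y c - y a| <= L * (c - a).
  have [t0 At0 ct0] := @sup_adherent _ A d d0 supA.
  have tc : t0 <= c by exact: sup_upper_bound.
  have [/andP[at0 t0b] H0] := At0.
  have := Hd t0; rewrite at0 t0b ler0_norm; last by rewrite subr_le0.
  move=> H1; have {}H1 := H1 _ isT; rewrite -/c in ct0.
  have {}H1 : `|y t0 - y c| <= L * - (t0 - c) by apply: H1; lra.
  have H2 : `|y t0 - y a| <= L * (t0 - a) by apply: H0; rewrite lexx at0.
  rewrite (_ : y c - y a = (y t0 - y a) - (y t0 - y c)); last first.
    by rewrite opprB [RHS]addrC subrKA.
  by apply: le_trans (ler_normB _ _) _; move: H1 H2; lra.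
have above r : c <= r -> r <= b -> r < c + d -> `|y r - y a| <= L * (r - a).
  move=> cr rb rd; have := Hd r.
  rewrite ger0_norm ?subr_ge0// (le_trans ac cr) rb => H1.
  have {}H1 : `|y r - y c| <= L * (r - c) by apply: H1 => //; lra.
  rewrite -(subrKA (y c)); apply: le_trans (ler_normD _ _) _.
  by move: H1 atc; lra.
have [cb'|bc] := ltP c b; last first.
  by have -> : b = c by apply/eqP; rewrite eq_le bc cb.
pose t := Num.min b (c + d / 2).
have tb : t <= b by rewrite ge_min lexx.
have ct : c < t by rewrite lt_min cb' /=; lra.
have At : A t.
  split; first by rewrite tb andbT; lra.
  move=> r /andP[ar rt]; have [rc|cr] := ltP r c; first exact: below.
  have td : t <= c + d / 2 by rewrite /t ge_min lexx orbT.
  by apply: above => //; lra.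
by have := sup_upper_bound supA At; rewrite -/c; lra.
Qed.

Lemma is_derive1P (V : normedModType R) (y : R -> V) (s : R) (v : V) :
  is_derive s 1 y v <-> forall e : R, 0 < e ->
    \forall t \near s, `|y t - y s - (t - s) *: v| <= e * `|t - s|.
Proof.
split.
  move=> Hy e e0; have [dy dyE] := Hy.
  have : h^-1 *: (y (h *: 1 + s) - y s) @[h --> 0^'] --> 'D_1 y s by exact: dy.
  rewrite dyE => /cvgrPdist_le/(_ _ e0).
  rewrite /dnbhs near_withinE => /nearP[d d0 Hd]; apply/nearP.
  exists d => // t td; have [->|ts] := eqVneq t s.
    by rewrite !subrr scale0r subr0 !normr0 mulr0.
  have ts0 : t - s != 0 by rewrite subr_eq0.
  have := Hd (t - s); rewrite subr0 => /(_ td ts0).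
  rewrite scaler1 subrK -[v in X in X -> _](scalerK ts0) -scalerBr normrZ normfV.
  by rewrite ler_pdivrMl ?normr_gt0// => H; rewrite mulrC distrC.
move=> Hy.
have Hcvg : h^-1 *: (y (h *: 1 + s) - y s) @[h --> 0^'] --> v.
  apply/cvgrPdist_le => e e0; have /nearP[d d0 Hd] := Hy _ e0.
  rewrite /dnbhs near_withinE; apply: (proj2 (@nearP R 0 _)); exists d => // h.
  rewrite subr0 => hd h0; rewrite scaler1.
  have := Hd (h + s); rewrite addrK => /(_ hd) H.
  rewrite -[v](scalerK h0) -scalerBr normrZ normfV distrC.
  by rewrite ler_pdivrMl ?normr_gt0// mulrC.
split; first by apply/cvg_ex; exists v.
exact: cvg_lim.
Qed.

(** The values lie in any normed space, where the mean value theorem fails. *)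
Lemma derive_bound_le (V : normedModType R) (y y' : R -> V) (a b K : R) :
  (forall s, Num.min a b <= s <= Num.max a b ->
    is_derive s 1 y (y' s) /\ `|y' s| <= K) ->
  `|y b - y a| <= K * `|b - a|.
Proof.
wlog ab : a b / a <= b => [H|].
  case/orP: (le_total a b) => [ab|ba]; first exact: H.
  rewrite minC maxC => Hy; rewrite distrC [X in _ <= _ * X]distrC.
  exact: H.
rewrite min_l// max_r// => Hy; rewrite ger0_norm ?subr_ge0//.
apply: growth_le => // s sab e e0; have [/is_derive1P/(_ _ e0) Hs Ks] := Hy _ sab.
near=> t => _; rewrite -[y t - y s](subrK ((t - s) *: y' s)).
apply: le_trans (ler_normD _ _) _; rewrite mulrDl addrC lerD//.
  by rewrite normrZ mulrC ler_wpM2r.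
by near: t.
Unshelve. all: by end_near. Qed.

Lemma between_dist (s t x : R) : Num.min s t <= x <= Num.max s t ->
  `|x - s| <= `|t - s|.
Proof.
case: (leP s t) => st /andP[a1 a2]; first by rewrite !ger0_norm; lra.
by rewrite !ler0_norm; lra.
Qed.

(** The segment is connected.  This carries local statements along curves. *)
Lemma locally_constant_le (P : R -> Prop) (a b : R) : a <= b ->
  (forall s, a <= s <= b -> exists2 d : R, 0 < d & forall r r',
     a <= r <= b -> a <= r' <= b -> `|r - s| < d -> `|r' - s| < d -> P r -> P r') ->
  P a <-> P b.
Proof.
move=> ab HP; pose f t : R := (`[< P t >])%:R.
have : `|f b - f a| <= 0 * (b - a).
  apply: growth_le => // s sab e e0; have [d d0 Hd] := HP _ sab.
  apply/nearP; exists d => // t td tab.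
  have ss : `|s - s| < d by rewrite subrr normr0.
  have -> : f t = f s.
    by rewrite /f; congr (nat_of_bool _)%:R; apply/asbool_equiv_eq; split; exact: Hd.
  by rewrite subrr normr0 add0r mulr_ge0// ltW.
rewrite mul0r normr_le0 subr_eq0 /f => /eqP.
by case: asboolP; case: asboolP => //= ? ? /eqP; rewrite ?oner_eq0 1?eq_sym ?oner_eq0.
Qed.

(** The supremum [s] satisfies [s <= c + s / 2].  On short intervals this replaces
Gronwall's inequality. *)
Lemma absorb_half (T : Type) (A : set T) (f : T -> R) (c B : R) :
  (forall t, A t -> f t <= B) ->
  (forall B', (forall t, A t -> f t <= B') -> forall t, A t -> f t <= c + B' / 2) ->
  forall t, A t -> f t <= 2 * c.
Proof.
move=> fB Hf t At; pose s := sup (f @` A).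
have supA : has_sup (f @` A).
  by split; [exists (f t); exists t|exists B => _ [r Ar <-]; exact: fB].
have fs r : A r -> f r <= s by move=> Ar; apply: sup_upper_bound => //; exists r.
have : s <= c + s / 2.
  by apply: ge_sup; [exact: supA.1|move=> _ [r Ar <-]; exact: Hf].
by have := fs _ At; lra.
Qed.

End Growth.

(** * Primitives of bounded measurable functions *)

Section Primitives.
Variable R : realType.
Implicit Types (f g F G : R -> R) (a b c s t : R).
Notation mu := (@lebesgue_measure R).

Definition bounded_measurable a b f :=
  measurable_fun `[a, b] f /\ exists K : R, forall x, a <= x <= b -> `|f x| <= K.

Lemma bmeas_integrable a b f : bounded_measurable a b f ->
  mu.-integrable `[a, b] (EFin \o f).
Proof.
move=> [mf [K fK]]; apply: measurable_bounded_integrable => //.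
  by apply: compact_finite_measure; exact: segment_compact.
exists K; split; first exact: num_real.
by move=> M KM x /=; rewrite in_itv /= => /fK /le_trans -> //; exact: ltW.
Qed.

Lemma bmeas_sub a b a' b' f : a <= a' -> b' <= b ->
  bounded_measurable a b f -> bounded_measurable a' b' f.
Proof.
move=> aa' b'b [mf [K fK]]; split; last first.
  by exists K => x /andP[a'x xb']; apply: fK; lra.
apply: measurable_funS mf => //; apply: subset_itv; by rewrite bnd_simp.
Qed.

Lemma bmeas_cst a b c : bounded_measurable a b (fun=> c).
Proof. by split; [exact: measurable_cst|exists `|c|]. Qed.

Lemma bmeasD a b f g : bounded_measurable a b f -> bounded_measurable a b g ->
  bounded_measurable a b (fun x => f x + g x).
Proof.
move=> [mf [K fK]] [mg [L gL]]; split; first exact: measurable_funD.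
by exists (K + L) => x xab; apply: le_trans (ler_normD _ _) (lerD _ _); auto.
Qed.

Lemma bmeasM a b f g : bounded_measurable a b f -> bounded_measurable a b g ->
  bounded_measurable a b (fun x => f x * g x).
Proof.
move=> [mf [K fK]] [mg [L gL]]; split; first exact: measurable_funM.
by exists (K * L) => x xab; rewrite normrM ler_pM //; auto.
Qed.

Lemma bmeasZ a b c f : bounded_measurable a b f ->
  bounded_measurable a b (fun x => c * f x).
Proof. by apply: bmeasM; exact: bmeas_cst. Qed.

Lemma bmeasB a b f g : bounded_measurable a b f -> bounded_measurable a b g ->
  bounded_measurable a b (fun x => f x - g x).
Proof.
move=> mf /(bmeasZ (-1)) mg; have := bmeasD mf mg.
by congr bounded_measurable; apply/funext => x; rewrite mulN1r.
Qed.

Lemma bmeas_sum a b (I : Type) (r : seq I) (f : I -> R -> R) :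
  (forall i, bounded_measurable a b (f i)) ->
  bounded_measurable a b (fun x => \sum_(i <- r) f i x).
Proof.
move=> mf; elim: r => [|i r IH].
  have := bmeas_cst a b 0; congr bounded_measurable.
  by apply/funext => x; rewrite big_nil.
have := bmeasD (mf i) IH; congr bounded_measurable.
by apply/funext => x; rewrite big_cons.
Qed.

Lemma bmeas_continuous a b f : {within `[a, b], continuous f} ->
  bounded_measurable a b f.
Proof.
move=> cf; split; first exact: subspace_continuous_measurable_fun.
have /compact_bounded[M [_ mrt]] := continuous_compact cf (@segment_compact _ a b).
by exists (M + 1) => x xab; apply: mrt; [lra|exists x => //=; rewrite in_itv].
Qed.

Lemma integral_bound a b (K : R) f : a <= b -> bounded_measurable a b f ->
  (forall x, a <= x <= b -> `|f x| <= K) ->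
  `|\int[mu]_(x in `[a, b]) f x| <= K * (b - a).
Proof.
move=> ab mf fK; have itf := bmeas_integrable mf.
apply: le_trans (le_normr_Rintegral _ itf) _ => //.
have -> : K * (b - a) = \int[mu]_(x in `[a, b]) (fun=> K) x.
  rewrite Rintegral_cst//; congr (_ * _).
  rewrite -[RHS]/(fine (lebesgue_measure `[a, b])) lebesgue_measure_itv /= lte_fin.
  by case: ltP => //= ba; apply/eqP; rewrite subr_eq0 eq_le ba ab.
apply: le_Rintegral => //.
- apply: (@bmeas_integrable _ _ (fun x => `|f x|)); case: mf => mf [L fL].
  split; first exact: measurableT_comp.
  by exists L => x xab; rewrite normr_id fL.
- exact: bmeas_integrable (bmeas_cst _ _ _).
Qed.

Lemma integral_split a b c f : a <= b <= c -> bounded_measurable a c f ->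
  \int[mu]_(x in `[a, c]) f x =
  \int[mu]_(x in `[a, b]) f x + \int[mu]_(x in `[b, c]) f x.
Proof.
move=> /andP[ab bc] mf; apply/eqP; rewrite addrC -subr_eq; apply/eqP.
rewrite Rintegral_itvB ?bnd_simp//; last exact: bmeas_integrable.
apply: Rintegral_itv_obnd_cbnd.
apply: (@integrableS _ _ _ mu `[a, c]) => //; last exact: bmeas_integrable.
by apply: subset_itv; rewrite bnd_simp.
Qed.

Lemma integralZ a b c f : bounded_measurable a b f ->
  \int[mu]_(x in `[a, b]) (c * f x) = c * \int[mu]_(x in `[a, b]) f x.
Proof. by move=> mf; rewrite RintegralZl//; exact: bmeas_integrable. Qed.

Lemma integralD a b f g : bounded_measurable a b f -> bounded_measurable a b g ->
  \int[mu]_(x in `[a, b]) (f x + g x) =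
  \int[mu]_(x in `[a, b]) f x + \int[mu]_(x in `[a, b]) g x.
Proof. by move=> mf mg; rewrite RintegralD//; exact: bmeas_integrable. Qed.

Lemma integralB a b f g : bounded_measurable a b f -> bounded_measurable a b g ->
  \int[mu]_(x in `[a, b]) (f x - g x) =
  \int[mu]_(x in `[a, b]) f x - \int[mu]_(x in `[a, b]) g x.
Proof. by move=> mf mg; rewrite RintegralB//; exact: bmeas_integrable. Qed.

Lemma eq_integral_itv a b f g : (forall x, a <= x <= b -> f x = g x) ->
  \int[mu]_(x in `[a, b]) f x = \int[mu]_(x in `[a, b]) g x.
Proof.
by move=> fg; apply: eq_Rintegral => x; rewrite inE /= in_itv /=; exact: fg.
Qed.

Lemma integral_eq0 a b f : (forall x, a <= x <= b -> f x = 0) ->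
  \int[mu]_(x in `[a, b]) f x = 0.
Proof.
move=> f0; rewrite (@eq_integral_itv _ _ _ (fun=> 0 * 1)).
  by rewrite integralZ ?mul0r//; exact: bmeas_cst.
by move=> x xab; rewrite f0 ?mul0r.
Qed.

Lemma integral_sum a b (I : Type) (r : seq I) (f : I -> R -> R) :
  (forall i, bounded_measurable a b (f i)) ->
  \int[mu]_(x in `[a, b]) (\sum_(i <- r) f i x) =
  \sum_(i <- r) \int[mu]_(x in `[a, b]) f i x.
Proof.
move=> mf; elim: r => [|i r IH].
  by rewrite big_nil integral_eq0// => x _; rewrite big_nil.
rewrite big_cons -IH -integralD//; last exact: bmeas_sum.
by apply: eq_integral_itv => x _; rewrite big_cons.
Qed.

Lemma integral_point a f : \int[mu]_(x in `[a, a]) f x = 0.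
Proof. by rewrite set_itv1 Rintegral_set1. Qed.

(** Increments, rather than derivatives almost everywhere, define primitives;
the bound on [f] makes them Lipschitz. *)
Definition primitive F f := [/\ measurable_fun setT f,
  exists K : R, forall x, `|f x| <= K &
  forall s t, s <= t -> F t - F s = \int[mu]_(x in `[s, t]) f x].

Lemma primitive_bmeas F f a b : primitive F f -> bounded_measurable a b f.
Proof.
move=> [mf [K fK] _]; split; first exact: measurable_funTS.
by exists K => x _.
Qed.

Lemma primitive_lipschitz F f : primitive F f ->
  exists2 K : R, 0 <= K & forall s t, `|F t - F s| <= K * `|t - s|.
Proof.
move=> pF; have [mf [K fK] FE] := pF; exists K; first exact: le_trans (fK 0).
move=> s t; wlog st : s t / s <= t => [H|].
  case/orP: (le_total s t) => [|/H]; first exact: H.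
  by rewrite distrC [X in _ <= _ * X]distrC.
rewrite FE// (ger0_norm (x := t - s)) ?subr_ge0//; apply: integral_bound => //.
exact: primitive_bmeas pF.
Qed.

Lemma lipschitz_continuous (V : normedModType R) (F : R -> V) K :
  (forall s t, `|F t - F s| <= K * `|t - s|) -> continuous F.
Proof.
move=> FK s; apply/cvgrPdist_le => e e0.
have K1 : 0 < `|K| + 1 by rewrite ltr_pwDr.
apply: (@nearI R R s _ (e / (`|K| + 1))); first exact: divr_gt0.
move=> t /ltW; rewrite ler_pdivlMr// => td.
rewrite distrC; apply: le_trans (FK _ _) (le_trans _ td).
by rewrite mulrC ler_wpM2l//; have := ler_norm K; lra.
Qed.

Lemma primitive_continuous F f : primitive F f -> continuous F.
Proof. by case/primitive_lipschitz => K _; exact: lipschitz_continuous. Qed.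

(** The function [F] and the integral have the same first order expansion at every
point, with increments of the [V j] in place of the time increment; so their
difference has slope zero at every point and [growth_le] applies.  The product
rule, the chain rule and the differential equation of the product of flows are
all obtained in this way. *)
Lemma primitive_of_expansion (J : finType) a b (phi v V : J -> R -> R) F :
  a <= b -> (forall j, primitive (V j) (v j)) ->
  (forall j, {within `[a, b], continuous (phi j)}) ->
  (forall s, a <= s <= b -> forall e : R, 0 < e -> \forall t \near s, a <= t <= b ->
    `|F t - F s - \sum_j phi j s * (V j t - V j s)| <= e * `|t - s|) ->
  F b - F a = \int[mu]_(x in `[a, b]) \sum_j phi j x * v j x.
Proof.
move=> ab pV cphi Fexp.
pose g x := \sum_j phi j x * v j x.
have mphi j := bmeas_continuous (cphi j).
have mv j := @primitive_bmeas _ _ a b (pV j).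
have mg : bounded_measurable a b g.
  by apply: bmeas_sum => j; apply: bmeasM.
pose D t := F t - \int[mu]_(x in `[a, t]) g x.
suff : `|D b - D a| <= 0 * (b - a).
  rewrite mul0r normr_le0 /D integral_point subr0 => /eqP.
  by move=> H; apply/eqP; rewrite -subr_eq0 -{2}H; apply/eqP; rewrite /g; ring.
apply: growth_le => // s sab e e0; rewrite add0r.
have [K K0 vK] : exists2 K : R, 0 < K & forall j x, `|v j x| <= K.
  have : forall j, exists K : R, forall x, `|v j x| <= K by move=> j; case: (pV j).
  move=> /choice[k Hk]; exists (1 + \sum_j `|k j|).
    by rewrite ltr_pwDl// sumr_ge0.
  move=> j x; apply: le_trans (Hk j x) _; rewrite (bigD1 j)//=.
  have : 0 <= \sum_(i | i != j) `|k i| by exact: sumr_ge0.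
  by have := ler_norm (k j); lra.
pose N : R := #|J|%:R + 1.
have N0 : 0 < N by rewrite /N ltr_pwDr.
have e2 : 0 < e / 2 by lra.
have e3 : 0 < e / 2 / (N * K) by rewrite divr_gt0// mulr_gt0.
have phic : \forall t \near s, forall j, a <= t <= b ->
    `|phi j t - phi j s| <= e / 2 / (N * K).
  apply: (@filter_forall _ J (fun j t => a <= t <= b ->
    `|phi j t - phi j s| <= e / 2 / (N * K)) (nbhs s)) => j.
  have /subspace_continuousP/(_ s) := cphi j.
  rewrite /= in_itv /= => /(_ sab)/cvgrPdist_le/(_ _ e3).
  rewrite near_withinE; apply: filterS => t /= H tab.
  by rewrite distrC H// in_itv.
have /nearP[d1 d10 Hd1] := phic.
have /nearP[d2 d20 Hd2] := Fexp _ sab _ e2.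
apply/nearP; exists (Num.min d1 d2); first by rewrite lt_min d10.
move=> t; rewrite lt_min => /andP[td1 td2] tab.
have ID : forall p q, a <= p -> p <= q -> q <= b ->
    \int[mu]_(x in `[a, q]) g x - \int[mu]_(x in `[a, p]) g x =
    \int[mu]_(x in `[p, q]) g x.
  move=> p q ap pq qb; rewrite (@integral_split a p q) ?ap ?pq//.
    by rewrite addrC addKr.
  by apply: bmeas_sub mg.
have est p q : a <= p -> p <= q -> q <= b ->
    (forall x, p <= x <= q -> `|x - s| < d1) ->
    `|\int[mu]_(x in `[p, q]) g x - \sum_j phi j s * (V j q - V j p)| <=
    e / 2 * (q - p).
  move=> ap pq qb Hx.
  have mvpq j := @bmeas_sub _ _ p q _ ap qb (mv j).
  have mphipq j := @bmeas_sub _ _ p q _ ap qb (mphi j).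
  have -> : \sum_j phi j s * (V j q - V j p) =
      \int[mu]_(x in `[p, q]) \sum_j phi j s * v j x.
    rewrite integral_sum; last by move=> j; exact: bmeasZ.
    by apply: eq_bigr => j _; rewrite integralZ//; case: (pV j) => _ _ ->.
  rewrite -integralB; last 2 first.
  - by apply: bmeas_sub mg.
  - by apply: bmeas_sum => j; apply: bmeasZ.
  apply: integral_bound => //.
    apply: bmeasB; first by apply: bmeas_sub mg.
    by apply: bmeas_sum => j; apply: bmeasZ.
  move=> x xpq; rewrite /g -sumrB.
  apply: le_trans (ler_norm_sum _ _ _) _.
  apply: (@le_trans _ _ (\sum_(j : J) (e / 2 / (N * K) * K))).
    apply: ler_sum => j _; rewrite -mulrBl normrM ler_pM//.
    by apply: Hd1; [exact: Hx|lra].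
  rewrite sumr_const -[leLHS]mulr_natl.
  rewrite [leLHS](_ : _ = e / 2 * (#|J|%:R / N)); last first.
    by field; rewrite !gt_eqF.
  apply: ler_piMr; first exact: ltW.
  by rewrite ler_pdivrMr// mul1r /N; lra.
rewrite /D.
case/orP: (le_total s t) => [st|ts].
  have := Hd2 _ td2 tab; have := ID s t; have := est s t.
  move: tab sab => /andP[at_ tb] /andP[as_ sb].
  move=> /(_ as_ st tb) H1 /(_ as_ st tb) H2 H3.
  have {}H1 : `|\int[mu]_(x in `[s, t]) g x - \sum_j phi j s * (V j t - V j s)|
     <= e / 2 * (t - s).
    apply: H1 => x xst; apply: le_lt_trans td1; apply: between_dist.
    by rewrite min_l ?max_r.
  rewrite (_ : F t - _ - _ = (F t - F s - \sum_j phi j s * (V j t - V j s)) -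
    (\int[mu]_(x in `[s, t]) g x - \sum_j phi j s * (V j t - V j s))); last first.
    by rewrite -H2; ring.
  apply: le_trans (ler_normB _ _) _; move: H3 H1.
  by rewrite (ger0_norm (x := t - s)); lra.
have := Hd2 _ td2 tab; have := ID t s; have := est t s.
move: tab sab => /andP[at_ tb] /andP[as_ sb].
move=> /(_ at_ ts sb) H1 /(_ at_ ts sb) H2 H3.
have {}H1 : `|\int[mu]_(x in `[t, s]) g x - \sum_j phi j s * (V j s - V j t)|
   <= e / 2 * (s - t).
  apply: H1 => x xst; apply: le_lt_trans td1; apply: between_dist.
  by rewrite min_r ?max_l.
have HS : \sum_j phi j s * (V j s - V j t) = - \sum_j phi j s * (V j t - V j s).
  by rewrite -sumrN; apply: eq_bigr => j _; ring.
rewrite (_ : F t - _ - _ = (F t - F s - \sum_j phi j s * (V j t - V j s)) +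
  (\int[mu]_(x in `[t, s]) g x - \sum_j phi j s * (V j s - V j t))); last first.
  by rewrite -H2 HS; ring.
apply: le_trans (ler_normD _ _) _; move: H3 H1.
by rewrite (ler0_norm (x := t - s)); lra.
Qed.

End Primitives.

Section PrimitiveCalculus.
Variable R : realType.
Implicit Types (f g F G : R -> R) (a b c s t : R).
Notation mu := (@lebesgue_measure R).

Lemma eq_primitive F G f g : F =1 G -> f =1 g -> primitive F f -> primitive G g.
Proof. by move=> /funext -> /funext ->. Qed.

Lemma primitive_cst c : primitive (fun=> c) (fun=> 0 : R).
Proof.
split; [exact: measurable_cst|by exists 0 => x; rewrite normr0|].
by move=> s t st; rewrite Rintegral_cst// mul0r subrr.
Qed.

Lemma primitiveD F G f g : primitive F f -> primitive G g ->
  primitive (fun t => F t + G t) (fun t => f t + g t).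
Proof.
move=> pF pG; have [mf [K fK] FE] := pF; have [mg [L gL] GE] := pG.
split; first exact: measurable_funD.
  by exists (K + L) => x; apply: le_trans (ler_normD _ _) (lerD _ _).
move=> s t st; rewrite integralD; [|exact: primitive_bmeas pF|exact: primitive_bmeas pG].
by rewrite -FE// -GE//; ring.
Qed.

Lemma primitiveZ c F f : primitive F f ->
  primitive (fun t => c * F t) (fun t => c * f t).
Proof.
move=> pF; have [mf [K fK] FE] := pF.
split; first by apply: measurable_funM => //; exact: measurable_cst.
  by exists (`|c| * K) => x; rewrite normrM ler_wpM2l.
by move=> s t st; rewrite integralZ -?FE ?mulrBr//; exact: primitive_bmeas pF.
Qed.

Lemma primitive_sum (I : Type) (r : seq I) (F f : I -> R -> R) :
  (forall i, primitive (F i) (f i)) ->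
  primitive (fun t => \sum_(i <- r) F i t) (fun t => \sum_(i <- r) f i t).
Proof.
move=> pF; elim: r => [|i r IH].
  by apply: eq_primitive (primitive_cst 0) => x; rewrite big_nil.
by apply: eq_primitive (primitiveD (pF i) IH) => x; rewrite big_cons.
Qed.

(** Integration by parts. *)
Lemma primitiveM F G f g (K L : R) : primitive F f -> primitive G g ->
  (forall x, `|F x| <= K) -> (forall x, `|G x| <= L) ->
  primitive (fun t => F t * G t) (fun t => f t * G t + F t * g t).
Proof.
move=> pF pG FK GL; have [mf [Kf fK] _] := pF; have [mg [Kg gK] _] := pG.
have cF := primitive_continuous pF; have cG := primitive_continuous pG.
split.
- by apply: measurable_funD; apply: measurable_funM => //;
    exact: continuous_measurable_fun.
- exists (Kf * L + K * Kg) => x; apply: le_trans (ler_normD _ _) _.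
  by rewrite !normrM lerD// ler_pM.
move=> s t st.
pose phi (i : bool) := if i then G else F.
pose V (i : bool) := if i then F else G.
pose v (i : bool) := if i then f else g.
have := @primitive_of_expansion R bool s t phi v V (fun t => F t * G t) st.
rewrite /phi /V /v => ->; first last.
- have [Lf Lf0 HF] := primitive_lipschitz pF.
  have [Lg Lg0 HG] := primitive_lipschitz pG.
  move=> r _ e e0.
  have L1 : 0 < Lf * Lg + 1 by rewrite ltr_pwDr// mulr_ge0.
  apply: (@nearI R R r _ (e / (Lf * Lg + 1))); first exact: divr_gt0.
  move=> x; rewrite ltr_pdivlMr// => xr _.
  rewrite big_bool /= (_ : _ - _ - _ = (F x - F r) * (G x - G r)); last by ring.
  rewrite normrM; apply: le_trans (ler_pM _ _ (HF _ _) (HG _ _)) _ => //.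
  rewrite mulrACA mulrA ler_wpM2r//.
  by have := normr_ge0 (x - r); move: xr; nra.
- by case; exact: continuous_subspaceT.
- by case.
by apply: eq_integral_itv => x _; rewrite big_bool /=; ring.
Qed.

Lemma primitive_expR F f (K : R) : primitive F f -> (forall x, `|F x| <= K) ->
  primitive (fun t => expR (F t)) (fun t => expR (F t) * f t).
Proof.
move=> pF FK; have [mf [Kf fK] _] := pF.
have cF := primitive_continuous pF.
have cE : continuous (fun t => expR (F t)).
  by move=> x; apply: continuous_comp; [exact: cF|exact: continuous_expR].
split.
- by apply: measurable_funM => //; exact: continuous_measurable_fun.
- exists (expR K * Kf) => x; rewrite normrM ler_pM// ger0_norm ?expR_ge0//.
  by rewrite ler_expR; exact: le_trans (ler_norm _) (FK _).
move=> s t st.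
have := @primitive_of_expansion R unit s t (fun _ t => expR (F t)) (fun=> f)
  (fun=> F) (fun t => expR (F t)) st.
move=> ->; first last.
- have [L L0 HF] := primitive_lipschitz pF.
  move=> r _ e e0.
  have e1 : 0 < e / (L + 1) by rewrite divr_gt0// ltr_pwDr.
  have /is_derive1P/(_ _ e1)/nearP[d d0 Hd] := is_derive_expR (F r).
  have dL : 0 < d / (L + 1) by rewrite divr_gt0// ltr_pwDr.
  apply: (@nearI R R r _ (d / (L + 1))) => // x.
  rewrite ltr_pdivlMr ?ltr_pwDr// => xr _.
  rewrite (big_pred1 tt) => [|[]//].
  have Fd : `|F x - F r| < d.
    apply: le_lt_trans (HF _ _) _; move: xr; have := normr_ge0 (x - r); nra.
  rewrite mulrC; apply: le_trans (Hd _ Fd) _.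
  rewrite mulrAC ler_pdivrMr ?ltr_pwDr// -mulrA ler_pM2l//.
  by apply: le_trans (HF _ _) _; rewrite mulrDr mulr1 mulrC lerDl.
- by move=> _; exact: continuous_subspaceT.
- by [].
by apply: eq_integral_itv => x _; rewrite (big_pred1 tt) // => -[].
Qed.

(** Bounded convergence of the densities allows passing to the limit. *)
Lemma primitive_lim (F_ f_ : nat -> R -> R) F f (K : R) :
  (forall n, primitive (F_ n) (f_ n)) -> (forall n x, `|f_ n x| <= K) ->
  (forall t, F_ n t @[n --> \oo] --> F t) ->
  (forall t, f_ n t @[n --> \oo] --> f t) ->
  primitive F f.
Proof.
move=> pF fK cF cf.
have mf_ n : measurable_fun setT (f_ n) by case: (pF n).
have mf : measurable_fun setT f.
  by apply: (@measurable_fun_cvg _ _ _ _ f_) => // x _; exact: cf.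
have fK' x : `|f x| <= K.
  by apply: (cvgr_to_le (cvg_norm (cf x))); near=> n; exact: fK.
split => //; first by exists K.
move=> s t st; apply: (@cvg_unique _ _ ((F_ n t - F_ n s) @[n --> \oo])) => //.
  exact: cvgB.
rewrite (_ : (fun n => _) = fun n => \int[mu]_(x in `[s, t]) f_ n x); last first.
  by apply/funext => n; case: (pF n) => _ _ ->.
have bf : bounded_measurable s t f.
  by split; [exact: measurable_funTS|exists K].
apply: fine_cvg.
have -> : (fine (\int[mu]_(x in `[s, t]) (f x)%:E))%:E =
    (\int[mu]_(x in `[s, t]) (f x)%:E)%E.
  by rewrite fineK//; apply: integrable_fin_num => //; exact: bmeas_integrable.
have := @dominated_convergence _ _ _ mu `[s, t] _ (fun n => EFin \o f_ n)
  (EFin \o f) (EFin \o (fun=> K)).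
case; last by [].
- by [].
- by move=> n; apply/measurable_EFinP/measurable_funTS; exact: mf_.
- by apply/measurable_EFinP; exact: measurable_funTS.
- by apply/aeW => x _; apply: cvg_EFin; [exact: nearW|exact: cf].
- exact: bmeas_integrable (bmeas_cst _ _ _).
- by apply/aeW => x n _; rewrite lee_fin.
Unshelve. all: by end_near. Qed.

(** The density vanishes at negative times, where the integral is over an empty
interval; this makes the integral a primitive on the whole line. *)
Lemma primitive_integral f (K : R) : measurable_fun setT f ->
  (forall x, `|f x| <= K) -> (forall x, x < 0 -> f x = 0) ->
  primitive (fun t => \int[mu]_(x in `[0, t]) f x) f.
Proof.
move=> mf fK f0; split => //; first by exists K.
have bf a b : bounded_measurable a b f.
  by split; [exact: measurable_funTS|exists K].
have neg a b : b < 0 -> \int[mu]_(x in `[a, b]) f x = 0.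
  by move=> b0; apply: integral_eq0 => x xab; apply: f0; lra.
have neg0 a : a < 0 -> \int[mu]_(x in `[a, 0]) f x = 0.
  move=> a0; suff : `|\int[mu]_(x in `[a, 0]) f x| <= 0 by rewrite normr_le0 => /eqP.
  apply/ler_addgt0Pr => e e0; rewrite add0r.
  have K1 : 0 < `|K| + 1 by rewrite ltr_pwDr.
  pose d := Num.min (- a) (e / (`|K| + 1)).
  have d0 : 0 < d by rewrite lt_min oppr_gt0 a0 divr_gt0.
  have da : d <= - a by rewrite ge_min lexx.
  have ad0 : a <= - d <= 0 by apply/andP; split; lra.
  rewrite (integral_split ad0)// neg ?add0r; last by lra.
  have dE : d <= e / (`|K| + 1) by rewrite ge_min lexx orbT.
  apply: le_trans (@integral_bound _ _ _ (`|K| + 1) _ _ _ _) _ => //.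
  - by lra.
  - by move=> x _; apply: le_trans (fK _) _; have := ler_norm K; lra.
  - by rewrite opprK add0r mulrC -ler_pdivlMr.
move=> s t st; have [s0|s0] := leP 0 s.
  by rewrite (@integral_split _ 0 s) ?s0// addrC addKr.
rewrite (neg 0 s)// subr0; have [t0|t0] := leP 0 t; last by rewrite !neg.
by rewrite [RHS](@integral_split _ s 0) ?neg0 ?add0r// ltW.
Qed.

End PrimitiveCalculus.

(** * Iterated integrals *)

(** For controls cut off outside of [0, b[, all iterated integrals are bounded
Lipschitz functions on the whole line, so that no interval has to be carried
along.  The right end is open so that cutting off does not change the integrals
up to a time [t < b]. *)
Record control (R : realType) (u : letter -> R -> R) (M b : R) : Prop := Control {
  control_meas : forall d, measurable_fun setT (u d);
  control_bound : forall d x, `|u d x| <= M;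
  control_before : forall d (x : R), x < 0 -> u d x = 0;
  control_after : forall d x, b <= x -> u d x = 0;
  control_ge0 : 0 <= b }.

Section IteratedIntegrals.
Variable R : realType.
Variables (u : letter -> R -> R) (M b : R).
Hypothesis uC : control u M b.
Let u_meas := control_meas uC.
Let u_bound := control_bound uC.
Let u_neg := control_before uC.
Let u_end := control_after uC.
Let b_ge0 := control_ge0 uC.
Implicit Types (S U : ncseries R) (v w : word) (y : letter) (s t x : R).
Notation mu := (@lebesgue_measure R).

Lemma M_ge0 : 0 <= M.
Proof. exact: le_trans (u_bound La 0). Qed.

Lemma upsilon_word_rcons w y t : upsilon_word u t (rcons w y) =
  \int[mu]_(s in `[0, t]) (upsilon_word u s w * u y s).
Proof. by rewrite /upsilon_word rev_rcons. Qed.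

Lemma integral_derive (F f : R -> R) s t : s <= t ->
  (forall x, is_derive x 1 F (f x)) -> continuous f ->
  F t - F s = \int[mu]_(x in `[s, t]) f x.
Proof.
move=> st dF cf.
have pid : primitive (fun x : R => x) (fun=> 1 : R).
  split; [exact: measurable_cst|by exists 1 => x; rewrite normr1|].
  move=> p q pq; rewrite -[p in LHS]mul1r -[q in LHS]mul1r -mulrBr.
  rewrite Rintegral_cst//; congr (_ * _).
  rewrite -[RHS]/(fine (lebesgue_measure `[p, q])) lebesgue_measure_itv /= lte_fin.
  by case: ltP => //= qp; apply/eqP; rewrite subr_eq0 eq_le qp pq.
rewrite (@primitive_of_expansion R unit s t (fun=> f) (fun _ _ => 1)
  (fun _ x => x) F)//.
- by apply: eq_integral_itv => x _; rewrite (big_pred1 tt) ?mulr1// => -[].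
- by move=> _; exact: continuous_subspaceT.
- move=> r _ e e0; have /is_derive1P/(_ _ e0) := dF r.
  apply: filterS => x Hx _; rewrite (big_pred1 tt) => [|[]//].
  by rewrite mulrC.
Qed.

Lemma primitive_word w y (K : R) : continuous (fun t => upsilon_word u t w) ->
  (forall t, `|upsilon_word u t w| <= K) ->
  primitive (fun t => upsilon_word u t (rcons w y))
            (fun t => upsilon_word u t w * u y t).
Proof.
move=> cw wK.
have := @primitive_integral R (fun t => upsilon_word u t w * u y t) (K * M).
move=> H; apply: eq_primitive (H _ _ _) => //.
- by move=> t; rewrite upsilon_word_rcons.
- by apply: measurable_funM => //; exact: continuous_measurable_fun.
- by move=> x; rewrite normrM ler_pM.
- by move=> x /(u_neg y) ->; rewrite mulr0.
Qed.

Lemma primitive_before F f t : primitive F f -> (forall x, x < 0 -> f x = 0) ->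
  t < 0 -> F t = F 0.
Proof.
move=> pF f0 t0; have [mf [K fK] FE] := pF.
have cF := primitive_continuous pF.
suff : F 0 - F t = 0 by move/eqP; rewrite subr_eq0 => /eqP.
have H s : s < 0 -> t <= s -> F s = F t.
  move=> s0 ts; apply/eqP; rewrite -subr_eq0 FE// integral_eq0// => x xst.
  by apply: f0; lra.
suff : `|F 0 - F t| <= 0 by rewrite normr_le0 => /eqP.
apply/ler_addgt0Pr => e e0; rewrite add0r.
have /cvgrPdist_le/(_ _ e0)/nearP[d d0 Hd] := cF 0.
pose s := Num.max t (- d / 2).
have s0 : s < 0 by rewrite gt_max t0 /=; lra.
have ts : t <= s by rewrite le_max lexx.
have ds : - d / 2 <= s by rewrite le_max lexx orbT.
by rewrite -(H s)//; apply: Hd; rewrite subr0 ltr0_norm//; lra.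
Qed.

Lemma primitive_after F f t : primitive F f -> (forall x, b <= x -> f x = 0) ->
  b <= t -> F t = F b.
Proof.
move=> pF f0 bt; have [mf [K fK] FE] := pF.
apply/eqP; rewrite -subr_eq0 FE// integral_eq0// => x /andP[bx _].
exact: f0.
Qed.

Lemma upsilon_word0 w y : upsilon_word u 0 (rcons w y) = 0.
Proof. by rewrite upsilon_word_rcons integral_point. Qed.

(** The factorial comes from integrating the bound for a shorter word; it cancels
the growth of the coefficients of the series. *)
Lemma upsilon_word_bound w :
  [/\ continuous (fun t => upsilon_word u t w),
      forall t, 0 <= t <= b -> `|upsilon_word u t w| <= (M * t) ^+ size w / (size w)`!%:R &
      forall t, `|upsilon_word u t w| <= (M * b) ^+ size w / (size w)`!%:R].
Proof.
elim/last_ind: w => [|w y [cw wb wbb]].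
  rewrite /upsilon_word /= fact0 invr1 mulr1; split.
  - by move=> t; exact: cvg_cst.
  - by move=> t _; rewrite expr0 normr1.
  - by move=> t; rewrite expr0 normr1.
set k := size w in wb wbb *.
have pw := primitive_word y cw wbb.
have wb' t : 0 <= t <= b -> `|upsilon_word u t (rcons w y)| <=
    (M * t) ^+ (size (rcons w y)) / (size (rcons w y))`!%:R.
  move=> /andP[t0 tb].
  rewrite size_rcons -/k upsilon_word_rcons.
  have bw := primitive_bmeas 0 t pw.
  apply: le_trans (le_normr_Rintegral _ (bmeas_integrable bw)) _ => //.
  pose F s : R := (M * s) ^+ k.+1 / k.+1`!%:R.
  pose f s : R := (M * s) ^+ k / k`!%:R * M.
  have cf : continuous f.
    move=> s; apply: cvgM; last exact: cvg_cst.
    apply: cvgM; last exact: cvg_cst.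
    apply: (@continuous_comp _ _ _ (fun s => M * s) (fun z => z ^+ k)).
      by apply: cvgM; [exact: cvg_cst|exact: cvg_id].
    exact: exprn_continuous.
  have dF s : is_derive s 1 F (f s).
    have -> : F = (k.+1`!%:R^-1 * M ^+ k.+1) \*: (@GRing.exp R ^~ k.+1).
      by apply/funext => x; rewrite /F exprMn mulrC mulrA.
    have dX : is_derive s 1 (@GRing.exp R ^~ k.+1) (k.+1%:R * s ^+ k).
      by split; [exact: exprn_derivable|rewrite exp_derive [LHS]mulr1].
    apply: is_derive_eq; rewrite /f factS natrM exprMn exprS.
    have k0 : k.+1%:R != 0 :> R by rewrite pnatr_eq0.
    have f0 : k`!%:R != 0 :> R by rewrite pnatr_eq0 -lt0n fact_gt0.
    rewrite -[_ *: _]/(_ * _); move: k0 f0.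
    move: (k.+1%:R : R) (k`!%:R : R) => p q p0 q0.
    by field; rewrite p0 q0.
  have <- : F t - F 0 = (M * t) ^+ k.+1 / k.+1`!%:R.
    by rewrite /F mulr0 expr0n mul0r subr0.
  rewrite (integral_derive t0 dF cf).
  apply: le_Rintegral => //.
  - case: bw => mw [K wK]; apply: (@bmeas_integrable _ 0 t
      (fun s => `|upsilon_word u s w * u y s|)); split.
      exact: measurableT_comp.
    by exists K => x xt; rewrite normr_id wK.
  - by apply: bmeas_integrable; apply: bmeas_continuous; exact: continuous_subspaceT.
  move=> x /=; rewrite in_itv /= => /andP[x0 xt].
  by rewrite normrM ler_pM// wb// x0 (le_trans xt).
split => //; first exact: primitive_continuous pw.
move=> t.
have Mb : (M * b) ^+ size (rcons w y) / (size (rcons w y))`!%:R >= 0.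
  by rewrite mulr_ge0// ?invr_ge0// exprn_ge0// mulr_ge0// M_ge0.
have [t0|t0] := ltP t 0.
  rewrite (primitive_before pw)// ?upsilon_word0 ?normr0//.
  by move=> x /(u_neg y) ->; rewrite mulr0.
have [bt|tb] := leP b t.
  rewrite (primitive_after pw)//; first by apply: wb'; rewrite b_ge0 lexx.
  by move=> x /(u_end y) ->; rewrite mulr0.
have := wb' t; rewrite t0 (ltW tb) => /(_ isT) /le_trans; apply.
rewrite ler_wpM2r ?invr_ge0// lerXn2r// ?nnegrE ?mulr_ge0// ?M_ge0//.
by rewrite ler_wpM2l ?M_ge0// ltW.
Qed.

Lemma upsilon_homogE t S k : upsilon_homog u t S k =
  tsum k (fun w => S w * upsilon_word u t w).
Proof. by []. Qed.

Lemma upsilon_homog0 t S : upsilon_homog u t S 0 = S [::].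
Proof. by rewrite upsilon_homogE tsum0 /upsilon_word /= mulr1. Qed.

Lemma upsilon_homogD t S U k : upsilon_homog u t (fun w => S w + U w) k =
  upsilon_homog u t S k + upsilon_homog u t U k.
Proof.
by rewrite !upsilon_homogE -tsumD; apply: eq_tsum => w _; rewrite mulrDl.
Qed.

Lemma upsilon_homogZ t a S k : upsilon_homog u t (fun w => a * S w) k =
  a * upsilon_homog u t S k.
Proof.
by rewrite !upsilon_homogE -tsumZ; apply: eq_tsum => w _; rewrite mulrA.
Qed.

Lemma upsilon_homog_bound t S k :
  `|upsilon_homog u t S k| <= hnorm S k * ((M * b) ^+ k / k`!%:R).
Proof.
rewrite upsilon_homogE /hnorm /tsum mulr_suml.
apply: le_trans (ler_norm_sum _ _ _) _; apply: ler_sum => w _.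
have [_ _ Hw] := upsilon_word_bound w.
by rewrite normrM ler_wpM2l//; have := Hw t; rewrite size_tuple.
Qed.

Lemma primitive_upsilon_homog S k : primitive (fun t => upsilon_homog u t S k.+1)
  (fun t => \sum_y upsilon_homog u t (rder S y) k * u y t).
Proof.
apply: (@eq_primitive _ (fun t => \sum_y tsum k (fun w =>
    S (rcons w y) * upsilon_word u t (rcons w y))) _ (fun t => \sum_y tsum k
    (fun w => S (rcons w y) * (upsilon_word u t w * u y t)))).
- by move=> t; rewrite upsilon_homogE tsumS.
- move=> t; apply: eq_bigr => y _; rewrite upsilon_homogE mulrC -tsumZ.
  by apply: eq_tsum => w _; rewrite /rder; ring.
apply: primitive_sum => y; apply: primitive_sum => w; apply: primitiveZ.
by have [cw _ wb] := upsilon_word_bound w; exact: primitive_word wb.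
Qed.

Lemma upsilon_homog_at0 S k : upsilon_homog u 0 S k.+1 = 0.
Proof.
rewrite upsilon_homogE tsumS big1// => y _.
by apply: tsum_eq0 => w _; rewrite upsilon_word0 mulr0.
Qed.

Lemma primitive_unique F G (f : R -> R) : primitive F f -> primitive G f ->
  F 0 = G 0 -> F =1 G.
Proof.
move=> [_ _ FE] [_ _ GE] FG0 t; case/orP: (le_total 0 t) => [t0|t0].
  by have := FE 0 t t0; have := GE 0 t t0; rewrite FG0; lra.
by have := FE t 0 t0; have := GE t 0 t0; rewrite FG0; lra.
Qed.

(** Both sides vanish at 0, unless [k = 0], and they have the same derivative by
Leibniz's rule for the shuffle product and integration by parts. *)
Lemma upsilon_homog_shuffle S U k t : upsilon_homog u t (ser_shuffle S U) k =
  \sum_(i < k.+1) upsilon_homog u t S i * upsilon_homog u t U (k - i).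
Proof.
elim: k S U t => [|k IH] S U t.
  by rewrite big_ord_recl big_ord0 addr0 /= !upsilon_homog0 shuffle_nil.
pose h V i s : R := if i is i'.+1 then
  \sum_y upsilon_homog u s (rder V y) i' * u y s else 0.
have ph V i : primitive (fun s => upsilon_homog u s V i) (h V i).
  case: i => [|i]; last exact: primitive_upsilon_homog.
  by apply: eq_primitive (primitive_cst (V [::])) => s //; rewrite upsilon_homog0.
have pR := @primitive_sum R _ (index_enum 'I_k.+2) _ _ (fun i : 'I_k.+2 =>
  primitiveM (ph S i) (ph U (k.+1 - i)%N) (fun x => upsilon_homog_bound x S i)
    (fun x => upsilon_homog_bound x U (k.+1 - i)%N)).
move: t; apply: (@primitive_unique _ (fun t => \sum_(i < k.+2)
  upsilon_homog u t S i * upsilon_homog u t U (k.+1 - i)) _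
  (ph (ser_shuffle S U) k.+1)).
  apply: eq_primitive pR => // s; rewrite big_split /=.
  under [RHS]eq_bigr => y _.
    rewrite rder_shuffle upsilon_homogD !IH mulrDl !mulr_suml.
    over.
  rewrite big_split /=; congr (_ + _).
  - rewrite big_ord_recl mul0r add0r exchange_big /=.
    apply: eq_bigr => i _; rewrite /bump /= add1n subSS mulr_suml.
    by apply: eq_bigr => y _; rewrite mulrAC.
  - rewrite big_ord_recr /= subnn mulr0 addr0 [RHS]exchange_big /=.
    apply: eq_bigr => i _; rewrite subSn ?leq_ord// /= mulr_sumr.
    by apply: eq_bigr => y _; rewrite mulrA.
rewrite upsilon_homog_at0 big1// => i _.
case: (nat_of_ord i) (ltn_ord i) => [|j] _.
  by rewrite subn0 upsilon_homog_at0 mulr0.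
by rewrite upsilon_homog_at0 mul0r.
Qed.

End IteratedIntegrals.

(** * Geometric estimates and Cauchy products *)

Section GeometricSeries.
Variable R : realType.

Lemma bernoulli_geometric (p : R) n : 0 <= p < 1 -> n.+1%:R * p ^+ n <= (1 - p)^-1.
Proof.
move=> /andP[p0 p1].
have H : n.+1%:R * p ^+ n <= \sum_(i < n.+1) p ^+ i.
  rewrite -[n.+1 in leLHS]card_ord -sumr_const mulr_suml; apply: ler_sum => i _.
  by rewrite mul1r ler_wiXn2l ?p0 ?(ltW p1) ?leq_ord.
apply: le_trans H _; rewrite -[leRHS]mul1r ler_pdivlMr ?subr_gt0//.
have -> : (\sum_(i < n.+1) p ^+ i) * (1 - p) = 1 - p ^+ n.+1.
  elim: n => [|n IH]; first by rewrite big_ord_recl big_ord0 expr0 expr1 addr0 mul1r.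
  by rewrite big_ord_recr /= mulrDl IH [p ^+ n.+2]exprS; ring.
by have := exprn_ge0 n.+1 p0; lra.
Qed.

Lemma geometric_sum_le (r : R) n : 0 <= r < 1 -> \sum_(i < n) r ^+ i <= (1 - r)^-1.
Proof.
move=> /andP[r0 r1]; rewrite -[leRHS]mul1r ler_pdivlMr ?subr_gt0//.
have -> : (\sum_(i < n) r ^+ i) * (1 - r) = 1 - r ^+ n.
  elim: n => [|n IH]; first by rewrite big_ord0 mul0r expr0 subrr.
  by rewrite big_ord_recr /= mulrDl IH [r ^+ n.+1]exprS; ring.
by have := exprn_ge0 n r0; lra.
Qed.

Lemma cvg_geo0 (r : R) : 0 <= r < 1 -> r ^+ n @[n --> \oo] --> (0 : R).
Proof.
move=> /andP[r0 r1]; have := @cvg_geometric R 1 r.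
by rewrite ger0_norm// => /(_ r1); rewrite (_ : geometric 1 r = fun n => r ^+ n)//;
  apply/funext => n /=; rewrite mul1r.
Qed.

Lemma is_cvg_dominated_series (f : nat -> R) (C r : R) : 0 <= r < 1 ->
  (forall k, `|f k| <= C * r ^+ k) -> cvgn (series f).
Proof.
move=> /andP[r0 r1] fC; apply: normed_cvg.
apply: (@series_le_cvg R _ (geometric C r)) => //.
- by move=> k /=.
- by move=> k; exact: (le_trans (normr_ge0 (f k)) (fC k)).
- by apply: is_cvg_geometric_series; rewrite ger0_norm.
Qed.

(** The difference between the square and the triangular partial sums is
supported on the pairs [i, j < n] with [i + j >= n], on which [r^(i + j)] is at
most [(r / s)^n s^(i + j)] for [r < s < 1]. *)
Lemma cauchy_product (f g : nat -> R) (F G C D r : R) : 0 <= r < 1 ->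
  (forall k, `|f k| <= C * r ^+ k) -> (forall k, `|g k| <= D * r ^+ k) ->
  \sum_(k < n) f k @[n --> \oo] --> F -> \sum_(k < n) g k @[n --> \oo] --> G ->
  (forall n, `|\sum_(k < n) \sum_(i < k.+1) f i * g (k - i)%N| <=
     C * D * (1 - r)^-1 ^+ 2) /\
  \sum_(k < n) \sum_(i < k.+1) f i * g (k - i)%N @[n --> \oo] --> F * G.
Proof.
move=> r01 fC gD cF cG; have /andP[r0 r1] := r01.
have C0 : 0 <= C by rewrite -[C]mulr1 -(expr0 r); exact: le_trans (fC 0%N).
have D0 : 0 <= D by rewrite -[D]mulr1 -(expr0 r); exact: le_trans (gD 0%N).
have triE n : \sum_(k < n) \sum_(i < k.+1) f i * g (k - i)%N =
    \sum_(i < n) \sum_(j < n | (i + j < n)%N) f i * g j.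
  pose a i k : R := if (i <= k)%N then f i * g (k - i)%N else 0.
  transitivity (\sum_(k < n) \sum_(i < n) a i k).
    apply: eq_bigr => k _; rewrite (big_ord_widen n (fun i => f i * g (k - i)%N))//.
    by rewrite big_mkcond; apply: eq_bigr => i _; rewrite /a ltnS.
  rewrite exchange_big /=; apply: eq_bigr => i _.
  rewrite /a -(big_mkord xpredT (fun k => if (i <= k)%N then f i * g (k - i)%N else 0)).
  rewrite -(big_mkord (fun j => i + j < n)%N (fun j => f i * g j)).
  rewrite (@big_cat_nat _ _ _ i) //=; last exact: ltnW.
  rewrite big_nat_cond big1 ?add0r; last first.
    by move=> k /andP[/andP[_ ki] _]; rewrite leqNgt ki.
  rewrite -{1}[i : nat]add0n big_addn.
  rewrite (@big_cat_nat _ _ _ (n - i) 0 n) ?leq_subr//=.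
  rewrite [X in _ = _ + X]big_nat_cond [X in _ = _ + X]big1 ?addr0; last first.
    by move=> j /andP[/andP[nij _]]; lia.
  rewrite [RHS]big_nat_cond big_nat_cond; apply: eq_big => j.
    by rewrite !andbT; case: ltnP => //= jn; rewrite ltn_subRL in jn; rewrite jn.
  by move=> _; rewrite leq_addl addnK.
have fg i j : `|f i * g j| <= C * D * (r ^+ i * r ^+ j).
  by rewrite normrM mulrACA ler_pM.
split.
  move=> n; rewrite triE.
  apply: (@le_trans _ _ (\sum_(i < n) \sum_(j < n) C * D * (r ^+ i * r ^+ j))).
    apply: le_trans (ler_norm_sum _ _ _) _; apply: ler_sum => i _.
    apply: le_trans (ler_norm_sum _ _ _) _; rewrite big_mkcond; apply: ler_sum => j _.
    by case: ifP => _; [exact: fg|exact: le_trans (fg i j)].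
  have -> : \sum_(i < n) \sum_(j < n) C * D * (r ^+ i * r ^+ j) =
      C * D * ((\sum_(i < n) r ^+ i) * (\sum_(j < n) r ^+ j)).
    rewrite mulr_suml mulr_sumr; apply: eq_bigr => i _.
    by rewrite !mulr_sumr; apply: eq_bigr => j _.
  rewrite ler_wpM2l ?mulr_ge0// expr2 ler_pM ?geometric_sum_le//;
    by apply: sumr_ge0 => i _; rewrite exprn_ge0.
pose s := (1 + r) / 2.
have s0 : 0 < s by rewrite /s; lra.
have s1 : s < 1 by rewrite /s; lra.
have rs : r < s by rewrite /s; lra.
have s01 : 0 <= s < 1 by rewrite s1 ltW.
have rs01 : 0 <= r / s < 1 by rewrite divr_ge0 ?(ltW s0)//= ltr_pdivrMr// mul1r.
pose K := C * D * (1 - s)^-1 ^+ 2.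
have diff n : `|(\sum_(k < n) f k) * (\sum_(k < n) g k) -
    \sum_(k < n) \sum_(i < k.+1) f i * g (k - i)%N| <= K * (r / s) ^+ n.
  rewrite triE.
  have -> : (\sum_(k < n) f k) * (\sum_(k < n) g k) -
     \sum_(i < n) \sum_(j < n | (i + j < n)%N) f i * g j =
     \sum_(i < n) \sum_(j < n | ~~ (i + j < n)%N) f i * g j.
    rewrite mulr_suml -sumrB; apply: eq_bigr => i _.
    by rewrite mulr_sumr (bigID (fun j : 'I_n => i + j < n)%N) /= [X in X - _]addrC addrK.
  apply: (@le_trans _ _ (\sum_(i < n) \sum_(j < n)
      C * D * (r / s) ^+ n * (s ^+ i * s ^+ j))).
    apply: le_trans (ler_norm_sum _ _ _) _; apply: ler_sum => i _.
    apply: le_trans (ler_norm_sum _ _ _) _; rewrite big_mkcond; apply: ler_sum => j _.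
    case: ifP => [|_]; last first.
      have [rs0 _] := andP rs01.
      by do !apply: mulr_ge0 => //; rewrite exprn_ge0 ?(ltW s0).
    rewrite -leqNgt => nij; apply: le_trans (fg i j) _.
    rewrite -!mulrA !ler_wpM2l// -!exprD -[r in leLHS](divfK (lt0r_neq0 s0)).
    rewrite exprMn ler_wpM2r ?exprn_ge0 ?(ltW s0)//.
    have [rs0 rs1] := andP rs01.
    by rewrite ler_wiXn2l// ltW.
  have -> : \sum_(i < n) \sum_(j < n) C * D * (r / s) ^+ n * (s ^+ i * s ^+ j) =
      C * D * (r / s) ^+ n * ((\sum_(i < n) s ^+ i) * (\sum_(j < n) s ^+ j)).
    rewrite mulr_suml mulr_sumr; apply: eq_bigr => i _.
    by rewrite !mulr_sumr; apply: eq_bigr => j _.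
  rewrite /K [leRHS]mulrAC ler_wpM2l//.
    by have [rs0 _] := andP rs01; rewrite !mulr_ge0// exprn_ge0.
  rewrite expr2 ler_pM ?geometric_sum_le//;
    by apply: sumr_ge0 => i _; rewrite exprn_ge0// ltW.
have cdiff : (\sum_(k < n) f k) * (\sum_(k < n) g k) -
    \sum_(k < n) \sum_(i < k.+1) f i * g (k - i)%N @[n --> \oo] --> (0 : R).
  have cK : K * (r / s) ^+ n @[n --> \oo] --> (0 : R).
    by rewrite -[X in _ --> X](mulr0 K); apply: cvgM; [exact: cvg_cst|exact: cvg_geo0].
  apply/cvgrPdist_le => e e0; have /cvgrPdist_le/(_ e e0) := cK.
  apply: filterS => n; rewrite !sub0r !normrN => H.
  by apply: le_trans (diff n) _; exact: le_trans (ler_norm _) H.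
rewrite (_ : (fun n => _) = fun n => (\sum_(k < n) f k) * (\sum_(k < n) g k) -
  ((\sum_(k < n) f k) * (\sum_(k < n) g k) -
    \sum_(k < n) \sum_(i < k.+1) f i * g (k - i)%N)); last first.
  by apply/funext => n; rewrite subKr.
by rewrite -[X in _ --> X]subr0; exact: cvgB (cvgM cF cG) cdiff.
Qed.

End GeometricSeries.

(** * Differential equations of the coordinates *)

Section UpsilonSeries.
Variable R : realType.
Variables (u : letter -> R -> R) (M b : R).
Hypothesis uC : control u M b.
Implicit Types (S U : ncseries R) (y : letter) (s t x : R).

Definition upsilon_sum S n t : R := \sum_(k < n) upsilon_homog u t S k.

Lemma upsilon_sumE S n t : series (upsilon_homog u t S) n = upsilon_sum S n t.
Proof. by rewrite /series /= big_mkord. Qed.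

(** Bounded pointwise convergence, the hypothesis of [primitive_lim]. *)
Definition sums_to S (p : R -> R) :=
  (exists K : R, forall n t, `|upsilon_sum S n t| <= K) /\
  (forall t, upsilon_sum S n t @[n --> \oo] --> p t).

Lemma sums_toD S U (p q : R -> R) : sums_to S p -> sums_to U q ->
  sums_to (fun w => S w + U w) (fun t => p t + q t).
Proof.
move=> [[K SK] Sp] [[L UL] Uq].
have E n t : upsilon_sum (fun w => S w + U w) n t =
    upsilon_sum S n t + upsilon_sum U n t.
  by rewrite -big_split; apply: eq_bigr => k _; exact: upsilon_homogD.
split; first by exists (K + L) => n t; rewrite E;
  exact: le_trans (ler_normD _ _) (lerD _ _).
by move=> t; rewrite (funext (E^~ t)); exact: cvgD.
Qed.

Lemma sums_toZ a S (p : R -> R) : sums_to S p ->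
  sums_to (fun w => a * S w) (fun t => a * p t).
Proof.
move=> [[K SK] Sp].
have E n t : upsilon_sum (fun w => a * S w) n t = a * upsilon_sum S n t.
  by rewrite /upsilon_sum mulr_sumr; apply: eq_bigr => k _; exact: upsilon_homogZ.
split; first by exists (`|a| * K) => n t; rewrite E normrM ler_wpM2l.
by move=> t; rewrite (funext (E^~ t)); apply: cvgM => //; exact: cvg_cst.
Qed.

Lemma sums_to_one : sums_to (@ser_one R) (fun=> 1).
Proof.
have E n t : upsilon_sum (@ser_one R) n.+1 t = 1.
  rewrite /upsilon_sum big_ord_recl upsilon_homog0 /ser_one eqxx big1 ?addr0//.
  move=> k _; rewrite upsilon_homogE tsum_eq0// => -[]// *.
  by rewrite mul0r.
split.
  by exists 1 => -[|n] t; rewrite ?E ?normr1// /upsilon_sum big_ord0 normr0.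
move=> t; rewrite -(@cvg_shiftS _ (fun n => upsilon_sum (@ser_one R) n t)).
by rewrite (funext (E^~ t)); exact: cvg_cst.
Qed.

Definition geometric_bound S (C r : R) :=
  forall k t, `|upsilon_homog u t S k| <= C * r ^+ k.

Lemma geometric_sums_to S C r : 0 <= r < 1 -> geometric_bound S C r ->
  (forall t, upsilon_cvg u t S) /\ sums_to S (upsilon u ^~ S).
Proof.
move=> r01 SC.
have C0 : 0 <= C by rewrite -[C]mulr1 -(expr0 r); exact: le_trans (SC 0%N 0).
have cS t : upsilon_cvg u t S by apply: (is_cvg_dominated_series r01 (SC^~ t)).
split => //; split.
  exists (C * (1 - r)^-1) => n t; apply: le_trans (ler_norm_sum _ _ _) _.
  apply: (@le_trans _ _ (\sum_(i < n) C * r ^+ i)); first exact: ler_sum.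
  by rewrite -mulr_sumr ler_wpM2l// geometric_sum_le.
by move=> t; have := cS t; rewrite /upsilon_cvg -(funext (upsilon_sumE S ^~ t)).
Qed.

Lemma sums_to_shuffle S U C D r : 0 <= r < 1 ->
  geometric_bound S C r -> geometric_bound U D r ->
  sums_to (ser_shuffle S U) (fun t => upsilon u t S * upsilon u t U).
Proof.
move=> r01 SC UD.
have [_ [_ Sp]] := geometric_sums_to r01 SC.
have [_ [_ Up]] := geometric_sums_to r01 UD.
have E n t : upsilon_sum (ser_shuffle S U) n t = \sum_(k < n) \sum_(i < k.+1)
    upsilon_homog u t S i * upsilon_homog u t U (k - i)%N.
  by apply: eq_bigr => k _; rewrite (upsilon_homog_shuffle uC).
have CP t := cauchy_product r01 (SC^~ t) (UD^~ t) (Sp t) (Up t).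
split.
  by exists (C * D * (1 - r)^-1 ^+ 2) => n t; rewrite E; case: (CP t).
by move=> t; rewrite (funext (E^~ t)); case: (CP t).
Qed.

(** Bounded convergence allows integrating the derivatives of [S] termwise. *)
Lemma primitive_sums_to S (F : R -> R) (p : letter -> R -> R) : sums_to S F ->
  (forall y, sums_to (rder S y) (p y)) ->
  primitive F (fun t => \sum_y p y t * u y t).
Proof.
move=> [_ SF] Sp.
have /choice[K HK] y : exists K : R, forall n t, `|upsilon_sum (rder S y) n t| <= K.
  by case: (Sp y).
pose f n t := \sum_y upsilon_sum (rder S y) n t * u y t.
apply: (@primitive_lim R (fun n => upsilon_sum S n.+1) f _ _ (\sum_y K y * M)).
- move=> n; apply: (@eq_primitive _ (fun t => S [::] +
      \sum_(k < n) upsilon_homog u t S k.+1) _ (fun t => 0 +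
      \sum_(k < n) \sum_y upsilon_homog u t (rder S y) k * u y t)).
  + by move=> t; rewrite /upsilon_sum big_ord_recl upsilon_homog0.
  + move=> t; rewrite add0r exchange_big /=; apply: eq_bigr => y _.
    by rewrite -mulr_suml.
  apply: primitiveD; first exact: primitive_cst.
  by apply: primitive_sum => k; exact: primitive_upsilon_homog uC _ _.
- move=> n t; apply: le_trans (ler_norm_sum _ _ _) _; apply: ler_sum => y _.
  by rewrite normrM ler_pM// (control_bound uC).
- by move=> t; have := SF t; rewrite -cvg_shiftS.
- move=> t; rewrite sum_letter (_ : (fun n => _) = fun n =>
    upsilon_sum (rder S La) n t * u La t + upsilon_sum (rder S Lb) n t * u Lb t +
    upsilon_sum (rder S Lc) n t * u Lc t); last first.
    by apply/funext => n; rewrite /f sum_letter.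
  have cy y : upsilon_sum (rder S y) n t * u y t @[n --> \oo] --> p y t * u y t.
    by apply: cvgM; [case: (Sp y)|exact: cvg_cst].
  by apply: cvgD; [exact: cvgD|].
Qed.

Lemma eq_sums_to S U (p q : R -> R) : S =1 U -> p =1 q -> sums_to S p -> sums_to U q.
Proof. by move=> /funext -> /funext ->. Qed.

Lemma upsilon_at0 S : upsilon u 0 S = S [::].
Proof.
rewrite /upsilon; apply: cvg_lim => //; rewrite -cvg_shiftS.
rewrite (_ : (fun n => _) = fun=> S [::]); first exact: cvg_cst.
apply/funext => n; rewrite upsilon_sumE /upsilon_sum big_ord_recl upsilon_homog0.
by rewrite big1 ?addr0// => k _; exact: upsilon_homog_at0.
Qed.

(** The three coordinates and the exponential are evaluated through their
derivatives as series, which the algebraic part computed. *)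

Section Coordinates.
Variable S : ncseries R.
Hypothesis S_eq : Sa1_equation S.
Hypothesis Mb1 : M * b < 1.
Local Notation Sa := (coord_series S La).
Local Notation W := (exp_shuffle2 S).
Notation xi d := (fun t => upsilon u t (coord_series S d)).
Let q := M * b.
Let r := (1 + q) / 2.

Let q01 : 0 <= q < 1.
Proof. by rewrite mulr_ge0 ?(M_ge0 uC) ?(control_ge0 uC). Qed.

Let r01 : 0 <= r < 1.
Proof. by have := q01; rewrite /r => /andP[? ?]; apply/andP; split; lra. Qed.

Let qr : 0 <= q / r < 1.
Proof.
have := q01; rewrite /r => /andP[? ?].
rewrite divr_ge0//=; last by lra.
by rewrite ltr_pdivrMr; lra.
Qed.

Let C := (1 - q / r)^-1.

Let C1 : 1 <= C.
Proof.
by have /andP[? ?] := qr; rewrite /C invf_ge1 ?subr_gt0//; lra.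
Qed.

(* The coefficients of [W] only give the bound [(k + 1) q^k], whence the larger
   ratio [r] and the constant [C]. *)
Let bound_W : geometric_bound W C r.
Proof.
move=> k t; apply: le_trans (upsilon_homog_bound uC _ _ _) _.
have [q0 _] := andP q01.
apply: (@le_trans _ _ (shift_fact R 1 k * (q ^+ k / k`!%:R))).
  by apply: ler_wpM2r; [rewrite divr_ge0// exprn_ge0|exact: hnorm_exp].
rewrite /shift_fact addn1 factS natrM.
have f0 : k`!%:R != 0 :> R by rewrite pnatr_eq0 -lt0n fact_gt0.
rewrite (_ : _ * _ * _ = k.+1%:R * q ^+ k); last first.
  by move: f0; move: (k`!%:R : R) (q ^+ k) => z z' ?; field.
have rn0 : r != 0 by have := q01; rewrite /r => /andP[? ?]; lra.
rewrite -[q in leLHS](divfK rn0) exprMn mulrA ler_wpM2r//.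
  by have /andP[? _] := r01; exact: exprn_ge0.
exact: bernoulli_geometric.
Qed.

Let bound_coord d : geometric_bound (coord_series S d) C r.
Proof.
move=> k t; apply: le_trans (upsilon_homog_bound uC _ _ _) _.
have [q0 _] := andP q01.
apply: (@le_trans _ _ (k`!%:R * (q ^+ k / k`!%:R))).
  by apply: ler_wpM2r; [rewrite divr_ge0// exprn_ge0|exact: hnorm_coord].
have f0 : k`!%:R != 0 :> R by rewrite pnatr_eq0 -lt0n fact_gt0.
rewrite mulrC divfK// -[leLHS]mul1r ler_pM// ?exprn_ge0//.
by rewrite lerXn2r// ?nnegrE//; move: q01; rewrite /r => /andP[? ?]; lra.
Qed.

Lemma upsilon_cvg_coord d t : upsilon_cvg u t (coord_series S d).
Proof. by case: (geometric_sums_to r01 (@bound_coord d)) => + _; exact. Qed.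

Let sums_coord d : sums_to (coord_series S d) (xi d).
Proof. by case: (geometric_sums_to r01 (@bound_coord d)). Qed.

Let sums_W : sums_to W (fun t => upsilon u t W).
Proof. by case: (geometric_sums_to r01 bound_W). Qed.

Lemma primitive_coord_a : primitive (xi La) (fun t =>
  u La t + 2 * xi La t * u Lb t - xi La t ^+ 2 * u Lc t).
Proof.
have H y : sums_to (rder Sa y) (fun t => (y == La)%:R * 1 +
    2 * (y == Lb)%:R * xi La t + - (y == Lc)%:R * (xi La t * xi La t)).
  rewrite rder_coord_series_a//.
  apply: eq_sums_to (sums_toD (sums_toD (sums_toZ (y == La)%:R sums_to_one)
    (sums_toZ (2 * (y == Lb)%:R) (sums_coord La)))
    (sums_toZ (- (y == Lc)%:R) (sums_to_shuffle r01 (@bound_coord La) (@bound_coord La)))).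
    by move=> w; rewrite mulNr.
  by [].
apply: eq_primitive (primitive_sums_to (sums_coord La) H) => // t.
by rewrite sum_letter !letter_eqE !eqxx /=; ring.
Qed.

Lemma primitive_coord_b : primitive (xi Lb) (fun t =>
  u Lb t - xi La t * u Lc t).
Proof.
have H y : sums_to (rder (coord_series S Lb) y) (fun t => (y == Lb)%:R * 1 +
    - (y == Lc)%:R * xi La t).
  rewrite [coord_series S Lb]/coord_series rder_Sa1//.
  apply: eq_sums_to (sums_toD (sums_toZ (y == Lb)%:R sums_to_one)
    (sums_toZ (- (y == Lc)%:R) (sums_coord La))).
    by move=> w; rewrite mulNr.
  by [].
apply: eq_primitive (primitive_sums_to (sums_coord Lb) H) => // t.
by rewrite sum_letter !letter_eqE !eqxx /=; ring.
Qed.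

Let primitive_W : primitive (fun t => upsilon u t W) (fun t =>
  2 * upsilon u t W * (u Lb t - xi La t * u Lc t)).
Proof.
have H y : sums_to (rder W y) (fun t => 2 * (y == Lb)%:R * upsilon u t W +
    - (2 * (y == Lc)%:R) * (upsilon u t W * xi La t)).
  rewrite rder_exp_shuffle2//.
  apply: eq_sums_to (sums_toD (sums_toZ (2 * (y == Lb)%:R) sums_W)
    (sums_toZ (- (2 * (y == Lc)%:R)) (sums_to_shuffle r01 bound_W (@bound_coord La)))).
    by move=> w; rewrite mulNr.
  by [].
apply: eq_primitive (primitive_sums_to sums_W H) => // t.
by rewrite sum_letter !letter_eqE !eqxx /=; ring.
Qed.

Let upsilon_bounded U (p : R -> R) : sums_to U p -> exists K : R, forall t, `|p t| <= K.
Proof.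
move=> [[K UK] Up]; exists K => t; apply: (cvgr_to_le (cvg_norm (Up t))).
by near=> n; exact: UK.
Unshelve. all: by end_near. Qed.

(** Both sides solve the same linear equation: the derivative of the left hand
side times the inverse of the right hand side vanishes. *)
Lemma upsilon_exp_shuffle2 t : upsilon u t W = expR (2 * xi Lb t).
Proof.
have pN := primitiveZ (-2) primitive_coord_b.
have [K HK] := upsilon_bounded (sums_coord Lb).
have NK x : `|-2 * upsilon u x (coord_series S Lb)| <= 2 * K.
  have -> : 2 * K = `|-2| * K by rewrite normrN (@ger0_norm _ 2).
  by rewrite normrM; apply: ler_wpM2l.
have pE := primitive_expR pN NK.
have [L HL] := upsilon_bounded sums_W.
have EK x : `|expR (-2 * upsilon u x (coord_series S Lb))| <= expR (2 * K).
  rewrite ger0_norm ?expR_ge0// ler_expR.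
  exact: le_trans (ler_norm _) (NK x).
have pP := primitiveM primitive_W pE HL EK.
have {}pP : primitive (fun t => upsilon u t W *
    expR (-2 * upsilon u t (coord_series S Lb))) (fun=> 0 : R).
  by apply: eq_primitive pP => // x; ring.
have := primitive_unique pP (@primitive_cst _ 1) _ t.
rewrite !upsilon_at0 exp_shuffle2_nil coord_series_nil// mulr0 expR0 mul1r.
move=> /(_ erefl) H.
apply: (mulIf (x := expR (-2 * upsilon u t (coord_series S Lb)))).
  by rewrite gt_eqF// expR_gt0.
by rewrite H -expRD mulNr subrr expR0.
Qed.

Lemma primitive_coord_c : primitive (xi Lc) (fun t => expR (2 * xi Lb t) * u Lc t).
Proof.
have H y : sums_to (rder (coord_series S Lc) y) (fun t => (y == Lc)%:R * upsilon u t W).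
  by rewrite rder_coord_series_c//; exact: sums_toZ.
apply: eq_primitive (primitive_sums_to (sums_coord Lc) H) => // t.
by rewrite sum_letter !letter_eqE !eqxx /= upsilon_exp_shuffle2; ring.
Qed.

End Coordinates.
End UpsilonSeries.

Section Truncation.
Variable R : realType.
Variables (u : letter -> R -> R) (T M b : R).
Hypothesis u_meas : forall d, measurable_fun `[0, T] (u d).
Hypothesis u_bound : forall d t, 0 <= t <= T -> `|u d t| <= M.
Hypothesis b_ge0 : 0 <= b.
Hypothesis bT : b <= T.

Definition truncate : letter -> R -> R := fun d x => if 0 <= x < b then u d x else 0.

Lemma truncate_control : control truncate M b.
Proof.
split=> //.
- move=> d; rewrite (_ : truncate d = u d \_ `[0, b[); last first.
    by apply/funext => x; rewrite /truncate patchE mem_setE in_itv.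
  apply/(measurable_restrictT _ _).1 => //.
  apply: measurable_funS (u_meas d) => //.
  by apply: subset_itv; rewrite bnd_simp.
- move=> d x; rewrite /truncate; case: ifP => [/andP[x0 xb]|_].
    by apply: u_bound; rewrite x0 (le_trans (ltW xb)).
  rewrite normr0; apply: le_trans (u_bound La (t := 0) _) => //.
  by rewrite lexx (le_trans b_ge0).
- by move=> d x x0; rewrite /truncate leNgt x0.
- by move=> d x bx; rewrite /truncate ltNge bx andbF.
Qed.

Lemma truncateE d x : 0 <= x < b -> truncate d x = u d x.
Proof. by rewrite /truncate => ->. Qed.

Lemma upsilon_word_truncate w t : t < b ->
  upsilon_word u t w = upsilon_word truncate t w.
Proof.
elim/last_ind: w t => // w y IH t tb; rewrite !upsilon_word_rcons.
apply: eq_integral_itv => x /andP[x0 xt].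
by rewrite IH ?truncateE ?x0//; exact: le_lt_trans tb.
Qed.

Lemma upsilon_homog_truncate S t k : t < b ->
  upsilon_homog u t S k = upsilon_homog truncate t S k.
Proof.
move=> tb; rewrite !upsilon_homogE; apply: eq_tsum => w _.
by rewrite upsilon_word_truncate.
Qed.

Lemma upsilon_truncate S t : t < b -> upsilon u t S = upsilon truncate t S.
Proof.
move=> tb; rewrite /upsilon; congr (limn (series _)).
by apply/funext => k; exact: upsilon_homog_truncate.
Qed.

Lemma upsilon_cvg_truncate S t : t < b -> upsilon_cvg truncate t S -> upsilon_cvg u t S.
Proof.
move=> tb; rewrite /upsilon_cvg (_ : upsilon_homog u t S = upsilon_homog truncate t S)//.
by apply/funext => k; exact: upsilon_homog_truncate.
Qed.

End Truncation.

(** * Differential calculus for row vectors *)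

Section RowVectorCalculus.
Variable R : realType.

Lemma rV_norm_le n (z : 'rV[R]_n) (e : R) : 0 <= e ->
  (forall j, `|z 0 j| <= e) -> `|z| <= e.
Proof.
move=> e0 ze; rewrite [leLHS]/Num.Def.normr /= mx_normrE.
by apply: bigmax_le => // -[i j] _ /=; rewrite ord1.
Qed.

Lemma rV_coord_le n (z : 'rV[R]_n) j : `|z 0 j| <= `|z|.
Proof.
rewrite [leRHS]/Num.Def.normr /= mx_normrE.
exact: (le_bigmax _ (fun i : 'I_1 * 'I_n => `|z i.1 i.2|) (0, j)).
Qed.

Lemma is_derive_curve (V W : normedModType R) (f : V -> W) (y : R -> V) (s : R) (v : V) :
  is_derive s 1 y v -> differentiable f (y s) ->
  is_derive s 1 (f \o y) ('D_v f (y s)).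
Proof.
move=> dy df; have /derivable1_diffP dify : derivable y s 1 by [].
have difc : differentiable (f \o y) s by exact: differentiable_comp.
split; first exact/derivable1_diffP.
rewrite !deriveE// diff_comp//= -[X in 'd f _ X]/('d y s 1).
by rewrite -(deriveE _ dify) derive_val.
Qed.

Lemma differentiable_expand (V W : normedModType R) (f : V -> W) (z : V) (e : R) :
  differentiable f z -> 0 < e ->
  \forall x \near z, `|f x - f z - 'D_(x - z) f z| <= e * `|x - z|.
Proof.
move=> df e0; have /eqaddoP := diff_locally df.
move=> /(_ e e0); rewrite near_simpl => /nearP[d d0 Hd].
apply: (nearI d0) => x xz; have := Hd (x - z); rewrite subr0 => /(_ xz).
rewrite deriveE// -![(_ + _ : _ -> _) _]/(_ + _) -![(- _ : _ -> _) _]/(- _) /=.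
by rewrite /cst subrK opprD addrA.
Qed.

Lemma is_derive_rowP n (w : R -> 'rV[R]_n) (s : R) (v : 'rV[R]_n) :
  is_derive s 1 w v <-> forall j, is_derive s 1 (fun x => w x 0 j) (v 0 j).
Proof.
split=> [/is_derive1P dw j|dw]; apply/is_derive1P => e e0.
  have := dw e e0; apply: filterS => t; apply: le_trans.
  by have := rV_coord_le (w t - w s - (t - s) *: v) j; rewrite !mxE.
near=> t; apply: rV_norm_le; first by rewrite mulr_ge0// ltW.
move=> j; rewrite !mxE; move: j; near: t.
apply: (@filter_forall _ _ (fun j t => `|w t 0 j - w s 0 j - (t - s) * v 0 j| <=
  e * `|t - s|) (nbhs s)) => j.
by have /is_derive1P := dw j; exact.
Unshelve. all: by end_near. Qed.

Lemma is_derive_scale n (k : R -> R) (w : R -> 'rV[R]_n) (s k' : R) (w' : 'rV[R]_n) :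
  is_derive s 1 k k' -> is_derive s 1 w w' ->
  is_derive s 1 (fun x => k x *: w x) (k' *: w s + k s *: w').
Proof.
move=> dk /is_derive_rowP dw; apply/is_derive_rowP => j.
rewrite (_ : (fun x => _) = k * (fun x => w x 0 j)); last first.
  by apply/funext => x; rewrite mxE.
apply: is_derive_eq; rewrite !mxE addrC; congr (_ + _).
by rewrite -[LHS]/(w s 0 j * k') mulrC.
Qed.

(** All that is used below of a vector field read in a chart. *)
Definition tame_on_ball n m (f : 'rV[R]_n -> 'rV[R]_m) (z0 : 'rV[R]_n) (L rho : R) :=
  0 <= L /\ forall z, `|z - z0| < rho -> [/\ differentiable f z, `|f z| <= L,
    forall v, `|'D_v f z| <= L * `|v| &
    forall z', `|z' - z0| < rho -> `|f z' - f z| <= L * `|z' - z| /\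
      `|f z' - f z - 'D_(z' - z) f z| <= L * `|z' - z| ^+ 2].

Lemma derive_dir_sum n m (f : 'rV[R]_n -> 'rV[R]_m) z v : differentiable f z ->
  'D_v f z = \sum_j v 0 j *: 'D_(delta_mx 0 j) f z.
Proof.
move=> df; rewrite deriveE// [X in 'd f z X]row_sum_delta linear_sum.
by apply: eq_bigr => j _; rewrite linearZ /= deriveE.
Qed.

Lemma derive_dirB n m (f : 'rV[R]_n -> 'rV[R]_m) z v w : differentiable f z ->
  'D_(v - w) f z = 'D_v f z - 'D_w f z.
Proof. by move=> df; rewrite !deriveE// linearB. Qed.

Lemma ball_segment n (z0 z z' : 'rV[R]_n) (rho t : R) : 0 <= t <= 1 ->
  `|z - z0| < rho -> `|z' - z0| < rho -> `|z + t *: (z' - z) - z0| < rho.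
Proof.
move=> /andP[t0 t1] zr zr'.
have -> : z + t *: (z' - z) - z0 = (1 - t) *: (z - z0) + t *: (z' - z0).
  by rewrite !scalerBr !scalerBl !scale1r; apply/rowP => j; rewrite !mxE; ring.
apply: le_lt_trans (ler_normD _ _) _; rewrite !normrZ !ger0_norm ?subr_ge0//.
have [->|tn0] := eqVneq t 0; first by rewrite mul0r addr0 subr0 mul1r.
have tp : 0 < t by rewrite lt_neqAle eq_sym tn0.
have := normr_ge0 (z - z0); nra.
Qed.

Lemma is_derive_segment n (z v : 'rV[R]_n) (t : R) :
  is_derive t 1 (fun t : R => z + t *: v) v.
Proof.
apply/is_derive1P => e e0; near=> s.
rewrite opprD addrACA subrr add0r -scalerBl subrr normr0.
by rewrite mulr_ge0// ltW.
Unshelve. all: by end_near. Qed.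

(** The derivatives along the coordinate axes are continuous, hence bounded near
[z0] by their value at [z0] plus one; integrating along segments gives the
Lipschitz bound. *)
Lemma C1_bounds n m (D : set 'rV[R]_n) (f : 'rV[R]_n -> 'rV[R]_m) z0 :
  open D -> Ck_on 1 D f -> D z0 ->
  exists2 L : R, 0 <= L & \forall rho \near 0^'+, forall z, `|z - z0| < rho ->
    [/\ D z, `|f z| <= L, forall v, `|'D_v f z| <= L * `|v| &
    forall z', `|z' - z0| < rho -> `|f z' - f z| <= L * `|z' - z|].
Proof.
move=> oD [dfD cfD] Dz0.
pose K := \sum_(j < n) (`|'D_(delta_mx 0 j) f z0| + 1).
have K0 : 0 <= K by apply: sumr_ge0 => j _; rewrite addr_ge0.
exists (K + (`|f z0| + 1)); first by rewrite !addr_ge0.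
have near_all : \forall z \near z0, [/\ D z, `|f z| <= `|f z0| + 1 &
    forall j, `|'D_(delta_mx 0 j) f z| <= `|'D_(delta_mx 0 j) f z0| + 1].
  near=> z; split.
  - by near: z; exact: open_nbhs_nbhs.
  - near: z; have /cvgr_norm_le : f z @[z --> z0] --> f z0.
      exact/differentiable_continuous/dfD.
    by apply; rewrite ltr_pwDr.
  - near: z; apply: (@filter_forall _ _ (fun j z => `|'D_(delta_mx 0 j) f z| <=
      `|'D_(delta_mx 0 j) f z0| + 1) (nbhs z0)) => j.
    have /cvgr_norm_le : 'D_(delta_mx 0 j) f z @[z --> z0] --> 'D_(delta_mx 0 j) f z0.
      exact: cfD.
    by apply; rewrite ltr_pwDr.
have [d d0 Hd] := (nearP _ _).1 near_all.
near=> rho => z zr.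
have rd : rho < d by near: rho; exact: nbhs_right_lt.
have bound x : `|x - z0| < rho -> forall v, `|'D_v f x| <= (K + (`|f z0| + 1)) * `|v|.
  move=> xr v; have [Dx _ Hx] := Hd x (lt_trans xr rd).
  rewrite derive_dir_sum; last exact: dfD.
  apply: le_trans (ler_norm_sum _ _ _) _.
  apply: (@le_trans _ _ (K * `|v|)); last by rewrite ler_wpM2r// lerDl addr_ge0.
  rewrite mulr_suml; apply: ler_sum => j _; rewrite normrZ mulrC.
  by apply: ler_pM => //; exact: rV_coord_le.
have [Dz fz _] := Hd z (lt_trans zr rd); split => //.
- by apply: le_trans fz _; rewrite lerDr.
- exact: bound.
move=> z' zr'.
have := @derive_bound_le R _ (fun t : R => f (z + t *: (z' - z)))
  (fun t => 'D_(z' - z) f (z + t *: (z' - z))) 0 1 ((K + (`|f z0| + 1)) * `|z' - z|).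
rewrite scale1r scale0r addr0 [z + _]addrC subrK subr0 normr1 mulr1; apply => t.
rewrite (min_l ler01) (max_r ler01) => t01.
have tr := ball_segment t01 zr zr'.
split; last exact: bound.
apply: (is_derive_curve (is_derive_segment _ _ _)).
by apply: dfD; have [] := Hd _ (lt_trans tr rd).
Unshelve. all: by end_near. Qed.

(** The previous bounds for the derivatives along the axes make the differential
Lipschitz, and the mean value inequality for [f] minus its first order
expansion gives the second order bound. *)
Lemma C2_tame n m (D : set 'rV[R]_n) (f : 'rV[R]_n -> 'rV[R]_m) z0 :
  open D -> Ck_on 2 D f -> D z0 ->
  exists L : R, \forall rho \near 0^'+, tame_on_ball f z0 L rho.
Proof.
move=> oD [dfD C1f] Dz0.
have C1 : Ck_on 1 D f by split => // v; case: (C1f v) => dv _ z Dz;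
  exact/differentiable_continuous/dv.
have [L0 L00 HL0] := C1_bounds oD C1 Dz0.
have /choice[L1 HL1] : forall j : 'I_n, exists L : R, 0 <= L /\ \forall rho \near 0^'+,
    forall z, `|z - z0| < rho -> forall z', `|z' - z0| < rho ->
    `|'D_(delta_mx 0 j) f z' - 'D_(delta_mx 0 j) f z| <= L * `|z' - z|.
  move=> j; have [L L00' HL] := C1_bounds oD (C1f (delta_mx 0 j)) Dz0.
  exists L; split => //; near=> rho => z zr z' zr'.
  suff : forall z, `|z - z0| < rho ->
    [/\ D z, `|'D_(delta_mx 0 j) f z| <= L,
      forall v, `|'D_v ('D_(delta_mx 0 j) f) z| <= L * `|v| &
      forall z', `|z' - z0| < rho -> `|'D_(delta_mx 0 j) f z' -
         'D_(delta_mx 0 j) f z| <= L * `|z' - z|].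
    by move=> /(_ z zr)[_ _ _]; exact.
  by near: rho.
pose K := \sum_j L1 j.
have K0 : 0 <= K by apply: sumr_ge0 => j _; case: (HL1 j).
have L1K : \forall rho \near 0^'+, forall j : 'I_n,
    forall z, `|z - z0| < rho -> forall z', `|z' - z0| < rho ->
    `|'D_(delta_mx 0 j) f z' - 'D_(delta_mx 0 j) f z| <= L1 j * `|z' - z|.
  apply: (@filter_forall _ _ (fun j (rho : R) => forall z, `|z - z0| < rho ->
    forall z', `|z' - z0| < rho ->
    `|'D_(delta_mx 0 j) f z' - 'D_(delta_mx 0 j) f z| <= L1 j * `|z' - z|) 0^'+).
  by move=> j; case: (HL1 j).
exists (L0 + K); near=> rho; split; first exact: addr_ge0.
have H0 : forall z, `|z - z0| < rho -> [/\ D z, `|f z| <= L0,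
    forall v, `|'D_v f z| <= L0 * `|v| &
    forall z', `|z' - z0| < rho -> `|f z' - f z| <= L0 * `|z' - z|] by near: rho.
have H1 : forall j : 'I_n,
    forall z, `|z - z0| < rho -> forall z', `|z' - z0| < rho ->
    `|'D_(delta_mx 0 j) f z' - 'D_(delta_mx 0 j) f z| <= L1 j * `|z' - z|.
  by near: rho.
move=> z zr; have [Dz fz dfz lfz] := H0 z zr; split.
- exact: dfD.
- by apply: le_trans fz _; rewrite lerDl.
- by move=> v; apply: le_trans (dfz v) _; rewrite ler_wpM2r// lerDl.
move=> z' zr'; split; first by apply: le_trans (lfz z' zr') _; rewrite ler_wpM2r// lerDl.
set v := z' - z.
have := @derive_bound_le R _ (fun t : R => f (z + t *: v) - t *: 'D_v f z)
  (fun t => 'D_v f (z + t *: v) - 'D_v f z) 0 1 (K * `|v| ^+ 2).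
rewrite scale1r scale0r addr0 [z + v]addrC /v subrK -/v subr0 normr1 mulr1.
rewrite scale0r subr0 scale1r => H; rewrite addrAC.
apply: (@le_trans _ _ (K * `|v| ^+ 2)); last first.
  by rewrite ler_wpM2r// ?exprn_ge0// lerDr.
apply: H => t; rewrite (min_l ler01) (max_r ler01) => t01.
have tr := ball_segment t01 zr zr'.
have [Dt _ _ _] := H0 _ tr.
split.
  apply: is_deriveB.
    exact: (is_derive_curve (is_derive_segment _ _ _) (dfD _ Dt)).
  have := is_derive_segment 0 ('D_v f z) t.
  by under eq_fun do rewrite add0r.
rewrite !derive_dir_sum; [|exact: dfD|exact: dfD].
rewrite -sumrB; apply: le_trans (ler_norm_sum _ _ _) _.
rewrite /K mulr_suml; apply: ler_sum => j _.
rewrite -scalerBr normrZ expr2 mulrCA.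
apply: ler_pM => //; first exact: rV_coord_le.
apply: le_trans (H1 j _ zr _ tr) _; apply: ler_wpM2l; first by case: (HL1 j).
rewrite addrC addKr normrZ -[leRHS]mul1r ler_wpM2r//.
by have /andP[t0 t1] := t01; rewrite ger0_norm.
Unshelve. all: by end_near. Qed.

End RowVectorCalculus.

(** * Local existence for differential equations *)

Section LocalExistence.
Variable R : realType.
Notation mu := (@lebesgue_measure R).

Lemma antiderivative n (phi : R -> 'rV[R]_n) (B : R) : 0 < B -> continuous phi ->
  exists F : R -> 'rV[R]_n, F 0 = 0 /\
    forall t : R, `|t| < B -> is_derive t 1 F (phi t).
Proof.
move=> B0 cphi.
have cj (j : 'I_n) : continuous (fun t => phi t 0 j).
  by move=> t; apply: (@continuous_comp _ _ _ phi (fun z => z 0 j));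
    [exact: cphi|exact: coord_continuous].
pose G (j : 'I_n) x := \int[mu]_(t in `[- B, x]) phi t 0 j.
exists (fun x => \row_j (G j x - G j 0)); split.
  by apply/rowP => j; rewrite !mxE subrr.
move=> t; rewrite ltr_norml => /andP[Bt tB].
have dG j : is_derive t 1 (fun x => G j x - G j 0) (phi t 0 j).
  have := @continuous_FTC1_closed R (fun t => phi t 0 j) (- B) t B tB.
  case.
  - by apply: bmeas_integrable; apply: bmeas_continuous; exact: continuous_subspaceT.
  - exact: Bt.
  - exact: cj.
  move=> dGj; rewrite derive1E => GE.
  rewrite -[phi t 0 j]subr0; apply: is_deriveB.
  by split.
apply/is_derive_rowP => j; rewrite (_ : (fun x => _) = fun x => G j x - G j 0)//.
by apply/funext => x; rewrite mxE.
Qed.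

Definition clamp (d t : R) := Num.max (- d) (Num.min d t).

Lemma clamp_id (d t : R) : `|t| <= d -> clamp d t = t.
Proof. by rewrite ler_norml /clamp => /andP[dt td]; rewrite min_r// max_r. Qed.

Lemma clamp_le (d t : R) : 0 <= d -> `|clamp d t| <= d.
Proof.
move=> d0; rewrite ler_norml /clamp le_max lexx /= ge_max ge_min lexx /= andbT.
by rewrite lerNl (le_trans _ d0)// oppr_le0.
Qed.

Lemma clamp_lip (d s t : R) : `|clamp d t - clamp d s| <= 1 * `|t - s|.
Proof.
rewrite mul1r /clamp; wlog st : s t / s <= t => [H|].
  case/orP: (le_total s t) => [|/H]; first exact: H.
  by rewrite distrC [X in _ <= X]distrC.
rewrite (ger0_norm (x := t - s)) ?subr_ge0// /Num.max /Num.min.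
by repeat case: ifP; move=> *; rewrite ler_norml; apply/andP; split; lra.
Qed.

Lemma le_half_pow (a c C : R) : (forall k, a <= c + C * (1 / 2) ^+ k) -> a <= c.
Proof.
move=> H; have c2 : C * (1 / 2) ^+ k @[k --> \oo] --> (0 : R).
  rewrite -[X in _ --> X](mulr0 C); apply: cvgM; [exact: cvg_cst|apply: cvg_geo0; lra].
have : (c + C * (1 / 2) ^+ k) @[k --> \oo] --> c + 0 by apply: cvgD => //; exact: cvg_cst.
rewrite addr0 => cc; apply: (cvgr_to_ge cc); exact: nearW.
Qed.

(** Picard iteration, on an interval short enough for the iteration to be a
contraction of ratio 1/2. *)
Lemma picard n (f : 'rV[R]_n -> 'rV[R]_n) (z0 z : 'rV[R]_n) (rho L d : R) :
  0 <= L -> 0 < d -> d * L <= 1 / 2 -> d * L <= rho / 2 -> `|z - z0| < rho / 2 ->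
  (forall x, `|x - z0| < rho -> `|f x| <= L) ->
  (forall x x', `|x - z0| < rho -> `|x' - z0| < rho ->
    `|f x' - f x| <= L * `|x' - x|) ->
  exists y : R -> 'rV[R]_n, y 0 = z /\ forall t : R, `|t| < d ->
    is_derive t 1 y (f (y t)) /\ `|y t - z0| < rho.
Proof.
move=> L0 d0 dL dLr zz0 fL flip.
have dd : d < 2 * d by lra.
have d20 : 0 < 2 * d by lra.
have /choice[A HA] (phi : R -> 'rV[R]_n) : exists F, continuous phi ->
    F 0 = 0 /\ forall t : R, `|t| < 2 * d -> is_derive t 1 F (phi t).
  have [cphi|ncphi] := pselect (continuous phi); last by exists 0.
  by have [F HF] := antiderivative d20 cphi; exists F.
pose J (y : R -> 'rV[R]_n) := y 0 = z /\
  forall s t : R, `|s| <= d -> `|t| <= d -> `|y t - y s| <= L * `|t - s|.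
(* Clamping the time makes the right hand side continuous on the whole line
   although the iterates are only controlled for [|t| <= d]. *)
pose phi (y : R -> 'rV[R]_n) t := f (y (clamp d t)).
pose P (y : R -> 'rV[R]_n) (t : R) : 'rV[R]_n := z + A (phi y) t.
have Jball y t : J y -> `|t| <= d -> `|y t - z0| < rho.
  move=> [y0 ylip] td; rewrite -(subrKA z); apply: le_lt_trans (ler_normD _ _) _.
  have n0 : `|0 : R| <= d by rewrite normr0 ltW.
  have := ylip 0 t n0 td; rewrite y0 subr0 => H.
  have : L * `|t| <= rho / 2 by apply: le_trans dLr; rewrite mulrC ler_wpM2r.
  by move: H zz0; lra.
have dc t : `|clamp d t| <= d by apply: clamp_le; exact: ltW.
have cphi y : J y -> continuous (phi y).
  move=> Jy; apply: (@lipschitz_continuous _ _ _ (L * L)) => s t.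
  apply: le_trans (flip _ _ _ _) _; [exact: Jball|exact: Jball|].
  rewrite -mulrA ler_wpM2l//; case: Jy => _ /(_ _ _ (dc s) (dc t))/le_trans; apply.
  by rewrite ler_wpM2l// -[leRHS]mul1r clamp_lip.
have dP y (t : R) : J y -> `|t| < 2 * d -> is_derive t 1 (P y) (phi y t).
  move=> Jy td; have [_ /(_ t td) dA] := HA _ (cphi y Jy).
  by rewrite -[phi y t]add0r; apply: is_deriveD.
have JP y : J y -> J (P y).
  move=> Jy; split; first by have [H _] := HA _ (cphi y Jy); rewrite /P H addr0.
  move=> s t sd td; apply: (@derive_bound_le _ _ _ (phi y)) => x xst.
  have xd : `|x| <= d.
    move: sd td xst; rewrite !ler_norml ge_min le_max.
    by case/orP: (le_total s t) => ?; rewrite ?(min_l, min_r, max_l, max_r)//; lra.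
  split; first by apply: dP => //; exact: le_lt_trans xd dd.
  by apply: fL; exact: Jball.
have contr y y' c : J y -> J y' -> (forall t : R, `|t| <= d -> `|y' t - y t| <= c) ->
    forall t : R, `|t| <= d -> `|P y' t - P y t| <= c / 2.
  move=> Jy Jy' yc t td.
  have n0 : `|0 : R| <= d by rewrite normr0 ltW.
  have c0 : 0 <= c by apply: le_trans (yc 0 n0).
  have := @derive_bound_le R _ (fun t => P y' t - P y t)
    (fun t => phi y' t - phi y t) 0 t (L * c).
  rewrite (JP y Jy).1 (JP y' Jy').1 subrr !subr0 => H.
  apply: le_trans (H _) _.
    move=> x x0t; have xd : `|x| <= d.
      by apply: le_trans td; have := between_dist x0t; rewrite !subr0.
    split; first by apply: is_deriveB; apply: dP => //; exact: le_lt_trans xd dd.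
    apply: le_trans (flip _ _ _ _) _; [exact: Jball|exact: Jball|].
    by rewrite ler_wpM2l// yc.
  rewrite mulrAC; apply: (@le_trans _ _ (1 / 2 * c)); last by rewrite mulrC mul1r.
  by rewrite ler_wpM2r//; apply: le_trans dL; rewrite mulrC ler_wpM2r.
pose Y k := iter k P (fun=> z).
have JY k : J (Y k).
  elim: k => [|k IH]; last exact: JP.
  by split => // s t _ _; rewrite subrr normr0 mulr_ge0.
have Ystep k (t : R) : `|t| <= d -> `|Y k.+1 t - Y k t| <= rho * (1 / 2) ^+ k.
  elim: k t => [|k IH] t td.
    have n0 : `|0 : R| <= d by rewrite normr0 ltW.
    rewrite expr0 mulr1 -[Y 0%N t]/z -{1}(JY 1%N).1.
    apply: le_trans ((JY 1%N).2 _ _ n0 td) _; rewrite subr0.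
    have : L * `|t| <= L * d by rewrite ler_wpM2l.
    by have := normr_ge0 (z - z0); lra.
  apply: le_trans (contr _ _ _ (JY k) (JY k.+1) IH t td) _.
  by rewrite exprS; lra.
have rho0 : 0 < rho by have := normr_ge0 (z - z0); lra.
have Ycauchy k m (t : R) : `|t| <= d -> `|Y (k + m)%N t - Y k t| <= 2 * rho * (1 / 2) ^+ k.
  move=> td; have H : `|Y (k + m)%N t - Y k t| <=
      2 * rho * (1 / 2) ^+ k - 2 * rho * (1 / 2) ^+ (k + m).
    elim: m => [|m IH]; first by rewrite addn0 !subrr normr0.
    rewrite addnS -(subrKA (Y (k + m)%N t)); apply: le_trans (ler_normD _ _) _.
    by have := Ystep (k + m)%N t td; rewrite exprS; lra.
  have : 0 <= 2 * rho * (1 / 2) ^+ (k + m) by apply: mulr_ge0; [lra|apply: exprn_ge0; lra].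
  by move: H; lra.
have Ycvg (t : R) j : `|t| <= d -> cvgn (fun k => Y k t 0 j).
  move=> td; have : cvgn (series (fun k => Y k.+1 t 0 j - Y k t 0 j)).
    apply: (@is_cvg_dominated_series _ _ rho (1 / 2)); first by apply/andP; split; lra.
    move=> k; apply: le_trans (Ystep k t td).
    by have := rV_coord_le (Y k.+1 t - Y k t) j; rewrite !mxE.
  rewrite -[series _]/(series (telescope (fun k => Y k t 0 j))) telescopeK.
  move=> /cvg_ex[l Hl]; apply/cvg_ex; exists (l + Y 0%N t 0 j).
  rewrite (_ : (fun k => Y k t 0 j) = fun k => (Y k t 0 j - Y 0%N t 0 j) + Y 0%N t 0 j).
    by apply: cvgD => //; exact: cvg_cst.
  by apply/funext => k; rewrite subrK.
pose y t : 'rV[R]_n := \row_j limn (fun k => Y k t 0 j).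
have yY k (t : R) : `|t| <= d -> `|y t - Y k t| <= 2 * rho * (1 / 2) ^+ k.
  move=> td; apply: rV_norm_le.
    by apply: mulr_ge0; [lra|apply: exprn_ge0; lra].
  move=> j; rewrite !mxE.
  have : Y (m + k)%N t 0 j - Y k t 0 j @[m --> \oo] -->
      limn (fun k => Y k t 0 j) - Y k t 0 j.
    apply: cvgB; last exact: cvg_cst.
    have := Ycvg t j td.
    by rewrite (@cvg_shiftn k _ (fun m => Y m t 0 j)).
  move=> /cvg_norm/cvgr_to_le; apply; apply: nearW => m.
  apply: le_trans (Ycauchy k m t td); rewrite addnC.
  by have := rV_coord_le (Y (k + m)%N t - Y k t) j; rewrite !mxE.
have Jy : J y.
  have n0 : `|0 : R| <= d by rewrite normr0 ltW.
  split.
    apply/eqP; rewrite -subr_eq0 -normr_le0.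
    apply: (@le_half_pow _ _ (2 * rho)) => k; rewrite add0r.
    by have := yY k 0 n0; rewrite (JY k).1.
  move=> s t sd td; apply: (@le_half_pow _ _ (4 * rho)) => k.
  have := yY k s sd; have := yY k t td; have := (JY k).2 s t sd td.
  rewrite (_ : y t - y s = (y t - Y k t) + (Y k t - Y k s) - (y s - Y k s)); last first.
    by rewrite subrKA opprB subrKA.
  move=> H1 H2 H3; apply: le_trans (ler_normB _ _) _.
  have := ler_normD (y t - Y k t) (Y k t - Y k s); lra.
have Py (t : R) : `|t| <= d -> P y t = y t.
  move=> td; apply/eqP; rewrite -subr_eq0 -normr_le0.
  apply: (@le_half_pow _ _ (2 * rho)) => k; rewrite add0r.
  have := contr _ _ _ (JY k) Jy (yY k) t td.
  have := yY k.+1 t td; rewrite exprS -[P (Y k)]/(Y k.+1) => H1 H2.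
  rewrite -(subrKA (Y k.+1 t)); apply: le_trans (ler_normD _ _) _.
  by rewrite [X in _ + X]distrC; lra.
exists (P y); split; first exact: (JP y Jy).1.
move=> t td; have td' := ltW td; split; last exact: Jball (JP y Jy) td'.
have := dP y t Jy (lt_trans td dd).
by rewrite /phi (clamp_id td') -(Py t td').
Qed.

End LocalExistence.

(** * Flows on a manifold *)

Section Flows.
Variables (R : realType) (n : nat) (E : topologicalType).
Variable A : smooth_manifold R n E.
Implicit Types (p q : E) (i j : chart_index A) (V : local_field A).

Local Notation chart_image i := (chart A i @` chart_dom A i).

Lemma chart_image_dom i z : chart_image i z -> chart_dom A i (chart_inv A i z).
Proof. by move=> [p ip <-]; rewrite chartK. Qed.

Lemma chart_invK i z : chart_image i z -> chart A i (chart_inv A i z) = z.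
Proof. by move=> [p ip <-]; rewrite chartK. Qed.

Lemma chart_image_chart i p : chart_dom A i p -> chart_image i (chart A i p).
Proof. by move=> ip; exists p. Qed.

Lemma chart_dom_near i p : chart_dom A i p -> \forall q \near p, chart_dom A i q.
Proof. by move=> ip; apply: open_nbhs_nbhs; split=> //; exact: chart_dom_open. Qed.

Lemma smooth_field_C2 V i : smooth_vector_field V -> Ck_on 2 (chart_image i) (V i).
Proof. by move=> [sV _]; exact: sV. Qed.

Lemma smooth_field_differentiable V i z : smooth_vector_field V ->
  chart_image i z -> differentiable (V i) z.
Proof. by move=> sV iz; have [dV _] := smooth_field_C2 i sV; exact: dV. Qed.

Lemma transition_differentiable i j p : chart_dom A i p -> chart_dom A j p ->
  differentiable (chart A j \o chart_inv A i) (chart A i p).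
Proof.
move=> ip jp; have [d _] := @transition_smooth _ _ _ A i j 1.
by apply: d; exists p.
Qed.

Lemma separated_near (T : Type) (F : set_system T) (FF : Filter F)
    (f g : T -> E) p q : f @ F --> p -> g @ F --> q -> p <> q ->
  \forall t \near F, f t <> g t.
Proof.
move=> fp gq pq; have /existsNP[B /existsNP[C]] : ~ cluster (nbhs p) q.
  by move=> /(manifold_hausdorff A).
move=> /not_implyP[pB /not_implyP[qC BC]].
have fB : \forall t \near F, B (f t) by exact: fp.
have gC : \forall t \near F, C (g t) by exact: gq.
near=> t => fgt; apply: BC; exists (f t); split; first by near: t.
by rewrite fgt; near: t.
Unshelve. all: by end_near. Qed.

Definition good_ball (X : letter -> local_field A) i (z0 : 'rV[R]_n) (L rho : R) :=
  (forall d, tame_on_ball (X d i) z0 L rho) /\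
  forall z, `|z - z0| < rho -> chart_image i z.

Lemma tame_on_ball_le m k (f : 'rV[R]_m -> 'rV[R]_k) z0 L L' rho : L <= L' ->
  tame_on_ball f z0 L rho -> tame_on_ball f z0 L' rho.
Proof.
move=> LL' [L0 Hf]; split; first exact: le_trans LL'.
move=> z zr; have [df fz dfz lfz] := Hf z zr; split => //.
- exact: le_trans LL'.
- by move=> v; apply: le_trans (dfz v) _; rewrite ler_wpM2r.
move=> z' zr'; have [H1 H2] := lfz z' zr'; split.
  by apply: le_trans H1 _; rewrite ler_wpM2r.
by apply: le_trans H2 _; rewrite ler_wpM2r// exprn_ge0.
Qed.

Variable X : letter -> local_field A.
Hypothesis sX : forall d, smooth_vector_field (X d).

Lemma good_ball_near i p : chart_dom A i p ->
  exists L : R, \forall rho \near 0^'+, good_ball X i (chart A i p) L rho.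
Proof.
move=> ip; set z0 := chart A i p.
have iz0 : chart_image i z0 by exact: chart_image_chart.
have oi := @chart_image_open _ _ _ A i.
have /choice[L HL] d : exists L : R, \forall rho \near 0^'+, tame_on_ball (X d i) z0 L rho.
  by apply: (C2_tame oi) => //; exact: smooth_field_C2.
exists (`|L La| + `|L Lb| + `|L Lc|).
have [r r0 Hr] : exists2 r, 0 < r & forall z, `|z - z0| < r -> chart_image i z.
  by apply/nearP; exact: open_nbhs_nbhs.
have Hall : \forall rho \near 0^'+, forall d, tame_on_ball (X d i) z0 (L d) rho.
  exact: (@filter_forall _ _ (fun d (rho : R) => tame_on_ball (X d i) z0 (L d) rho) 0^'+).
near=> rho; split.
  move=> d; apply: (@tame_on_ball_le _ _ _ _ (L d)).
    have := normr_ge0 (L La); have := normr_ge0 (L Lb); have := normr_ge0 (L Lc).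
    by case: d; [have := ler_norm (L La)|have := ler_norm (L Lb)|have := ler_norm (L Lc)];
      lra.
  by move: d; near: rho.
move=> z zr; apply: Hr; apply: lt_trans zr _.
by near: rho; exact: nbhs_right_lt.
Unshelve. all: by end_near. Qed.

(** The time [d] is short enough for all integral curves which start in the ball
of half radius to exist and stay in the ball, and for [absorb_half] to apply. *)
Definition flow_box i p (L rho d : R) :=
  [/\ chart_dom A i p, good_ball X i (chart A i p) L rho,
      0 < rho /\ 0 < d & d * L <= 1 / 2 /\ d * L <= rho / 2].

Lemma flow_box_exists p (W : set E) : nbhs p W ->
  exists i L rho d, flow_box i p L rho d /\
    forall z, `|z - chart A i p| < rho -> W (chart_inv A i z).
Proof.
move=> pW; have [i ip] := @chart_dom_cover _ _ _ A p.
have [L HL] := good_ball_near ip.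
have cinv := chart_inv_continuous (chart_image_chart ip).
have [r r0 Hr] : exists2 r, 0 < r & forall z, `|z - chart A i p| < r -> W (chart_inv A i z).
  by apply/nearP; apply: cinv; rewrite chartK.
have [rho [[rho0 rr] gb]] : exists rho, (0 < rho /\ rho < r) /\
    good_ball X i (chart A i p) L rho.
  apply: (@filter_ex _ (0 : R)^'+); near=> rho; split; last by near: rho.
  split; first by near: rho; exact: nbhs_right_gt.
  by near: rho; exact: nbhs_right_lt.
have L0 : 0 <= L by case: gb => /(_ La)[].
pose d := Num.min 1 rho / (2 * (L + 1)).
have L1 : 0 < 2 * (L + 1) by lra.
have d0 : 0 < d by rewrite divr_gt0// lt_min rho0 ltr01.
have dL : d * (2 * L) <= Num.min 1 rho.
  rewrite /d mulrAC ler_pdivrMr// ler_wpM2l//; last by lra.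
  by rewrite le_min ler01 ltW.
exists i, L, rho, d; split.
  split => //.
  have := dL; rewrite le_min => /andP[H1 H2]; split; lra.
by move=> z zr; apply: Hr; exact: lt_trans rr.
Unshelve. all: by end_near. Qed.

(** The equation in one chart implies the equation in all others, since the
components of the field transform by the differential of the transition. *)
Lemma integral_curve_lift i d (y : R -> 'rV[R]_n) (J : set R) :
  (forall t, J t -> is_derive t 1 y (X d i (y t)) /\ chart_image i (y t)) ->
  integral_curve (X d) J (chart_inv A i \o y).
Proof.
move=> Hy s Js; have [dy [p ip py]] := Hy s Js.
have gs : chart_inv A i (y s) = p by rewrite -py chartK.
have cy : {for s, continuous y}.
  by apply: differentiable_continuous; apply/derivable1_diffP.
split.
  apply: continuous_comp => //.
  by apply: chart_inv_continuous; exists p.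
move=> j /=; rewrite gs => jp.
have [_ trans] := sX d; rewrite (trans i j p ip jp) py.
rewrite -[_ \o (_ \o y)]/((chart A j \o chart_inv A i) \o y).
by apply: is_derive_curve => //; rewrite -py; exact: transition_differentiable.
Qed.

Lemma flow_box_curve i p L rho d e q : flow_box i p L rho d ->
  chart_dom A i q -> `|chart A i q - chart A i p| < rho / 2 ->
  exists g : R -> E, [/\ integral_curve (X e) `]- d, d[ g, g 0 = q &
    forall t, `|t| < d -> chart_dom A i (g t) /\ `|chart A i (g t) - chart A i p| < rho].
Proof.
move=> [ip [tame im] [rho0 d0] [dL dLr]] iq qp.
have [L0 tameL] := tame e.
have [y [y0 Hy]] : exists y : R -> 'rV[R]_n, y 0 = chart A i q /\
    forall t : R, `|t| < d -> is_derive t 1 y (X e i (y t)) /\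
      `|y t - chart A i p| < rho.
  apply: (@picard _ _ _ _ _ _ L) => //.
    by move=> x xr; case: (tameL x xr).
  by move=> x x' xr xr'; case: (tameL x xr) => _ _ _ /(_ x' xr')[].
exists (chart_inv A i \o y); split.
- apply: integral_curve_lift => t /=; rewrite in_itv /= -ltr_norml => /Hy[dy yr].
  by split => //; exact: im.
- by rewrite /= y0 chartK.
- move=> t /Hy[_ yr] /=; have iy := im _ yr.
  by rewrite chart_invK//; split => //; exact: chart_image_dom.
Qed.

Lemma curve_chart_derive i V (g : R -> E) (J : set R) s : integral_curve V J g ->
  J s -> chart_dom A i (g s) ->
  is_derive s 1 (chart A i \o g) (V i (chart A i (g s))).
Proof. by move=> Hg Js; have [_ H] := Hg s Js; exact: H. Qed.

Lemma curve_continuous V (g : R -> E) (J : set R) s : integral_curve V J g ->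
  J s -> g t @[t --> s] --> g s.
Proof. by move=> Hg Js; have [] := Hg s Js. Qed.

Lemma curve_near_chart i V (g : R -> E) (J : set R) s (e : R) :
  integral_curve V J g -> J s -> chart_dom A i (g s) -> 0 < e ->
  \forall t \near s, chart_dom A i (g t) /\ `|chart A i (g t) - chart A i (g s)| < e.
Proof.
move=> Hg Js ig e0; have cg := curve_continuous Hg Js.
near=> t; split; first by near: t; apply: cg; exact: chart_dom_near.
rewrite distrC; near: t.
have : chart A i (g t) @[t --> s] --> chart A i (g s).
  by apply: (cvg_comp _ _ cg); exact: chart_continuous.
by move=> /cvgrPdist_lt/(_ _ e0).
Unshelve. all: by end_near. Qed.

(** During the time [d], the distance grows by at most half of its supremum. *)
Lemma curves_close (f : 'rV[R]_n -> 'rV[R]_n) (z0 : 'rV[R]_n) (L rho d s : R)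
    (y1 y2 : R -> 'rV[R]_n) : tame_on_ball f z0 L rho ->
  0 < d -> d * L <= 1 / 2 ->
  (forall t, `|t - s| < d -> [/\ is_derive t 1 y1 (f (y1 t)), is_derive t 1 y2 (f (y2 t)),
     `|y1 t - z0| < rho & `|y2 t - z0| < rho]) ->
  forall t, `|t - s| < d -> `|y1 t - y2 t| <= 2 * `|y1 s - y2 s|.
Proof.
move=> [L0 tame] d0 dL Hy.
apply: (@absorb_half R R [set t | `|t - s| < d] _ _ (2 * rho)).
  move=> t /Hy[_ _ y1r y2r]; rewrite -(subrKA z0).
  apply: le_trans (ler_normD _ _) _.
  by rewrite [X in _ + X]distrC; lra.
move=> B HB t /= td.
have sd : `|s - s| < d by rewrite subrr normr0.
have B0 : 0 <= B by apply: le_trans (HB s sd).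
have := @derive_bound_le R _ (fun x => y1 x - y2 x)
  (fun x => f (y1 x) - f (y2 x)) s t (L * B) => H.
have {}H : `|y1 t - y2 t - (y1 s - y2 s)| <= L * B * `|t - s|.
  apply: H => x xst; have xd : `|x - s| < d.
    exact: le_lt_trans (between_dist xst) td.
  have [dy1 dy2 y1r y2r] := Hy x xd.
  split; first exact: is_deriveB.
  have [_ _ _ /(_ _ y1r)[H _]] := tame _ y2r.
  by apply: le_trans H _; rewrite ler_wpM2l//; exact: HB.
have H2 : L * B * `|t - s| <= B / 2.
  rewrite mulrAC -[leRHS]mulrC ler_wpM2r//; apply: le_trans (_ : L * d <= _).
    by rewrite ler_wpM2l// ltW.
  by rewrite mulrC; lra.
rewrite -[y1 t - y2 t](subrK (y1 s - y2 s)).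
by apply: le_trans (ler_normD _ _) _; lra.
Qed.

(** Agreement of the curves is an open condition by [curves_close] and a closed
one because the manifold is Hausdorff. *)
Lemma integral_curve_unique d (g1 g2 : R -> E) (l h l' h' s0 : R) :
  integral_curve (X d) `]l, h[ g1 -> integral_curve (X d) `]l', h'[ g2 ->
  l < s0 < h -> l' < s0 < h' -> g1 s0 = g2 s0 ->
  forall s, l < s < h -> l' < s < h' -> g1 s = g2 s.
Proof.
move=> H1 H2 s0l s0l' E0 s sl sl'.
have loc x : l < x < h -> l' < x < h' -> exists2 e : R, 0 < e &
    forall r r', `|r - x| < e -> `|r' - x| < e -> g1 r = g2 r -> g1 r' = g2 r'.
  move=> xl xl'.
  have J1x : `]l, h[%classic x by rewrite /= in_itv.
  have J2x : `]l', h'[%classic x by rewrite /= in_itv.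
  have c1 := curve_continuous H1 J1x; have c2 := curve_continuous H2 J2x.
  have [E12|N12] := pselect (g1 x = g2 x); last first.
    have [e e0 He] := (nearP _ _).1 (separated_near _ c1 c2 N12).
    by exists e => // r r' re _ /(He r re).
  have [i [L [rho [del [[ip [tame im] [rho0 del0] [dL dLr]] _]]]]] :=
    @flow_box_exists (g1 x) setT filterT.
  have ip2 : chart_dom A i (g2 x) by rewrite -E12.
  have N1 := curve_near_chart H1 J1x ip rho0.
  have N2 := curve_near_chart H2 J2x ip2 rho0.
  have Nl : \forall t \near x, l < t < h by apply: near_in_itvoo; rewrite in_itv.
  have Nl' : \forall t \near x, l' < t < h' by apply: near_in_itvoo; rewrite in_itv.
  have : \forall t \near x, [/\ l < t < h, l' < t < h',
      chart_dom A i (g1 t) /\ `|chart A i (g1 t) - chart A i (g1 x)| < rho &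
      chart_dom A i (g2 t) /\ `|chart A i (g2 t) - chart A i (g2 x)| < rho].
    by near=> t; split; near: t.
  move=> /nearP[e1 e10 He1].
  pose e := Num.min e1 del.
  have e0 : 0 < e by rewrite lt_min e10.
  have ee1 : e <= e1 by rewrite ge_min lexx.
  have eL : e * L <= 1 / 2.
    have [L0 _] := tame d.
    by apply: le_trans dL; rewrite ler_wpM2r// ge_min lexx orbT.
  have all_eq r : `|r - x| < e -> g1 r = g2 r.
    move=> re.
    have Hr t : `|t - x| < e -> _ := fun te => He1 t (lt_le_trans te ee1).
    have := @curves_close _ _ _ _ _ x (chart A i \o g1) (chart A i \o g2) (tame d) e0 eL.
    move=> /(_ _ r re) /=; rewrite E12 subrr normr0 mulr0 normr_le0 subr_eq0.
    have [_ _ [i1 _] [i2 _]] := Hr r re.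
    move=> H; rewrite -(chartK i1) -(chartK i2); congr chart_inv; apply/eqP; apply: H.
    move=> t te; have [tl tl' [i1t r1t] [i2t r2t]] := Hr t te; split.
    - by apply: (curve_chart_derive H1) => //=; rewrite in_itv.
    - by apply: (curve_chart_derive H2) => //=; rewrite in_itv.
    - by rewrite -E12.
    - exact: r2t.
  by exists e => // r r' _ r'e _; exact: all_eq.
case/orP: (le_total s0 s) => [s0s|ss0].
  apply: (@locally_constant_le R (fun s => g1 s = g2 s) s0 s s0s _).1 => // x xs.
  have [e e0 He] : exists2 e : R, 0 < e &
    forall r r', `|r - x| < e -> `|r' - x| < e -> g1 r = g2 r -> g1 r' = g2 r'.
    by apply: loc; lra.
  by exists e => // r r' _ _; exact: He.
apply: (@locally_constant_le R (fun s => g1 s = g2 s) s s0 ss0 _).2 => // x xs.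
have [e e0 He] : exists2 e : R, 0 < e &
  forall r r', `|r - x| < e -> `|r' - x| < e -> g1 r = g2 r -> g1 r' = g2 r'.
  by apply: loc; lra.
by exists e => // r r' _ _; exact: He.
Unshelve. all: by end_near. Qed.

Lemma flow_unique d r p q q' : flow (X d) r p q -> flow (X d) r p q' -> q = q'.
Proof.
move=> [g [l [h [lh rlh Hg g0 <-]]]] [g' [l' [h' [lh' rlh' Hg' g0' <-]]]].
by apply: (integral_curve_unique Hg Hg' lh lh') => //; rewrite g0.
Qed.

Lemma integral_curve_shift V (g : R -> E) (l h r : R) :
  integral_curve V `]l, h[ g ->
  integral_curve V `]l + r, h + r[ (fun t => g (t - r)).
Proof.
move=> Hg s /=; rewrite in_itv /= => slh.
have slh' : `]l, h[%classic (s - r) by rewrite /= in_itv /=; lra.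
have [cg dg] := Hg _ slh'; split.
  apply: (@continuous_comp _ _ _ (fun t => t - r) g) => //.
  by apply: cvgB; [exact: cvg_id|exact: cvg_cst].
move=> i ig; have /is_derive1P H := dg i ig.
apply/is_derive1P => e e0; have /nearP[d d0 Hd] := H e e0.
apply: (nearI d0) => t ts; have := Hd (t - r).
by rewrite (_ : t - r - (s - r) = t - s) => [/(_ ts)|]; last by ring.
Qed.

Lemma flow_curve V (g : R -> E) (l h r s : R) : integral_curve V `]l, h[ g ->
  l < r < h -> l < s < h -> flow V (s - r) (g r) (g s).
Proof.
move=> Hg rlh slh; exists (fun t => g (t + r)), (l - r), (h - r); split.
- lra.
- lra.
- rewrite (_ : (fun t => g (t + r)) = fun t => g (t - - r)).
    exact: integral_curve_shift.
  by apply/funext => t; rewrite opprK.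
- by rewrite add0r.
- by rewrite subrK.
Qed.

Lemma flow_inv V r p q : flow V r p q -> flow V (- r) q p.
Proof.
move=> [g [l [h [lh rlh Hg g0 gr]]]].
by have := flow_curve Hg rlh lh; rewrite sub0r g0 gr.
Qed.

Lemma integral_curve_glue d (g g' : R -> E) (l h l' h' r : R) :
  integral_curve (X d) `]l, h[ g -> integral_curve (X d) `]l', h'[ g' ->
  l < r < h -> l' < r < h' -> g r = g' r ->
  exists k : R -> E, [/\ integral_curve (X d) `]Num.min l l', Num.max h h'[ k,
    forall t, l < t < h -> k t = g t & forall t, l' < t < h' -> k t = g' t].
Proof.
move=> Hg Hg' rlh rlh' Er.
pose k t := if l < t < h then g t else g' t.
have kg t : l < t < h -> k t = g t by rewrite /k => ->.
have kg' t : l' < t < h' -> k t = g' t.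
  rewrite /k; case: ifP => // tlh tlh'.
  exact: (integral_curve_unique Hg Hg' rlh rlh').
exists k; split=> // s /=; rewrite in_itv /= gt_min lt_max => slh.
have : l < s < h \/ l' < s < h'.
  have [sl|sl] := boolP (l < s < h); first by left.
  by right; move: slh sl; rewrite negb_and -!leNgt; lra.
have local g1 l1 h1 : integral_curve (X d) `]l1, h1[ g1 ->
    (forall t, l1 < t < h1 -> k t = g1 t) -> l1 < s < h1 ->
    {for s, continuous k} /\ forall i, chart_dom A i (k s) ->
      is_derive s 1 (chart A i \o k) (X d i (chart A i (k s))).
  move=> H1 k1 sl1.
  have Nk : \forall t \near s, g1 t = k t.
    have : \forall t \near s, l1 < t < h1 by apply: near_in_itvoo; rewrite in_itv.
    by apply: filterS => t /k1.
  have J1 : `]l1, h1[%classic s by rewrite /= in_itv.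
  have [c1 d1] := H1 s J1; split.
    suff : k t @[t --> s] --> k s by [].
    rewrite (k1 s sl1); apply: cvg_trans c1.
    exact: near_eq_cvg.
  move=> i; rewrite (k1 s sl1) => i1.
  apply: near_eq_is_derive (d1 i i1).
  by apply: filterS Nk => t /= ->.
by case=> [s1|s1]; [exact: (local g l h)|exact: (local g' l' h')].
Qed.

Lemma flow_trans d r s p q q' : flow (X d) r p q -> flow (X d) s q q' ->
  flow (X d) (r + s) p q'.
Proof.
move=> [g [l [h [lh rlh Hg g0 gr]]]] [g' [l' [h' [lh' slh' Hg' g0' gs]]]].
have Hg'' := integral_curve_shift (r := r) Hg'.
have r' : l' + r < r < h' + r by lra.
have Er : g r = g' (r - r) by rewrite subrr gr g0'.
have [k [Hk kg kg']] := integral_curve_glue Hg Hg'' rlh r' Er.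
exists k, (Num.min l (l' + r)), (Num.max h (h' + r)); split => //.
- by rewrite gt_min lt_max; lra.
- by rewrite gt_min lt_max; lra.
- by rewrite kg.
- by rewrite kg'; [rewrite addrAC subrr add0r|lra].
Qed.

Lemma flow0 d p : flow (X d) 0 p p.
Proof.
have [i [L [rho [e [box _]]]]] := @flow_box_exists p setT filterT.
have [ip _ [rho0 e0] _] := box.
have [g [Hg g0 _]] : exists g : R -> E, [/\ integral_curve (X d) `]- e, e[ g, g 0 = p &
    forall t, `|t| < e -> chart_dom A i (g t) /\ `|chart A i (g t) - chart A i p| < rho].
  by apply: (flow_box_curve _ box) => //; rewrite subrr normr0; lra.
by exists g, (- e), e; split => //; lra.
Qed.

End Flows.

(** * First order displacements *)

Section Displacement.
Variables (R : realType) (n : nat) (E : topologicalType).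
Variable A : smooth_manifold R n E.
Variable X : letter -> local_field A.
Hypothesis sX : forall d, smooth_vector_field (X d).
Variables (T : Type) (F : set_system T).
Context {FF : Filter F}.
Variable m : T -> R.
Hypothesis m_ge0 : forall t, 0 <= m t.
Hypothesis m_cvg0 : forall e : R, 0 < e -> \forall t \near F, m t <= e.

Local Notation chart_image i := (chart A i @` chart_dom A i).

Definition field_comb i (y : letter -> R) (z : 'rV[R]_n) : 'rV[R]_n :=
  \sum_d y d *: X d i z.

Definition small (y : T -> letter -> R) := exists2 K : R, 0 <= K &
  \forall t \near F, forall d, `|y t d| <= K * m t.

Lemma between_trans (a x y z : R) : Num.min a z <= x <= Num.max a z ->
  Num.min a x <= y <= Num.max a x -> Num.min a z <= y <= Num.max a z.
Proof.
by case: (leP a z) => az; case: (leP a x) => ax /andP[? ?] /andP[? ?];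
  apply/andP; split; lra.
Qed.

(** To first order in [m t], the points [p t] are displaced from [p0] by the
tangent vector with coefficients [y t] in the fields.  Displacements along a
filter stand for the differential of the flow: only the directions spanned by
the three fields occur, and one-sided limits are covered. *)
Definition displaced (p : T -> E) (p0 : E) (y : T -> letter -> R) :=
  p @ F --> p0 /\ forall i, chart_dom A i p0 -> forall e : R, 0 < e ->
  \forall t \near F, `|chart A i (p t) - chart A i p0 -
    field_comb i (y t) (chart A i p0)| <= e * m t.

Lemma field_comb_norm i (y : letter -> R) z (B K : R) : 0 <= B ->
  (forall d, `|X d i z| <= B) -> (forall d, `|y d| <= K) ->
  `|field_comb i y z| <= 3 * (K * B).
Proof.
move=> B0 XB yK; rewrite /field_comb sum_letter.
have H d : `|y d *: X d i z| <= K * B by rewrite normrZ ler_pM.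
apply: le_trans (ler_normD _ _) _.
apply: le_trans (lerD (ler_normD _ _) (lexx _)) _.
by have := H La; have := H Lb; have := H Lc; lra.
Qed.

Lemma cvg_chart i (p : T -> E) p0 : chart_dom A i p0 -> p @ F --> p0 ->
  (\forall t \near F, chart_dom A i (p t)) /\
  (forall e : R, 0 < e -> \forall t \near F, `|chart A i (p t) - chart A i p0| < e).
Proof.
move=> ip pp; split; first by apply: pp; exact: chart_dom_near.
move=> e e0; have : chart A i (p t) @[t --> F] --> chart A i p0.
  by apply: (cvg_comp _ _ pp); exact: chart_continuous.
move=> /cvgrPdist_lt/(_ _ e0); apply: filterS => t.
by rewrite distrC.
Qed.

Lemma chart_displacement_bound i (p : T -> E) p0 y : small y -> chart_dom A i p0 ->
  (forall e : R, 0 < e -> \forall t \near F, `|chart A i (p t) - chart A i p0 -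
    field_comb i (y t) (chart A i p0)| <= e * m t) ->
  exists2 K : R, 0 < K & \forall t \near F, `|chart A i (p t) - chart A i p0| <= K * m t.
Proof.
move=> [K K0 yK] ip Hp; set z := chart A i p0 in Hp *.
pose B := `|X La i z| + `|X Lb i z| + `|X Lc i z|.
have B0 : 0 <= B by rewrite !addr_ge0.
have XB d : `|X d i z| <= B.
  have := normr_ge0 (X La i z); have := normr_ge0 (X Lb i z).
  by have := normr_ge0 (X Lc i z); rewrite /B; case: d; lra.
exists (3 * (K * B) + 1); first by rewrite ltr_pwDr// !mulr_ge0.
have Hp1 := Hp 1 ltr01.
near=> t; have H1 : `|chart A i (p t) - z - field_comb i (y t) z| <= 1 * m t.
  by near: t.
have H2 : `|field_comb i (y t) z| <= 3 * (K * m t * B).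
  apply: field_comb_norm => // d; move: d; near: t; exact: yK.
rewrite -[X in `|X|](subrK (field_comb i (y t) z)).
by apply: le_trans (ler_normD _ _) _; lra.
Unshelve. all: by end_near. Qed.

(** The transition to another chart is differentiable, and its differential maps
the components of the fields to their components in the other chart. *)
Lemma displaced_chart i (p : T -> E) p0 y : small y -> p @ F --> p0 ->
  chart_dom A i p0 -> (forall e : R, 0 < e ->
  \forall t \near F, `|chart A i (p t) - chart A i p0 -
    field_comb i (y t) (chart A i p0)| <= e * m t) ->
  displaced p p0 y.
Proof.
move=> sy pp ip Hi; split => // j jp e e0.
have [K K0 HK] := chart_displacement_bound sy ip Hi.
set z := chart A i p0 in Hi HK *.
pose tau := chart A j \o chart_inv A i.
have dtau : differentiable tau z by exact: transition_differentiable.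
have tauz : tau z = chart A j p0 by rewrite /tau /z /= chartK.
pose N := \sum_k `|'D_(delta_mx 0 k) tau z|.
have N0 : 0 <= N by exact: sumr_ge0.
have tauN v : `|'D_v tau z| <= N * `|v|.
  rewrite derive_dir_sum// mulr_suml; apply: le_trans (ler_norm_sum _ _ _) _.
  apply: ler_sum => k _; rewrite normrZ mulrC ler_wpM2l//; exact: rV_coord_le.
have e1 : 0 < e / 2 / K by rewrite !divr_gt0.
have e2 : 0 < e / 2 / (N + 1) by rewrite !divr_gt0// ltr_pwDr.
have [ci cid] := cvg_chart ip pp; have [cj _] := cvg_chart jp pp.
have [d d0 Hd] := (nearP _ _).1 (differentiable_expand dtau e1).
near=> t.
have it : chart_dom A i (p t) by near: t.
have tauE : tau (chart A i (p t)) = chart A j (p t) by rewrite /tau /= chartK.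
have zt : `|chart A i (p t) - z| < d by near: t; exact: cid.
have ztK : `|chart A i (p t) - z| <= K * m t by near: t.
have Ht : `|chart A i (p t) - z - field_comb i (y t) z| <= e / 2 / (N + 1) * m t.
  by near: t; exact: Hi.
have := Hd _ zt; rewrite tauz tauE => H1.
have combE : field_comb j (y t) (chart A j p0) = 'D_(field_comb i (y t) z) tau z.
  rewrite deriveE// /field_comb linear_sum; apply: eq_bigr => k _.
  rewrite linearZ /= -deriveE//; congr (_ *: _).
  by have [_ trans] := sX k; rewrite (trans i j p0 ip jp).
rewrite combE.
rewrite (_ : _ - _ - _ = (chart A j (p t) - chart A j p0 - 'D_(chart A i (p t) - z) tau z)
  + 'D_(chart A i (p t) - z - field_comb i (y t) z) tau z); last first.
  by rewrite [X in _ = _ + X]derive_dirB// addrA subrK.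
apply: le_trans (ler_normD _ _) _.
have H2 : e / 2 / K * `|chart A i (p t) - z| <= e / 2 * m t.
  have -> : e / 2 * m t = e / 2 / K * (K * m t) by field; rewrite gt_eqF.
  by rewrite ler_wpM2l// ltW.
have H3 : `|'D_(chart A i (p t) - z - field_comb i (y t) z) tau z| <= e / 2 * m t.
  apply: le_trans (tauN _) _; apply: (@le_trans _ _ (N * (e / 2 / (N + 1) * m t))).
    by rewrite ler_wpM2l.
  have -> : N * (e / 2 / (N + 1) * m t) = (e / 2 * m t) * (N / (N + 1)).
    by field; rewrite gt_eqF// ltr_pwDr.
  rewrite ler_piMr//; first by rewrite mulr_ge0// divr_ge0// ltW.
  by rewrite ler_pdivrMr ?ltr_pwDr// mul1r lerDl.
by have := m_ge0 t; lra.
Unshelve. all: by end_near. Qed.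

Lemma eq_displaced p p0 y y' : (forall t d, y t d = y' t d) ->
  displaced p p0 y -> displaced p p0 y'.
Proof.
move=> yy' [pp Hp]; split => // i ip e e0; have := Hp i ip e e0.
apply: filterS => t; congr (`|_ - _| <= _).
by apply: eq_bigr => d _; rewrite yy'.
Qed.

Lemma displaced_cst p0 : displaced (fun=> p0) p0 (fun _ _ => 0).
Proof.
split; first exact: cvg_cst.
move=> i _ e e0; near=> t; rewrite subrr sub0r normrN /field_comb big1.
  by rewrite normr0 mulr_ge0// ltW.
by move=> d _; rewrite scale0r.
Unshelve. all: by end_near. Qed.

(** The coefficients [c r] (with [r]-derivative [c' r]) of a vector field which
is transported by the flow of [X a], i.e. whose Lie derivative along the
space-time field [d/dr + X a] vanishes. *)
Record transported (a : letter) (c c' : R -> T -> letter -> R) : Prop := Transported {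
  transported_derive : forall (r : R) t d, is_derive r 1 (fun r => c r t d) (c' r t d);
  transported_eq : forall r t i z, chart_image i z -> \sum_d (c' r t d *: X d i z +
     c r t d *: lie_bracket (X a) (X d) i z) = 0;
  transported_small : forall B : R, exists2 K : R, 0 <= K &
     \forall t \near F, forall (r : R) d, `|r| <= B -> `|c r t d| <= K * m t }.

Lemma transported_small_at a c c' r : transported a c c' -> small (c r).
Proof.
move=> [_ _ /(_ `|r|)[K K0 HK]]; exists K => //.
by apply: filterS HK => t Ht d; exact: Ht.
Qed.

Lemma transported_shift a c c' r0 : transported a c c' ->
  transported a (fun r => c (r + r0)) (fun r => c' (r + r0)).
Proof.
move=> [Hd He Hs]; split.
- move=> r t d; have /is_derive1P H := Hd (r + r0) t d.
  apply/is_derive1P => e e0; have /nearP[del del0 Hdel] := H e e0.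
  apply: (nearI del0) => x xr; have := Hdel (x + r0).
  by rewrite (_ : x + r0 - (r + r0) = x - r) => [/(_ xr)|]; last by ring.
- by move=> r t i z; exact: He.
- move=> B; have [K K0 HK] := Hs (B + `|r0|); exists K => //.
  apply: filterS HK => t Ht r d rB; apply: Ht.
  by apply: le_trans (ler_normD _ _) _; rewrite lerD2r.
Qed.

(** The defect of the expansion satisfies a linear differential inequality with
an error term of second order: by the transport equation, the candidate
displacement solves the linearized equation along [h0]. *)
Lemma transport_estimate i (V : 'rV[R]_n -> 'rV[R]_n) z0 (L rho d : R)
    (h0 h : R -> 'rV[R]_n) (k k' : R -> letter -> R) (K eta : R) :
  (forall a, tame_on_ball (X a i) z0 L rho) -> tame_on_ball V z0 L rho ->
  0 < d -> d * L <= 1 / 2 ->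
  (forall r : R, `|r| < d -> [/\ is_derive r 1 h0 (V (h0 r)), is_derive r 1 h (V (h r)),
     `|h0 r - z0| < rho & `|h r - z0| < rho]) ->
  (forall (r : R) a, is_derive r 1 (fun r => k r a) (k' r a)) ->
  (forall (r : R), `|r| < d -> \sum_a (k' r a *: X a i (h0 r) + k r a *:
     ('D_(V (h0 r)) (X a i) (h0 r) - 'D_(X a i (h0 r)) V (h0 r))) = 0) ->
  (forall (r : R) a, `|r| < d -> `|k r a| <= K) ->
  (forall r : R, `|r| < d -> `|h r - h0 r| <= eta) ->
  forall r : R, `|r| < d -> `|h r - h0 r - field_comb i (k r) (h0 r)| <=
    2 * (`|h 0 - h0 0 - field_comb i (k 0) (h0 0)| + d * L * eta ^+ 2).
Proof.
move=> tameX tameV d0 dL Hh dk keq kK heta.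
have [L0 tV] := tameV.
pose e r := h r - h0 r - field_comb i (k r) (h0 r).
pose e' r := V (h r) - V (h0 r) - \sum_a (k' r a *: X a i (h0 r) +
   k r a *: 'D_(V (h0 r)) (X a i) (h0 r)).
have z0d : `|0 : R| < d by rewrite normr0.
have de (r : R) : `|r| < d -> is_derive r 1 e (e' r).
  move=> rd; have [dh0 dh h0r hr] := Hh r rd.
  have dhh : is_derive r 1 (h - h0) (V (h r) - V (h0 r)) by exact: is_deriveB.
  suff dcomb : is_derive r 1 (fun r => field_comb i (k r) (h0 r))
      (\sum_a (k' r a *: X a i (h0 r) + k r a *: 'D_(V (h0 r)) (X a i) (h0 r))).
    exact: (is_deriveB dhh dcomb).
  rewrite sum_letter (_ : (fun r => _) = fun r => k r La *: X La i (h0 r) +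
    k r Lb *: X Lb i (h0 r) + k r Lc *: X Lc i (h0 r)); last first.
    by apply/funext => x; rewrite /field_comb sum_letter.
  have H a : is_derive r 1 (fun r => k r a *: X a i (h0 r)) (k' r a *: X a i (h0 r) +
      k r a *: 'D_(V (h0 r)) (X a i) (h0 r)).
    apply: is_derive_scale => //; apply: (is_derive_curve (f := X a i)) => //.
    by have [_ /(_ _ h0r)[]] := tameX a.
  exact: (is_deriveD (is_deriveD (H La) (H Lb)) (H Lc)).
have e'E (r : R) : `|r| < d -> e' r = (V (h r) - V (h0 r) - 'D_(h r - h0 r) V (h0 r)) +
    'D_(e r) V (h0 r).
  move=> rd; have [dh0 dh h0r hr] := Hh r rd.
  have [dV _ _ _] := tV _ h0r.
  rewrite /e [X in _ = _ + X]derive_dirB// addrA subrK /e'; congr (_ - _).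
  have combE : 'D_(field_comb i (k r) (h0 r)) V (h0 r) =
      \sum_a k r a *: 'D_(X a i (h0 r)) V (h0 r).
    rewrite deriveE// /field_comb linear_sum; apply: eq_bigr => a _.
    by rewrite linearZ /= -deriveE.
  rewrite combE; apply/eqP; rewrite -subr_eq0 -sumrB; apply/eqP.
  rewrite -[RHS](keq r rd); apply: eq_bigr => a _.
  by rewrite scalerBr addrA.
have e'le (r : R) : `|r| < d -> `|e' r| <= L * eta ^+ 2 + L * `|e r|.
  move=> rd; have [dh0 dh h0r hr] := Hh r rd; rewrite e'E//.
  have [dV _ bV lV] := tV _ h0r; have [_ H] := lV _ hr.
  apply: le_trans (ler_normD _ _) (lerD _ (bV _)); apply: le_trans H _.
  by rewrite ler_wpM2l// lerXn2r// ?nnegrE// ?heta// (le_trans _ (heta r rd)).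
apply: (@absorb_half R R [set r | `|r| < d] (fun r => `|e r|) _
  (eta + 3 * (K * L))).
  move=> r /= rd; have [_ _ h0r _] := Hh r rd.
  apply: le_trans (ler_normB _ _) (lerD (heta r rd) _).
  apply: field_comb_norm => // a; last exact: kK.
  by have [_ /(_ _ h0r)[]] := tameX a.
move=> B HB r /= rd.
have B0 : 0 <= B by apply: le_trans (HB 0 z0d).
have := @derive_bound_le R _ e e' 0 r (L * eta ^+ 2 + L * B).
rewrite subr0 => H.
have {}H : `|e r - e 0| <= (L * eta ^+ 2 + L * B) * `|r|.
  apply: H => x x0r; have xd : `|x| < d.
    by apply: le_lt_trans rd; have := between_dist x0r; rewrite !subr0.
  split; first exact: de.
  by apply: le_trans (e'le x xd) _; rewrite lerD2l ler_wpM2l// HB.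
have eta0 : 0 <= L * eta ^+ 2 + L * B by rewrite addr_ge0// mulr_ge0// sqr_ge0.
have H2 : (L * eta ^+ 2 + L * B) * `|r| <= (L * eta ^+ 2 + L * B) * d.
  by rewrite ler_wpM2l// ltW.
have H3 : L * B * d <= B / 2.
  by rewrite mulrAC [L * d]mulrC [leRHS]mulrC ler_wpM2r//; lra.
rewrite -[e r](subrK (e 0)); apply: le_trans (ler_normD _ _) _.
rewrite -/(e 0); move: H H2 H3; lra.
Qed.

(** By [transport_estimate], the defect at time [r] is bounded by the defect at
time 0, which is [o(m)], plus a multiple of [m^2]. *)
Lemma displaced_flow_local a i p1 (L rho d : R) : flow_box X i p1 L rho d ->
  forall (p : T -> E) p0 c c', transported a c c' ->
  chart_dom A i p0 -> `|chart A i p0 - chart A i p1| < rho / 2 ->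
  displaced p p0 (c 0) -> forall r : R, `|r| < d ->
  exists q q0, [/\ flow (X a) r p0 q0, \forall t \near F, flow (X a) r (p t) (q t) &
    displaced q q0 (c r)].
Proof.
move=> box p p0 c c' Hc ip0 p0r [pp Hp] r rd.
have [ip1 [tame im] [rho0 d0] [dL dLr]] := box.
have [L0 tameL] := tame a.
have [g0 [Hg0 g00 g0r]] := flow_box_curve sX a box ip0 p0r.
have [ci cid] := cvg_chart ip0 pp.
have ball_near : \forall t \near F, chart_dom A i (p t) /\
    `|chart A i (p t) - chart A i p1| < rho / 2.
  have gap : 0 < rho / 2 - `|chart A i p0 - chart A i p1| by rewrite subr_gt0.
  near=> t; split; first by near: t.
  have H : `|chart A i (p t) - chart A i p0| < rho / 2 - `|chart A i p0 - chart A i p1|.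
    by near: t; exact: cid.
  rewrite -(subrKA (chart A i p0)); apply: le_lt_trans (ler_normD _ _) _; lra.
have /choice[g Hg] : forall t, exists g : R -> E, chart_dom A i (p t) /\
    `|chart A i (p t) - chart A i p1| < rho / 2 ->
    [/\ integral_curve (X a) `]- d, d[ g, g 0 = p t &
    forall t : R, `|t| < d -> chart_dom A i (g t) /\ `|chart A i (g t) - chart A i p1| < rho].
  move=> t; have [[it tr]|nt] := pselect (chart_dom A i (p t) /\
    `|chart A i (p t) - chart A i p1| < rho / 2); last by exists (fun=> p0).
  by have [g Hg] := flow_box_curve sX a box it tr; exists g.
have dd0 : - d < 0 < d by lra.
have ddr : - d < r < d by rewrite -ltr_norml.
have [i0r h0r] := g0r r rd.
exists (fun t => g t r), (g0 r); split.
- by have := flow_curve Hg0 dd0 ddr; rewrite subr0 g00.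
- apply: filterS ball_near => t /Hg[Hgt gt0 _].
  by have := flow_curve Hgt dd0 ddr; rewrite subr0 gt0.
have s0 := transported_small_at 0 Hc.
have [K0 K0p HK0] := chart_displacement_bound s0 ip0 (Hp i ip0).
have [Kc Kc0 HKc] := transported_small Hc d.
pose h0 := chart A i \o g0; pose h t := chart A i \o g t.
have curves : \forall t \near F, forall x : R, `|x| < d ->
    [/\ is_derive x 1 h0 (X a i (h0 x)), is_derive x 1 (h t) (X a i (h t x)),
     `|h0 x - chart A i p1| < rho & `|h t x - chart A i p1| < rho].
  apply: filterS ball_near => t /Hg[Hgt gt0 gtr] x xd.
  have xJ : `]- d, d[%classic x by rewrite /= in_itv /= -ltr_norml.
  have [i0x h0x] := g0r x xd; have [itx htx] := gtr x xd; split => //.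
  - exact: curve_chart_derive Hg0 xJ i0x.
  - exact: curve_chart_derive Hgt xJ itx.
have start : \forall t \near F, h t 0 = chart A i (p t).
  by apply: filterS ball_near => t /Hg[_ gt0 _]; rewrite /h /= gt0.
have h00 : h0 0 = chart A i p0 by rewrite /h0 /= g00.
have close : \forall t \near F, forall x : R, `|x| < d ->
    `|h t x - h0 x| <= 2 * (K0 * m t).
  near=> t => x xd; have dL1 : d * L <= 1 / 2 by [].
  apply: le_trans (_ : 2 * `|h t 0 - h0 0| <= _).
    apply: (curves_close (tame a) d0 dL) => [y|]; rewrite subr0// => yd.
    suff : [/\ is_derive y 1 h0 (X a i (h0 y)), is_derive y 1 (h t) (X a i (h t y)),
       `|h0 y - chart A i p1| < rho & `|h t y - chart A i p1| < rho] by case.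
    by move: y yd; near: t.
  have st : h t 0 = chart A i (p t) by near: t.
  by rewrite ler_wpM2l// h00 st; near: t.
have cr : (fun t => g t r) @ F --> g0 r.
  have ch : h t r @[t --> F] --> h0 r.
    apply/cvgrPdist_le => e e0.
    have e1 : 0 < e / (2 * K0) by rewrite divr_gt0// mulr_gt0.
    near=> t; rewrite distrC.
    have H : `|h t r - h0 r| <= 2 * (K0 * m t) by move: r rd {ddr i0r h0r}; near: t.
    apply: le_trans H _.
    have mt : m t <= e / (2 * K0) by near: t; exact: m_cvg0.
    by move: mt; rewrite ler_pdivlMr ?mulr_gt0//; lra.
  have -> : g0 r = chart_inv A i (h0 r) by rewrite /h0 /= chartK.
  apply: cvg_trans (_ : chart_inv A i (h t r) @[t --> F] --> _); last first.
    apply: (cvg_comp _ _ ch); apply: chart_inv_continuous.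
    exact: chart_image_chart.
  apply: near_eq_cvg; apply: filterS ball_near => t /Hg[_ _ /(_ r rd)[itr _]].
  by rewrite /h /= chartK.
apply: (displaced_chart (transported_small_at r Hc) cr i0r).
move=> e e0.
pose C := 2 * (d * L * (4 * K0 ^+ 2)).
have C0 : 0 <= C by rewrite /C !mulr_ge0// ?sqr_ge0// ltW.
have e4 : 0 < e / 4 by lra.
have eC : 0 < e / 2 / (C + 1) by rewrite !divr_gt0// ltr_pwDr.
near=> t.
have H : `|h t r - h0 r - field_comb i (c r t) (h0 r)| <=
    2 * (`|h t 0 - h0 0 - field_comb i (c 0 t) (h0 0)| + d * L * (2 * (K0 * m t)) ^+ 2).
  apply: (@transport_estimate i (X a i) (chart A i p1) L rho d h0 (h t)
    (fun r => c r t) (fun r => c' r t) (Kc * m t)) => //.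
  - by near: t.
  - by move=> x b; exact: transported_derive Hc x t b.
  - move=> x xd; apply: (transported_eq Hc); apply: chart_image_chart.
    by have [] := g0r x xd.
  - have HK : forall (r : R) d0, `|r| <= d -> `|c r t d0| <= Kc * m t by near: t.
    by move=> x b xd; apply: HK; exact: ltW.
  - by near: t.
have start_t : h t 0 = chart A i (p t) by near: t.
have Hpt : `|chart A i (p t) - chart A i p0 - field_comb i (c 0 t) (chart A i p0)| <=
   e / 4 * m t by near: t; exact: Hp.
have mt : m t <= e / 2 / (C + 1) by near: t; exact: m_cvg0.
rewrite -/(h t r) -/(h0 r); apply: le_trans H _; rewrite start_t h00.
have -> : 2 * (`|chart A i (p t) - chart A i p0 - field_comb i (c 0 t) (chart A i p0)| +
    d * L * (2 * (K0 * m t)) ^+ 2) =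
  2 * `|chart A i (p t) - chart A i p0 - field_comb i (c 0 t) (chart A i p0)| +
    (C * m t) * m t by rewrite /C; ring.
have H1 : C * m t * m t <= e / 2 * m t.
  rewrite ler_wpM2r//; move: mt; rewrite ler_pdivlMr ?ltr_pwDr//.
  by have := m_ge0 t; lra.
by lra.
Unshelve. all: by end_near. Qed.

(** Flow boxes are chained along the integral curve through [p0]: the property of
pushing the displacement forward up to time [s] is locally constant in [s]. *)
Lemma displaced_flow a (p : T -> E) p0 q0 c c' r : transported a c c' ->
  displaced p p0 (c 0) -> flow (X a) r p0 q0 ->
  exists2 q, \forall t \near F, flow (X a) r (p t) (q t) & displaced q q0 (c r).
Proof.
move=> Hc Hp [g [l [h [lh rlh Hg g0 gr]]]].
pose P s := exists2 q, \forall t \near F, flow (X a) s (p t) (q t) &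
  displaced q (g s) (c s).
suff [q qf qd] : P r by exists q => //; rewrite -gr.
have P0 : P 0.
  exists p; last by rewrite g0.
  by apply: nearW => t; exact: flow0.
have loc s : l < s < h -> exists2 d : R, 0 < d & forall x x', l < x < h -> l < x' < h ->
    `|x - s| < d -> `|x' - s| < d -> P x -> P x'.
  move=> slh; have [i [L [rho [d [box _]]]]] := flow_box_exists sX (p := g s) filterT.
  have [is_ [tame im] [rho0 d0] _] := box.
  have sJ : `]l, h[%classic s by rewrite /= in_itv.
  have rho2 : 0 < rho / 2 by lra.
  have [e e0 He] := (nearP _ _).1 (curve_near_chart Hg sJ is_ rho2).
  exists (Num.min e (d / 2)); first by rewrite lt_min e0 /=; lra.
  move=> x x' xlh xlh'; rewrite !lt_min => /andP[xe xd] /andP[_ xd'] [q qf qd].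
  have [ix xr] := He x xe.
  have xx' : `|x' - x| < d.
    rewrite -(subrKA s); apply: le_lt_trans (ler_normD _ _) _.
    by rewrite [X in _ + X]distrC; lra.
  have Hc' := transported_shift x Hc.
  have qd' : displaced q (g x) (c (0 + x)) by rewrite add0r.
  have [q' [q0' [f0 fq Hq']]] := displaced_flow_local box Hc' ix xr qd' xx'.
  have q0'E : q0' = g x' by exact: flow_unique f0 (flow_curve Hg xlh xlh').
  exists q'; last by move: Hq'; rewrite q0'E subrK.
  apply: filterS2 qf fq => t f1 f2.
  by have := flow_trans sX f1 f2; rewrite addrC subrK.
case/orP: (le_total 0 r) => [r0|r0].
  apply: (locally_constant_le r0 _).1 P0 => s sr.
  have [|d d0 Hd] := loc s; first by lra.
  by exists d => // x x' xr x'r; apply: Hd; lra.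
apply: (locally_constant_le r0 _).2 P0 => s sr.
have [|d d0 Hd] := loc s; first by lra.
by exists d => // x x' xr x'r; apply: Hd; lra.
Qed.

(** During a time [O(m)] the velocity stays close to its value at [p0]. *)
Lemma displaced_flow_time a (p q : T -> E) p0 y (sigma : T -> R) : small y ->
  displaced p p0 y ->
  (exists2 K : R, 0 <= K & \forall t \near F, `|sigma t| <= K * m t) ->
  (\forall t \near F, flow (X a) (sigma t) (p t) (q t)) ->
  displaced q p0 (fun t d => y t d + sigma t * (d == a)%:R).
Proof.
move=> sy [pp Hp] [K K0 sK] pq.
have [i [L [rho [d [box _]]]]] := flow_box_exists sX (p := p0) filterT.
have [ip0 [tame im] [rho0 d0] [dL dLr]] := box.
have [L0 tameL] := tame a.
have [ci cid] := cvg_chart ip0 pp.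
have [Kp Kp0 HKp] := chart_displacement_bound sy ip0 (Hp i ip0).
have rho2 : 0 < rho / 2 by lra.
have sd : \forall t \near F, `|sigma t| < d.
  have K1 : 0 < d / (K + 1) / 2 by rewrite !divr_gt0// ltr_pwDr.
  near=> t; have H : `|sigma t| <= K * m t by near: t.
  have mt : m t <= d / (K + 1) / 2 by near: t; exact: m_cvg0.
  apply: le_lt_trans H _; apply: (@le_lt_trans _ _ (d / 2)); last by lra.
  have mt' : m t * (K + 1) <= d / 2.
    by rewrite -ler_pdivlMr ?ltr_pwDr// mulrAC.
  by have := m_ge0 t; nra.
have est : \forall t \near F, chart_dom A i (q t) /\
   `|chart A i (q t) - chart A i (p t) - sigma t *: X a i (chart A i p0)| <=
   (K * L * (L * (K * m t) + Kp * m t)) * m t.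
  near=> t.
  have it : chart_dom A i (p t) by near: t.
  have itr : `|chart A i (p t) - chart A i p0| < rho / 2 by near: t; exact: cid.
  have std : `|sigma t| < d by near: t.
  have stK : `|sigma t| <= K * m t by near: t.
  have ptK : `|chart A i (p t) - chart A i p0| <= Kp * m t by near: t.
  have ft : flow (X a) (sigma t) (p t) (q t) by near: t.
  have [g [Hg g0 gr]] := flow_box_curve sX a box it itr.
  have dd0 : - d < 0 < d by lra.
  have dds : - d < sigma t < d by rewrite -ltr_norml.
  have qg : q t = g (sigma t).
    by apply: flow_unique ft _ => //; have := flow_curve Hg dd0 dds; rewrite subr0 g0.
  have [iqt _] := gr _ std; rewrite -qg in iqt; split => //.
  pose h := chart A i \o g.
  have h0 : h 0 = chart A i (p t) by rewrite /h /= g0.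
  have between (x : R) : Num.min 0 (sigma t) <= x <= Num.max 0 (sigma t) ->
      `|x| <= `|sigma t|.
    by move=> /between_dist; rewrite !subr0.
  have dh (x : R) : Num.min 0 (sigma t) <= x <= Num.max 0 (sigma t) ->
      is_derive x 1 h (X a i (h x)) /\ `|h x - chart A i p0| < rho.
    move=> /between xs; have xd := le_lt_trans xs std.
    have [ix hx] := gr x xd; split => //.
    have xJ : `]- d, d[%classic x by rewrite /= in_itv /= -ltr_norml.
    exact: curve_chart_derive Hg xJ ix.
  have hlip (x : R) : Num.min 0 (sigma t) <= x <= Num.max 0 (sigma t) ->
      `|h x - h 0| <= L * `|sigma t|.
    move=> xs; apply: le_trans (_ : L * `|x| <= _); last by rewrite ler_wpM2l ?between.
    have := @derive_bound_le R _ h (fun x => X a i (h x)) 0 x L.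
    rewrite subr0; apply => x' x's; have [] : is_derive x' 1 h (X a i (h x')) /\
      `|h x' - chart A i p0| < rho.
      by apply: dh; apply: between_trans x's.
    by move=> ? /tameL[].
  have p0r : `|chart A i p0 - chart A i p0| < rho by rewrite subrr normr0.
  have := @derive_bound_le R _ (fun x => h x - x *: X a i (chart A i p0))
    (fun x => X a i (h x) - X a i (chart A i p0)) 0 (sigma t)
    (L * (L * (K * m t) + Kp * m t)).
  rewrite scale0r !subr0 h0 /h /= -qg => H; rewrite addrAC.
  apply: le_trans (H _) _; last first.
    have -> : K * L * (L * (K * m t) + Kp * m t) * m t =
       L * (L * (K * m t) + Kp * m t) * (K * m t) by ring.
    by rewrite ler_wpM2l// !(mulr_ge0, addr_ge0)// ltW.
  move=> x xs; have [dhx hxr] := dh x xs.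
  split.
    apply: is_deriveB => //.
    have := is_derive_segment 0 (X a i (chart A i p0)) x.
    by rewrite (_ : (fun x => 0 + _) = fun x => x *: X a i (chart A i p0))//;
      apply/funext => ?; rewrite add0r.
  have [_ _ _ /(_ _ hxr)[lx _]] := tameL _ p0r.
  apply: le_trans lx _; rewrite ler_wpM2l//.
  rewrite -(subrKA (h 0)); apply: le_trans (ler_normD _ _) (lerD _ _).
    by apply: le_trans (hlip x xs) _; rewrite ler_wpM2l.
  by rewrite h0.
have sy' : small (fun t d => y t d + sigma t * (d == a)%:R).
  have [Ky Ky0 HKy] := sy; exists (Ky + K); first exact: addr_ge0.
  near=> t => b; rewrite mulrDl; apply: le_trans (ler_normD _ _) (lerD _ _).
    by move: b; near: t.
  have H : `|sigma t| <= K * m t by near: t.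
  rewrite normrM; apply: le_trans H; rewrite ler_piMr//.
  by case: (b == a); rewrite ?normr1 ?normr0.
have expansion : forall e : R, 0 < e -> \forall t \near F,
    `|chart A i (q t) - chart A i p0 - field_comb i
      (fun d => y t d + sigma t * (d == a)%:R) (chart A i p0)| <= e * m t.
  move=> e e0.
  pose C := K * L * (L * K + Kp).
  have C0 : 0 <= C by rewrite /C !(mulr_ge0, addr_ge0)// ltW.
  have e2 : 0 < e / 2 by lra.
  have eC : 0 < e / 2 / (C + 1) by rewrite !divr_gt0// ltr_pwDr.
  near=> t.
  have [_ H1] : chart_dom A i (q t) /\
    `|chart A i (q t) - chart A i (p t) - sigma t *: X a i (chart A i p0)| <=
    (K * L * (L * (K * m t) + Kp * m t)) * m t by near: t.
  have H2 : `|chart A i (p t) - chart A i p0 - field_comb i (y t) (chart A i p0)| <=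
    e / 2 * m t by near: t; exact: Hp.
  have mt : m t <= e / 2 / (C + 1) by near: t; exact: m_cvg0.
  have combE : field_comb i (fun d => y t d + sigma t * (d == a)%:R) (chart A i p0) =
      field_comb i (y t) (chart A i p0) + sigma t *: X a i (chart A i p0).
    rewrite /field_comb; under eq_bigr => b _ do rewrite scalerDl.
    rewrite big_split /=; congr (_ + _); rewrite (bigD1 a)//= eqxx mulr1 big1 ?addr0//.
    by move=> b /negbTE ->; rewrite mulr0 scale0r.
  rewrite combE (_ : _ - _ - _ = (chart A i (q t) - chart A i (p t) -
    sigma t *: X a i (chart A i p0)) + (chart A i (p t) - chart A i p0 -
    field_comb i (y t) (chart A i p0))); last first.
    by apply/rowP => j; rewrite !mxE; ring.
  apply: le_trans (ler_normD _ _) _.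
  have H3 : K * L * (L * (K * m t) + Kp * m t) * m t <= e / 2 * m t.
    have -> : K * L * (L * (K * m t) + Kp * m t) = C * m t by rewrite /C; ring.
    rewrite ler_wpM2r//; move: mt; rewrite ler_pdivlMr ?ltr_pwDr//.
    by have := m_ge0 t; lra.
  by lra.
apply: (displaced_chart sy' _ ip0 expansion).
have ch : chart A i (q t) @[t --> F] --> chart A i p0.
  have [K' K'0 HK'] := chart_displacement_bound sy' ip0 expansion.
  apply/cvgrPdist_le => e e0; near=> t; rewrite distrC.
  have H : `|chart A i (q t) - chart A i p0| <= K' * m t by near: t.
  apply: le_trans H _; rewrite mulrC -ler_pdivlMr//.
  by near: t; apply: m_cvg0; exact: divr_gt0.
rewrite -[p0](chartK ip0).
apply: cvg_trans (_ : chart_inv A i (chart A i (q t)) @[t --> F] --> _); last first.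
  by apply: (cvg_comp _ _ ch); apply: chart_inv_continuous; exact: chart_image_chart.
by apply: near_eq_cvg; apply: filterS est => t [iqt _]; rewrite chartK.
Unshelve. all: by end_near. Qed.

End Displacement.

(** * The product of the three flows *)

Section CoordinatesBefore.
Variables (R : realType) (u : letter -> R -> R) (T M : R).
Hypothesis M_gt0 : 0 < M.
Hypothesis u_meas : forall d, measurable_fun `[0, T] (u d).
Hypothesis u_bound : forall d t, 0 <= t <= T -> `|u d t| <= M.
Variable S : ncseries R.
Hypothesis S_eq : Sa1_equation S.

(** Any time [b] between [t0] and the end will do: [M b < 1] makes the series of
the controls cut off at [b] converge geometrically. *)
Lemma coordinates_before t0 : 0 <= t0 < Num.min T M^-1 ->
  exists (b : R) (v xi : letter -> R -> R), [/\ t0 < b < Num.min T M^-1,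
    forall d x, 0 <= x < b -> v d x = u d x,
    forall d t, t < b -> upsilon_cvg u t (coord_series S d) /\
      upsilon u t (coord_series S d) = xi d t,
    forall d, xi d 0 = 0 &
    [/\ primitive (xi La) (fun t =>
          v La t + 2 * xi La t * v Lb t - xi La t ^+ 2 * v Lc t),
        primitive (xi Lb) (fun t => v Lb t - xi La t * v Lc t) &
        primitive (xi Lc) (fun t => expR (2 * xi Lb t) * v Lc t)]].
Proof.
move=> /andP[t00 t0m]; pose b := (t0 + Num.min T M^-1) / 2.
have b0 : 0 <= b by rewrite /b; lra.
have tb : t0 < b by rewrite /b; lra.
have bm : b < Num.min T M^-1 by rewrite /b; lra.
have /andP[bT bM] : (b < T) && (b < M^-1) by rewrite -lt_min.
have Mb1 : M * b < 1 by rewrite mulrC -ltr_pdivlMr// div1r.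
have vC := truncate_control u_meas u_bound b0 (ltW bT).
exists b, (truncate u b), (fun d t => upsilon (truncate u b) t (coord_series S d)).
split.
- by rewrite tb.
- by move=> d x; exact: truncateE.
- move=> d t tb'; split; last exact: upsilon_truncate.
  by apply: (upsilon_cvg_truncate tb'); exact: (upsilon_cvg_coord vC).
- by move=> d; rewrite upsilon_at0 coord_series_nil.
- split; [exact: (primitive_coord_a vC)|exact: (primitive_coord_b vC)|].
  exact: (primitive_coord_c vC).
Qed.

End CoordinatesBefore.

Section ProductOfFlows.
Variables (R : realType) (n : nat) (E : topologicalType).
Variable A : smooth_manifold R n E.
Variable X : letter -> local_field A.
Hypothesis sX : forall d, smooth_vector_field (X d).
Hypothesis Hab : eq_field (lie_bracket (X La) (X Lb)) (scale_field 2 (X La)).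
Hypothesis Hac : eq_field (lie_bracket (X La) (X Lc)) (scale_field (- 1) (X Lb)).
Hypothesis Hbc : eq_field (lie_bracket (X Lb) (X Lc)) (scale_field 2 (X Lc)).

Lemma exp_product_unique r (p q q' : E) : exp_product X r p q -> exp_product X r p q' ->
  q = q'.
Proof.
move=> [p1 [p2 [f1 f2 f3]]] [p1' [p2' [f1' f2' f3']]].
have E1 := flow_unique sX f1 f1'; rewrite -{}E1 in f2'.
have E2 := flow_unique sX f2 f2'; rewrite -{}E2 in f3'.
exact: flow_unique f3 f3'.
Qed.

(** A neighborhood is returned so that the lemma can be iterated. *)
Lemma flow_local_existence d (p : E) (W : set E) : nbhs p W ->
  exists2 U, nbhs p U & exists2 e : R, 0 < e & forall (q : E) (r : R), U q -> `|r| < e ->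
    exists2 q', flow (X d) r q q' & W q'.
Proof.
move=> pW; have [i [L [rho [e [box HW]]]]] := flow_box_exists sX pW.
have [ip _ [rho0 e0] _] := box.
exists [set q | chart_dom A i q /\ `|chart A i q - chart A i p| < rho / 2].
  have rho2 : 0 < rho / 2 by lra.
  have [ci cid] := @cvg_chart _ _ _ A _ (nbhs p) _ i id p ip cvg_id.
  near=> q; split; near: q; [exact: ci|exact: cid].
exists e => // q r [iq qr] re.
have [g [Hg g0 gr]] := flow_box_curve sX d box iq qr.
have [ig gb] := gr r re.
exists (g r); last by rewrite -(chartK ig); exact: HW.
have := @flow_curve _ _ _ _ (X d) g (- e) e 0 r Hg; rewrite subr0 g0; apply.
  by lra.
by rewrite -ltr_norml.
Unshelve. all: by end_near. Qed.

Lemma exp_product_local (p : E) : exists2 e : R, 0 < e &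
  forall r : letter -> R, (forall d, `|r d| < e) -> exists q, exp_product X r p q.
Proof.
have [Ua pUa [ea ea0 Ha]] := @flow_local_existence La p setT filterT.
have [Ub pUb [eb eb0 Hb]] := flow_local_existence Lb pUa.
have [Uc pUc [ec ec0 Hc]] := flow_local_existence Lc pUb.
exists (Num.min ea (Num.min eb ec)); first by rewrite !lt_min ea0 eb0.
move=> r rlt; have small d : `|r d| < ea /\ `|r d| < eb /\ `|r d| < ec.
  by have := rlt d; rewrite !lt_min => /and3P[].
have [p1 f1 Up1] := Hc p (r Lc) (nbhs_singleton pUc) (small Lc).2.2.
have [p2 f2 Up2] := Hb p1 (r Lb) Up1 (small Lb).2.1.
have [q f3 _] := Ha p2 (r La) Up2 (small La).1.
by exists q, p1, p2.
Qed.

Section AlongFilter.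
Variables (T : Type) (F : set_system T).
Context {FF : Filter F}.
Variable m : T -> R.
Hypothesis m_ge0 : forall t, 0 <= m t.
Hypothesis m_cvg0 : forall e : R, 0 < e -> \forall t \near F, m t <= e.

Lemma lie_bracket_self (V : local_field A) i z : lie_bracket V V i z = 0.
Proof. by rewrite /lie_bracket subrr. Qed.

(** The coefficients of [exp (- r ad X_a)] applied to a combination of [X_b]
and [X_c]. *)
Definition push_a (r yb yc : R) (d : letter) : R :=
  match d with La => - 2 * r * yb - r ^+ 2 * yc | Lb => yb + r * yc | Lc => yc end.

Definition push_a' (r yb yc : R) (d : letter) : R :=
  match d with La => - 2 * yb - 2 * r * yc | Lb => yc | Lc => 0 end.

Lemma derive_push_a (yb yc r : R) d :
  is_derive r 1 (fun r => push_a r yb yc d) (push_a' r yb yc d).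
Proof.
apply/is_derive1P => e e0; case: d => /=.
- near=> s.
  rewrite (_ : _ - _ - _ = - (s - r) ^+ 2 * yc); last first.
    by rewrite -[_ *: _]/(_ * _); ring.
  have sr : `|s - r| <= e / (`|yc| + 1).
    rewrite distrC; near: s; have : s @[s --> r] --> r by exact: cvg_id.
    by move=> /cvgrPdist_le; apply; rewrite divr_gt0// ltr_pwDr.
  rewrite normrM normrN normrX expr2 mulrAC ler_wpM2r//.
  move: sr; rewrite ler_pdivlMr ?ltr_pwDr//.
  by have := normr_ge0 (s - r); lra.
- near=> s; rewrite (_ : _ - _ - _ = 0); last by rewrite -[_ *: _]/(_ * _); ring.
  by rewrite normr0 mulr_ge0// ltW.
- near=> s; rewrite (_ : _ - _ - _ = 0); last by rewrite -[_ *: _]/(_ * _); ring.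
  by rewrite normr0 mulr_ge0// ltW.
Unshelve. all: by end_near. Qed.

Lemma transported_push_a (yb yc : T -> R) (K : R) : 0 <= K ->
  (\forall t \near F, `|yb t| <= K * m t /\ `|yc t| <= K * m t) ->
  transported X F m La (fun r t => push_a r (yb t) (yc t))
    (fun r t => push_a' r (yb t) (yc t)).
Proof.
move=> K0 yK; split.
- by move=> r t d; exact: derive_push_a.
- move=> r t i z [p ip <-]; rewrite sum_letter /= lie_bracket_self (Hab ip) (Hac ip).
  by rewrite /scale_field; apply/rowP => j; rewrite !mxE; ring.
- move=> B; exists ((1 + 2 * `|B| + `|B| ^+ 2) * K).
    by rewrite mulr_ge0// !addr_ge0// ?mulr_ge0// exprn_ge0.
  apply: filterS yK => t [ybK ycK] r d rB.
  have rB' : `|r| <= `|B| by exact: le_trans rB (ler_norm _).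
  have Km : 0 <= K * m t by rewrite mulr_ge0.
  have rb : `|r * yb t| <= `|B| * (K * m t) by rewrite normrM ler_pM.
  have rc : `|r * yc t| <= `|B| * (K * m t) by rewrite normrM ler_pM.
  have rrc : `|r ^+ 2 * yc t| <= `|B| ^+ 2 * (K * m t).
    by rewrite normrM normrX ler_pM// ?exprn_ge0// lerXn2r// nnegrE.
  have B1 : 0 <= `|B| * (K * m t) by rewrite mulr_ge0.
  have B2 : 0 <= `|B| ^+ 2 * (K * m t) by rewrite mulr_ge0// exprn_ge0.
  case: d => /=.
  + apply: le_trans (ler_normB _ _) _.
    rewrite -mulrA normrM normrN (@ger0_norm _ 2)//; lra.
  + by apply: le_trans (ler_normD _ _) _; lra.
  + by lra.
Qed.

Lemma transported_push_b (yc : T -> R) (K : R) : 0 <= K ->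
  (\forall t \near F, `|yc t| <= K * m t) ->
  transported X F m Lb (fun r t d => expR (- 2 * r) * yc t * (d == Lc)%:R)
    (fun r t d => - 2 * expR (- 2 * r) * yc t * (d == Lc)%:R).
Proof.
move=> K0 yK; split.
- move=> r t d.
  have dE : is_derive r 1 (fun r => expR (- 2 * r)) (- 2 * expR (- 2 * r)).
    have dl : is_derive r 1 (fun r : R => - 2 * r) (- 2 * 1).
      have -> : (fun r : R => - 2 * r) = (- 2) \*: id by [].
      by apply: is_deriveZ.
    have := @is_derive1_comp R expR (fun r => - 2 * r) r _ _ (is_derive_expR _) dl.
    by rewrite mulr1 mulrC.
  have -> : (fun r => expR (- 2 * r) * yc t * (d == Lc)%:R) =
      (yc t * (d == Lc)%:R) \*: (fun r => expR (- 2 * r)).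
    by apply/funext => x; rewrite -[RHS]/(_ * _); ring.
  by apply: is_derive_eq; rewrite -[_ *: _]/(_ * _); ring.
- move=> r t i z [p ip <-]; rewrite sum_letter !letter_eqE eqxx /= (Hbc ip).
  rewrite /scale_field; move: (expR (- 2 * r)) => w.
  move: (lie_bracket (X Lb) (X La) i _) (lie_bracket (X Lb) (X Lb) i _) => Z Z'.
  by apply/rowP => j; rewrite !mxE; ring.
- move=> B; exists (expR (2 * `|B|) * K); first by rewrite mulr_ge0 ?expR_ge0.
  apply: filterS yK => t ycK r d rB.
  have Km : 0 <= K * m t by rewrite mulr_ge0.
  rewrite -[leRHS]mulr1 normrM ler_pM//; last first.
    by case: (d == Lc); rewrite ?normr1 ?normr0.
  rewrite normrM -mulrA ler_pM// ger0_norm ?expR_ge0// ler_expR.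
  have := ler_norm B; have := ler_norm (- r); rewrite normrN.
  by lra.
Qed.

(** Each flow adds a displacement along its own field, by the increment of its
exponent, and pushes forward the displacement made by the previous ones. *)
Lemma displaced_product (xi : T -> letter -> R) (xi0 : letter -> R) (p : E)
    (p1 p2 q : T -> E) p10 p20 q0 (K : R) :
  0 <= K -> (\forall t \near F, forall d, `|xi t d - xi0 d| <= K * m t) ->
  flow (X Lc) (xi0 Lc) p p10 -> flow (X Lb) (xi0 Lb) p10 p20 ->
  flow (X La) (xi0 La) p20 q0 ->
  (\forall t \near F, [/\ flow (X Lc) (xi t Lc) p (p1 t),
    flow (X Lb) (xi t Lb) (p1 t) (p2 t) & flow (X La) (xi t La) (p2 t) (q t)]) ->
  displaced X F m q q0 (fun t d => push_a (xi0 La) (xi t Lb - xi0 Lb)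
    (expR (- 2 * xi0 Lb) * (xi t Lc - xi0 Lc)) d +
    (xi t La - xi0 La) * (d == La)%:R).
Proof.
move=> K0 xiK f10 f20 f0 Hf.
pose sg t d := xi t d - xi0 d.
have sgK d : exists2 K : R, 0 <= K & \forall t \near F, `|sg t d| <= K * m t.
  by exists K => //; apply: filterS xiK => t; exact.
(* A flow for the time [xi t d] is a flow for the time [xi0 d] followed by a
   flow for a short time. *)
have tail d r r0 a a0 a1 : flow (X d) r0 a a0 -> flow (X d) r a a1 ->
    flow (X d) (r - r0) a0 a1.
  by move=> /flow_inv g0 g1; have := flow_trans sX g0 g1; rewrite addrC.
have small0 : small F m (fun _ _ => 0).
  by exists 0 => //; apply: nearW => t d; rewrite normr0 mul0r.
have D1 : displaced X F m p1 p10 (fun t d => 0 + sg t Lc * (d == Lc)%:R).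
  apply: (displaced_flow_time sX m_ge0 m_cvg0 small0 (displaced_cst _ _ _) (sgK Lc)) => //.
  by apply: filterS Hf => t [f1 _ _]; exact: tail f10 f1.
have tb : transported X F m Lb (fun r t d => expR (- 2 * r) * sg t Lc * (d == Lc)%:R)
    (fun r t d => - 2 * expR (- 2 * r) * sg t Lc * (d == Lc)%:R).
  by apply: (transported_push_b K0); apply: filterS xiK => t; exact.
have D1' : displaced X F m p1 p10 (fun t d => expR (- 2 * 0) * sg t Lc * (d == Lc)%:R).
  by apply: eq_displaced D1 => t d; rewrite mulr0 expR0 mul1r add0r.
have [q2 fq2 Dq2] := displaced_flow sX m_ge0 m_cvg0 tb D1' f20.
have D2 := displaced_flow_time sX m_ge0 m_cvg0 (transported_small_at (xi0 Lb) tb)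
  Dq2 (sgK Lb).
have {}D2 : displaced X F m p2 p20 (fun t d =>
    expR (- 2 * xi0 Lb) * sg t Lc * (d == Lc)%:R + sg t Lb * (d == Lb)%:R).
  apply: D2; apply: filterS2 Hf fq2 => t [_ f2 _] g2; exact: tail g2 f2.
have ta := @transported_push_a (fun t => sg t Lb)
  (fun t => expR (- 2 * xi0 Lb) * sg t Lc) ((1 + expR (- 2 * xi0 Lb)) * K).
have {}ta : transported X F m La
    (fun r t => push_a r (sg t Lb) (expR (- 2 * xi0 Lb) * sg t Lc))
    (fun r t => push_a' r (sg t Lb) (expR (- 2 * xi0 Lb) * sg t Lc)).
  have e0 := expR_ge0 (- 2 * xi0 Lb).
  apply: ta; first by rewrite mulr_ge0// addr_ge0.
  apply: filterS xiK => t Ht; have Km : 0 <= K * m t by rewrite mulr_ge0.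
  have Hb := Ht Lb; have Hc := Ht Lc.
  have eK : 0 <= expR (- 2 * xi0 Lb) * (K * m t) by rewrite mulr_ge0.
  split; first by rewrite /sg; lra.
  rewrite normrM (ger0_norm e0) /sg.
  have : expR (- 2 * xi0 Lb) * `|xi t Lc - xi0 Lc| <= expR (- 2 * xi0 Lb) * (K * m t).
    by rewrite ler_wpM2l.
  by lra.
have D2' : displaced X F m p2 p20
    (fun t => push_a 0 (sg t Lb) (expR (- 2 * xi0 Lb) * sg t Lc)).
  by apply: eq_displaced D2 => t [] /=; rewrite ?letter_eqE ?eqxx /=; ring.
have [q3 fq3 Dq3] := displaced_flow sX m_ge0 m_cvg0 ta D2' f0.
apply: (displaced_flow_time sX m_ge0 m_cvg0 (transported_small_at (xi0 La) ta) Dq3 (sgK La)).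
by apply: filterS2 Hf fq3 => t [_ _ f3] g3; exact: tail g3 f3.
Qed.

End AlongFilter.
End ProductOfFlows.

(** * Solutions of the controlled equation *)

Section Solutions.
Variables (R : realType) (n : nat) (E : topologicalType).
Variable A : smooth_manifold R n E.
Variable X : letter -> local_field A.
Hypothesis sX : forall d, smooth_vector_field (X d).
Variables (u : letter -> R -> R) (x0 : E) (T M tau : R).
Hypothesis M_gt0 : 0 < M.
Hypothesis u_bound : forall d t, 0 <= t <= T -> `|u d t| <= M.
Hypothesis tauT : tau <= T.
Notation mu := (@lebesgue_measure R).

Lemma near_within_dist (D : set R) (s : R) (P : R -> Prop) :
  (\forall r \near within D (nbhs s), P r) ->
  exists2 d : R, 0 < d & forall r, `|r - s| < d -> D r -> P r.
Proof. by rewrite near_withinE => /(@nearP R R s _).1. Qed.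

Lemma solution_cvg (x : R -> E) s : is_solution X u x0 tau x -> 0 <= s < tau ->
  x r @[r --> within `[0, tau[ (nbhs s)] --> x s.
Proof.
move=> [_ /subspace_continuousP cx _] s0; apply: cx.
by rewrite /= in_itv.
Qed.

(** The integrands differ by at most [3 M L B] in each component, when the points
differ by at most [B].  The time [r] may lie on either side of [s]. *)
Lemma solutions_contract (x y : R -> E) i z0 (L rho B s r : R) :
  is_solution X u x0 tau x -> is_solution X u x0 tau y ->
  good_ball X i z0 L rho -> 0 <= s -> 0 <= r -> s < tau -> r < tau ->
  x s = y s -> 0 <= B ->
  (forall t, Num.min s r <= t <= Num.max s r ->
    [/\ chart_dom A i (x t), chart_dom A i (y t), `|chart A i (x t) - z0| < rho,
      `|chart A i (y t) - z0| < rho & `|chart A i (x t) - chart A i (y t)| <= B]) ->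
  `|chart A i (x r) - chart A i (y r)| <= 3 * (M * (L * B)) * `|r - s|.
Proof.
move=> Hx Hy [tame _] s0 r0 stau rtau xys B0 Hb.
have L0 : 0 <= L by case: (tame La).
set a := Num.min s r in Hb; set b := Num.max s r in Hb.
have ab : a <= b by rewrite /a /b; case: (leP s r) => [|/ltW].
have a0 : 0 <= a by rewrite le_min s0.
have btau : b < tau by rewrite gt_max stau.
have brs : b - a = `|r - s|.
  rewrite /a /b; case: (leP s r) => [sr|/ltW rs].
    by rewrite ger0_norm ?subr_ge0.
  by rewrite distrC ger0_norm ?subr_ge0.
pose D t := chart A i (x t) - chart A i (y t).
have Ds : D s = 0 by rewrite /D xys subrr.
suff main : `|D b - D a| <= 3 * (M * (L * B)) * (b - a).
  rewrite -brs -/(D r); move: main; rewrite /a /b.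
  case: (leP s r) => [sr|rs]; first by rewrite Ds subr0.
  by rewrite Ds sub0r normrN.
apply: rV_norm_le; first by rewrite !mulr_ge0// ?subr_ge0// ltW.
move=> k; have [_ _ Ix] := Hx; have [_ _ Iy] := Hy.
pose vx r := (\sum_(d : letter) u d r *: X d i (chart A i (x r))) 0 k.
pose vy r := (\sum_(d : letter) u d r *: X d i (chart A i (y r))) 0 k.
have [intx Ex] : mu.-integrable `[a, b] (EFin \o vx) /\
    chart A i (x b) 0 k - chart A i (x a) 0 k = \int[mu]_(t in `[a, b]) vx t.
  by apply: Ix => // t tab; case: (Hb t tab).
have [inty Ey] : mu.-integrable `[a, b] (EFin \o vy) /\
    chart A i (y b) 0 k - chart A i (y a) 0 k = \int[mu]_(t in `[a, b]) vy t.
  by apply: Iy => // t tab; case: (Hb t tab).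
have ut d t : a <= t <= b -> `|u d t| <= M.
  move=> /andP[a_t t_b]; apply: u_bound; rewrite (le_trans a0)//=.
  by apply: le_trans t_b (le_trans (ltW btau) tauT).
have vE w t : (\sum_(d : letter) u d t *: X d i (chart A i (w t))) 0 k =
    \sum_(d : letter) u d t * X d i (chart A i (w t)) 0 k.
  by rewrite summxE; apply: eq_bigr => d _; rewrite mxE.
have bm (w : R -> E) : (forall t, a <= t <= b -> `|chart A i (w t) - z0| < rho) ->
    mu.-integrable `[a, b] (EFin \o fun t =>
      (\sum_(d : letter) u d t *: X d i (chart A i (w t))) 0 k) ->
    bounded_measurable a b (fun t =>
      (\sum_(d : letter) u d t *: X d i (chart A i (w t))) 0 k).
  move=> wr intw; split.
    by apply/measurable_EFinP; exact: (measurable_int mu intw).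
  exists (\sum_(d : letter) M * L) => t tab; rewrite vE.
  apply: le_trans (ler_norm_sum _ _ _) _; apply: ler_sum => d _.
  rewrite normrM ler_pM// ?ut//; apply: le_trans (rV_coord_le _ _) _.
  by have [_ /(_ _ (wr t tab))[]] := tame d.
have bx : bounded_measurable a b vx by apply: bm => // t /Hb[].
have by_ : bounded_measurable a b vy by apply: bm => // t /Hb[].
have -> : (D b - D a) 0 k = \int[mu]_(t in `[a, b]) (vx t - vy t).
  by rewrite integralB// -Ex -Ey /D !mxE; ring.
apply: integral_bound => //; first exact: bmeasB.
move=> t tab; have [_ _ xr yr xyB] := Hb t tab.
rewrite /vx /vy (vE x) (vE y) -sumrB.
have H d : `|u d t * X d i (chart A i (x t)) 0 k -
    u d t * X d i (chart A i (y t)) 0 k| <= M * (L * B).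
  rewrite -mulrBr normrM ler_pM// ?ut//.
  have [_ /(_ _ yr)[_ _ _ /(_ _ xr)[lip _]]] := tame d.
  apply: le_trans (_ : `|X d i (chart A i (x t)) - X d i (chart A i (y t))| <= _).
    have := rV_coord_le (X d i (chart A i (x t)) - X d i (chart A i (y t))) k.
    by rewrite !mxE.
  by apply: le_trans lip _; rewrite ler_wpM2l.
rewrite sum_letter; apply: le_trans (ler_normD _ _) _.
apply: le_trans (lerD (ler_normD _ _) (lexx _)) _.
by have := H La; have := H Lb; have := H Lc; lra.
Qed.

(** As for integral curves, agreement is open, by contraction, and closed. *)
Lemma solution_unique (x y : R -> E) : is_solution X u x0 tau x ->
  is_solution X u x0 tau y -> forall t, 0 <= t < tau -> y t = x t.
Proof.
move=> Hx Hy t /andP[t0 tt].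
apply: (locally_constant_le (P := fun s => y s = x s) t0 _).1; last first.
  by case: Hx => -> _ _; case: Hy => ->.
move=> s /andP[s0 st]; have stau : 0 <= s < tau by rewrite s0 (le_lt_trans st).
have cx := solution_cvg Hx stau; have cy := solution_cvg Hy stau.
have [xy|nxy] := pselect (x s = y s); last first.
  have [d d0 Hd] := near_within_dist (separated_near A _ cx cy nxy).
  exists d => // r r' /andP[r0 rt] _ rs _ E0.
  have rJ : `[0, tau[%classic r by rewrite /= in_itv /= r0 (le_lt_trans rt).
  by have := Hd r rs rJ; rewrite E0.
have [i [L [rho [e [box _]]]]] := flow_box_exists sX (p := x s) filterT.
have [ip gb [rho0 _] _] := box; have [tame _] := gb.
have L0 : 0 <= L by case: (tame La).
have [cix cidx] := cvg_chart ip cx.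
have ip2 : chart_dom A i (y s) by rewrite -xy.
have [ciy cidy] := cvg_chart ip2 cy.
have : \forall r \near within `[0, tau[ (nbhs s), [/\ chart_dom A i (x r),
    chart_dom A i (y r), `|chart A i (x r) - chart A i (x s)| < rho &
    `|chart A i (y r) - chart A i (x s)| < rho].
  near=> r; split; near: r; [exact: cix|exact: ciy|exact: cidx|].
  by rewrite xy; exact: cidy.
move=> /near_within_dist[d d0 Hd].
pose K := 3 * (M * L); have K0 : 0 <= K by rewrite !mulr_ge0// ltW.
pose d' := Num.min d (1 / (2 * (K + 1))).
have K1 : 0 < 2 * (K + 1) by lra.
have d'0 : 0 < d' by rewrite lt_min d0 divr_gt0.
have d'd : d' <= d by rewrite ge_min lexx.
have d'K : K * d' <= 1 / 2.
  have : d' <= 1 / (2 * (K + 1)) by rewrite ge_min lexx orbT.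
  by rewrite ler_pdivlMr//; move: d'0; lra.
exists d' => // r r' _ r't _ r's _.
pose J := [set r | 0 <= r <= t /\ `|r - s| < d'].
have HJ r1 : J r1 -> [/\ chart_dom A i (x r1),
    chart_dom A i (y r1), `|chart A i (x r1) - chart A i (x s)| < rho &
    `|chart A i (y r1) - chart A i (x s)| < rho].
  move=> [/andP[r10 r1t] r1s]; apply: Hd; first exact: lt_le_trans d'd.
  by rewrite /= in_itv /= r10 (le_lt_trans r1t).
have close : forall r1, J r1 -> `|chart A i (x r1) - chart A i (y r1)| <= 2 * 0.
  apply: (@absorb_half R R J _ _ (2 * rho)).
    move=> r1 /HJ[_ _ xr yr]; rewrite -(subrKA (chart A i (x s))).
    apply: le_trans (ler_normD _ _) _; rewrite [X in _ + X]distrC; lra.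
  move=> B HB r1 Jr1; have [/andP[r10 r1t] r1s] := Jr1.
  have Js : J s by split; [rewrite s0|rewrite subrr normr0].
  have B0 : 0 <= B by apply: le_trans (HB s Js).
  rewrite add0r; apply: le_trans (_ : 3 * (M * (L * B)) * `|r1 - s| <= _).
    apply: (solutions_contract Hx Hy gb) => //; [by case/andP: stau|exact: le_lt_trans tt|].
    move=> w wr.
    have Jw : J w.
      split; last exact: le_lt_trans (between_dist wr) r1s.
      by move: wr; case: (leP s r1) => _ /andP[w1 w2]; apply/andP; split;
        [exact: le_trans w1|exact: le_trans w2 _|exact: le_trans w1|exact: le_trans w2 _].
    by have [? ? ? ?] := HJ w Jw; split => //; exact: HB.
  have -> : 3 * (M * (L * B)) = K * B by rewrite /K; ring.
  rewrite mulrAC [leRHS]mulrC ler_wpM2r//.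
  apply: le_trans (_ : K * d' <= _); first by rewrite ler_wpM2l// ltW.
  by move: d'K; lra.
have Jr' : J r' by split.
have [ix iy _ _] := HJ r' Jr'.
have := close r' Jr'; rewrite mulr0 normr_le0 subr_eq0 => /eqP E0.
by rewrite -(chartK ix) E0 chartK.
Unshelve. all: by end_near. Qed.

Section Existence.
Hypothesis Hab : eq_field (lie_bracket (X La) (X Lb)) (scale_field 2 (X La)).
Hypothesis Hac : eq_field (lie_bracket (X La) (X Lc)) (scale_field (- 1) (X Lb)).
Hypothesis Hbc : eq_field (lie_bracket (X Lb) (X Lc)) (scale_field 2 (X Lc)).
Hypothesis u_meas : forall d, measurable_fun `[0, T] (u d).
Variable S : ncseries R.
Hypothesis S_eq : Sa1_equation S.
Hypothesis tau_gt0 : 0 < tau.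
Hypothesis tau_max : tau <= Num.min T M^-1.
Local Arguments coord_series : simpl never.
Notation Xi := (fun t d => upsilon u t (coord_series S d)).

Lemma coord_at0 d : Xi 0 d = 0.
Proof. by rewrite /= upsilon_at0 coord_series_nil. Qed.

Variable x : R -> E.
Hypothesis x_prod : forall t, 0 <= t < tau -> exp_product X (Xi t) x0 (x t).

Lemma displaced_exp_product s : 0 <= s < tau ->
  displaced X (within `[0, tau[ (nbhs s)) (fun t => `|t - s|) x (x s)
    (fun t d => push_a (Xi s La) (Xi t Lb - Xi s Lb)
      (expR (- 2 * Xi s Lb) * (Xi t Lc - Xi s Lc)) d +
      (Xi t La - Xi s La) * (d == La)%:R).
Proof.
move=> /[dup] stau /andP[s0 st].
have sm : 0 <= s < Num.min T M^-1 by rewrite s0 (lt_le_trans st).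
have [b [v [xi [/andP[sb _] vu xiE _ [pa pb pc]]]]] :=
  coordinates_before M_gt0 u_meas u_bound S_eq sm.
have lip d : exists2 K : R, 0 <= K & forall s t, `|xi d t - xi d s| <= K * `|t - s|.
  by case: d; [exact: primitive_lipschitz pa|exact: primitive_lipschitz pb|
    exact: primitive_lipschitz pc].
have [Ka Ka0 HKa] := lip La; have [Kb Kb0 HKb] := lip Lb; have [Kc Kc0 HKc] := lip Lc.
have /choice[w Hw] t : exists w : E * E, 0 <= t < tau -> [/\ flow (X Lc) (Xi t Lc) x0 w.1,
    flow (X Lb) (Xi t Lb) w.1 w.2 & flow (X La) (Xi t La) w.2 (x t)].
  have [tt|nt] := pselect (0 <= t < tau); last by exists (x0, x0).
  by have [w1 [w2 Hw]] := x_prod tt; exists (w1, w2).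
have [f1 f2 f3] := Hw s stau.
apply: (@displaced_product _ _ _ _ _ sX Hab Hac Hbc _ _ _ (fun t => `|t - s|) _ _
  Xi (Xi s) x0 (fun t => (w t).1) (fun t => (w t).2) x _ _ _ (Ka + Kb + Kc)) => //.
- move=> e e0; rewrite near_withinE; apply: (@nearI R R s _ e e0) => t te _; exact: ltW.
- by rewrite !addr_ge0.
- rewrite near_withinE; have bs : 0 < b - s by rewrite subr_gt0.
  apply: (@nearI R R s _ (b - s) bs) => t ts _ d.
  have tb : t < b by move: ts; have := ler_norm (t - s); lra.
  have [_ ->] := xiE d t tb; have [_ ->] := xiE d s sb.
  have ts0 := normr_ge0 (t - s).
  have A1 := mulr_ge0 Ka0 ts0; have B1 := mulr_ge0 Kb0 ts0; have C1 := mulr_ge0 Kc0 ts0.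
  by case: d; [have := HKa s t|have := HKb s t|have := HKc s t]; lra.
- exact: f1.
- exact: f2.
- exact: f3.
- rewrite near_withinE; apply: nearW => t; rewrite /= in_itv /= => tt.
  exact: Hw.
Qed.

Lemma exp_product_cvg s : 0 <= s < tau ->
  x r @[r --> within `[0, tau[ (nbhs s)] --> x s.
Proof. by move=> /displaced_exp_product[]. Qed.

(** The expansion of [displaced_exp_product] is fed into
[primitive_of_expansion].  Replacing the densities of the coordinates by their
values in terms of the controls, the coefficients of the three fields collapse
to the controls: this is what the differential equations of the coordinates are
made for. *)
Lemma exp_product_solution : is_solution X u x0 tau x.
Proof.
split.
- have t0 : (0 : R) <= 0 < tau by apply/andP; split.
  apply: (exp_product_unique sX (x_prod t0)).
  by exists x0, x0; split; rewrite coord_at0; exact: flow0.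
- apply/subspace_continuousP => s; rewrite /= in_itv /= => st.
  exact: exp_product_cvg.
move=> i s t s0 st ttau idom k.
have tm : 0 <= t < Num.min T M^-1 by rewrite (le_trans s0 st) (lt_le_trans ttau).
have [b [v [xi [/andP[tb _] vu xiE _ [pa pb pc]]]]] :=
  coordinates_before M_gt0 u_meas u_bound S_eq tm.
have rng r : s <= r <= t -> 0 <= r < tau /\ r < b.
  by move=> /andP[sr rt]; split; lra.
pose Y d r := X d i (chart A i (x r)) 0 k.
have cY d : {within `[s, t], continuous (Y d)}.
  apply/subspace_continuousP => r; rewrite /= in_itv /= => srt.
  have [rtau rb] := rng r srt.
  have ir := idom r srt.
  have cx : x r' @[r' --> within `[s, t] (nbhs r)] --> x r.
    move=> U xU; have HU : nbhs r [set r' | `[0, tau[%classic r' -> U (x r')].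
      exact: (exp_product_cvg rtau xU).
    suff : nbhs r [set r' | `[s, t]%classic r' -> U (x r')] by [].
    apply: filterS HU => r' /= Hr'; rewrite in_itv /= => sr't; apply: Hr'.
    by rewrite in_itv /=; case: (rng r' sr't).
  apply: (@cvg_comp _ _ _ (fun r' => X d i (chart A i (x r'))) (fun z => z 0 k)); last first.
    exact: coord_continuous.
  apply: (@cvg_comp _ _ _ (fun r' => chart A i (x r')) (X d i)); last first.
    by apply: differentiable_continuous; apply: smooth_field_differentiable => //;
      exact: chart_image_chart.
  by apply: (cvg_comp _ _ cx); exact: chart_continuous.
have cxi d : {within `[s, t], continuous (xi d)}.
  by apply: continuous_subspaceT; case: d; [exact: primitive_continuous pa|
    exact: primitive_continuous pb|exact: primitive_continuous pc].
pose phi d r := match d with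
  | La => Y La r
  | Lb => Y Lb r - 2 * xi La r * Y La r
  | Lc => expR (- 2 * xi Lb r) * (Y Lc r + xi La r * Y Lb r - xi La r ^+ 2 * Y La r)
  end.
pose w d r := match d with
  | La => v La r + 2 * xi La r * v Lb r - xi La r ^+ 2 * v Lc r
  | Lb => v Lb r - xi La r * v Lc r
  | Lc => expR (2 * xi Lb r) * v Lc r
  end.
have integrandE r : s <= r <= t ->
    (\sum_(d : letter) u d r *: X d i (chart A i (x r))) 0 k = \sum_d phi d r * w d r.
  move=> srt; have [/andP[r0 _] rb] := rng r srt.
  have vr d : v d r = u d r by apply: vu; rewrite r0.
  rewrite summxE !sum_letter !mxE -/(Y La r) -/(Y Lb r) -/(Y Lc r) /phi /w !vr.
  have eE : expR (- 2 * xi Lb r) * expR (2 * xi Lb r) = 1.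
    by rewrite -expRD mulNr addNr expR0.
  move: eE; move: (expR (- 2 * xi Lb r)) (expR (2 * xi Lb r)) => e1 e2 eE.
  rewrite [e1 * _ * _]mulrACA eE; ring.
have cst_cont c : {within `[s, t], continuous (fun _ : R => c : R)}.
  by apply: continuous_subspaceT => r; exact: cvg_cst.
have contM (f g : R -> R) : {within `[s, t], continuous f} ->
    {within `[s, t], continuous g} -> {within `[s, t], continuous (fun r => f r * g r)}.
  by move=> cf cg r; apply: cvgM; [exact: cf|exact: cg].
have contD (f g : R -> R) : {within `[s, t], continuous f} ->
    {within `[s, t], continuous g} -> {within `[s, t], continuous (fun r => f r + g r)}.
  by move=> cf cg r; apply: cvgD; [exact: cf|exact: cg].
have contN (f : R -> R) : {within `[s, t], continuous f} ->
    {within `[s, t], continuous (fun r => - f r)}.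
  by move=> cf r; apply: cvgN; exact: cf.
have cphi d : {within `[s, t], continuous (phi d)}.
  case: d; rewrite /phi.
  - exact: cY.
  - by apply: (contD); [exact: cY|apply: (contN); apply: (contM) => //; exact: contM].
  - apply: (contM).
      move=> r; apply: (@continuous_comp _ _ _ (fun r : subspace `[s, t] => - 2 * xi Lb r) expR).
        exact: contM.
      exact: continuous_expR.
    apply: (contD); last by apply: (contN); apply: (contM) => //; exact: contM.
    by apply: (contD) => //; exact: contM.
have tT : t <= T by exact: le_trans (ltW ttau) tauT.
have bu d : bounded_measurable s t (u d).
  split.
    apply: measurable_funS (u_meas d) => //.
    by apply: subset_itv; rewrite bnd_simp.
  exists M => r /andP[sr rt]; apply: u_bound.
  by rewrite (le_trans s0)// (le_trans rt).
split.
  apply: bmeas_integrable.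
  have : bounded_measurable s t (fun r => \sum_d u d r * Y d r).
    by apply: bmeas_sum => d; apply: bmeasM => //; exact: bmeas_continuous.
  congr bounded_measurable; apply/funext => r.
  by rewrite summxE; apply: eq_bigr => d _; rewrite mxE.
rewrite (eq_integral_itv integrandE).
apply: (@primitive_of_expansion R letter s t phi w xi (fun r => chart A i (x r) 0 k)) => //.
  by case.
move=> r srt e e0.
have [rtau rb] := rng r srt.
have [_ /(_ i (idom r srt) e e0)] := displaced_exp_product rtau.
rewrite near_withinE; apply: filterS => r' /= Hr' sr't.
have [r'tau r'b] := rng r' sr't.
have {}Hr' := Hr' r'tau.
apply: le_trans Hr'; set z := (X in _ <= `|X|).
apply: le_trans (rV_coord_le z k); rewrite /z !mxE.
rewrite /field_comb summxE !sum_letter !mxE -/(Y La r) -/(Y Lb r) -/(Y Lc r).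
have xr d := (xiE d r rb).2; have xr' d := (xiE d r' r'b).2.
rewrite /= !letter_eqE !eqxx /= !xr !xr'.
by rewrite le_eqVlt; apply/orP; left; apply/eqP; congr (`|_|); ring.
Qed.

End Existence.
End Solutions.

Theorem proposition4p2 (R : realType) (n : nat) (E : topologicalType)
    (A : smooth_manifold R n E) (X : letter -> local_field A)
    (u : letter -> R -> R) (x0 : E) (T M : R)
    (HX : forall d, smooth_vector_field (X d))
    (Hab : eq_field (lie_bracket (X La) (X Lb)) (scale_field 2 (X La)))
    (Hac : eq_field (lie_bracket (X La) (X Lc)) (scale_field (- 1) (X Lb)))
    (Hbc : eq_field (lie_bracket (X Lb) (X Lc)) (scale_field 2 (X Lc)))
    (HT : 0 < T) (HM : 0 < M)
    (Hmeas : forall d, measurable_fun `[0, T] (u d))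
    (Hbound : forall d t, 0 <= t <= T -> `|u d t| <= M) :
  (exists! S : ncseries R, Sa1_equation S) /\
  forall S : ncseries R, Sa1_equation S ->
  let Xi t d := upsilon u t (coord_series S d) in
  let tmax := Num.min T M^-1 in
  [/\ forall t d, 0 <= t < tmax -> upsilon_cvg u t (coord_series S d),
      exists2 eps, 0 < eps <= tmax &
        forall t, 0 <= t < eps -> exists q, exp_product X (Xi t) x0 q &
      forall tau, 0 < tau <= tmax ->
        (forall t, 0 <= t < tau -> exists q, exp_product X (Xi t) x0 q) ->
        exists x : R -> E,
          [/\ forall t, 0 <= t < tau ->
                forall q, exp_product X (Xi t) x0 q <-> q = x t,
              is_solution X u x0 tau x &
              forall y, is_solution X u x0 tau y ->
                forall t, 0 <= t < tau -> y t = x t]].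
Proof.
split; first exact: Sa1_exists_unique.
move=> S S_eq Xi tmax.
have tmax0 : 0 < tmax by rewrite lt_min HT invr_gt0.
split.
- move=> t d tt.
  have [b [v [xi [/andP[tb _] _ xiE _ _]]]] := coordinates_before HM Hmeas Hbound S_eq tt.
  exact: (xiE d t tb).1.
- have t0 : (0 : R) <= 0 < tmax by apply/andP; split.
  have [b [v [xi [/andP[b0 bm] _ xiE xi0 [pa pb pc]]]]] :=
    coordinates_before HM Hmeas Hbound S_eq t0.
  have [e e0 He] := exp_product_local HX x0.
  have small d : \forall t \near (0 : R), `|xi d t| < e.
    have cxi : continuous (xi d).
      by case: d; [exact: primitive_continuous pa|exact: primitive_continuous pb|
        exact: primitive_continuous pc].
    have /cvgrPdist_lt/(_ _ e0) := cxi 0; apply: filterS => t.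
    by rewrite xi0 sub0r normrN.
  have [r r0 Hr] := (nearP _ _).1 (filter_forall _ small).
  exists (Num.min r b).
    by rewrite lt_min r0 b0 /= ge_min (ltW bm) orbT.
  move=> t /andP[t_ge0]; rewrite lt_min => /andP[tr tb]; apply: He => d.
  rewrite /Xi (xiE d t tb).2; apply: Hr.
  by rewrite subr0 ger0_norm.
move=> tau /andP[tau0 taum] Hex.
have tauT : tau <= T by apply: le_trans taum _; rewrite ge_min lexx.
have /choice[x Hx] t : exists q, 0 <= t < tau -> exp_product X (Xi t) x0 q.
  have [tt|nt] := pselect (0 <= t < tau); last by exists x0.
  by have [q Hq] := Hex t tt; exists q.
have solx : is_solution X u x0 tau x.
  exact: (exp_product_solution HX HM Hbound tauT Hab Hac Hbc Hmeas S_eq tau0 taum Hx).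
exists x; split => //.
- move=> t tt q; split=> [Hq|->]; last exact: Hx.
  exact: (exp_product_unique HX Hq (Hx t tt)).
- move=> y soly t tt.
  exact: (solution_unique HX HM Hbound tauT solx soly tt).
Qed.
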